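(* Let $p\in(0,2]$ and let $K\subset\mathbb{R}^d$ be a symmetric star body in Lewis' position for $p$. Let $l\in(0,d)$ and let $(\mathbb{R}^d,\|\cdot\|)$ be a quasi-normed space that embeds in $L_{-l}$. If $Y=(Y_1,\ldots,Y_n)$ is a random vector uniformly distributed on $B_p^n(K)\subset(\mathbb{R}^d)^n$, then the function $$[0,+\infty)^n\ni(a_1,\ldots,a_n)\mapsto\mathbb{E}\left\|\sqrt{a_1}Y_1+\cdots+\sqrt{a_n}Y_n\right\|^{-l}$$ is log-convex.
   Context: A set $K\subset\mathbb{R}^d$ is a star body if it is compact, $tx\in K$ for all $x\in K$, $t\in[0,1]$, and its Minkowski functional $\|x\|_K=\inf\{\lambda>0:x\in\lambda K\}$ is (finite and) continuous; symmetric means $K=-K$. Quasi-norms on $\mathbb{R}^d$ are Minkowski functionals of symmetric star bodies. $K$ is in Lewis' position (for $p$) if there is a Borel measure $\nu$ on $S^{d-1}$ that is isotropic, i.e. $\int_{S^{d-1}}u\otimes u\,\nu(du)=I_d$ where $(u\otimes u)(x)=\langle u,x\rangle u$, and such that $\|x\|_K^p=\int_{S^{d-1}}|\langle x,u\rangle|^p\,d\nu(u)$ for all $x$. $B_p^n(K)=\{x\in(\mathbb{R}^d)^n:\sum_{i=1}^n\|x_i\|_K^p\le1\}$. Fourier transform: $\hat f(x)=\int_{\mathbb{R}^d}f(y)e^{-2\pi i\langle x,y\rangle}dy$. For $l\in(0,d)$, $(\mathbb{R}^d,\|\cdot\|)$ embeds in $L_{-l}$ if there is a finite Borel measure $\sigma_l$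 on $S^{d-1}$ such that for every even Schwartz function $\psi$, $\int_{\mathbb{R}^d}\|x\|^{-l}\psi(x)dx=\int_0^\infty\int_{S^{d-1}}t^{l-1}\hat\psi(t\theta)\,d\sigma_l(\theta)\,dt$. A function $f:C\to[0,+\infty]$ on a convex set is log-convex if $f(\lambda x+(1-\lambda)y)\le f(x)^\lambda f(y)^{1-\lambda}$ for all $x,y\in C$, $\lambda\in(0,1)$; convention $\|0\|^{-l}=+\infty$, so the function above equals $+\infty$ at $a=0$. *)

(* Defs.v *)
From HB Require Import structures.
From mathcomp Require Import all_boot all_order all_algebra.
From mathcomp Require Import complex.
From mathcomp Require Import all_classical all_reals all_analysis.
From mathcomp Require Import measurable_realfun.

Set Implicit Arguments.
Unset Strict Implicit.
Unset Printing Implicit Defensive.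

Import Order.TTheory GRing.Theory Num.Theory.
Import numFieldNormedType.Exports.

Local Open Scope classical_set_scope.
Local Open Scope ring_scope.

(* The Borel sigma-algebra on matrices; vectors of R^d are row vectors
   'rV[R]_d and elements of (R^d)^n are n x d matrices. *)
HB.instance Definition _ (R : realType) (m n : nat) :=
  Measurable.copy 'M[R]_(m, n) (g_sigma_algebraType (@open 'M[R]_(m, n))).

(* [product_measure1] gets its canonical [sigma_finite_measure] structure only
   from subprobabilities, and [pushforward] gets none; both are redone here. *)
Section sigma_finite_pushforward.
Context d1 d2 (T1 : measurableType d1) (T2 : measurableType d2) (R : realType).

Lemma pushforward_set0 (mu : {measure set T1 -> \bar R}) (f : T1 -> T2) :
  pushforward mu f set0 = 0%E.
Proof. by rewrite /pushforward preimage_set0 measure0. Qed.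

Lemma pushforward_ge0 (mu : {measure set T1 -> \bar R}) (f : T1 -> T2) A :
  (0 <= pushforward mu f A)%E.
Proof. by rewrite /pushforward measure_ge0. Qed.

Lemma pushforward_semi_sigma_additive (mu : {measure set T1 -> \bar R})
    (f : T1 -> T2) :
  measurable_fun setT f -> semi_sigma_additive (pushforward mu f).
Proof.
move=> mf F mF tF mUF; rewrite /pushforward preimage_bigcup.
apply: measure_semi_sigma_additive.
- by move=> n; rewrite -[X in measurable X]setTI; exact: mf.
- apply/trivIsetP => /= i j _ _ ij; rewrite -preimage_setI.
  by move/trivIsetP : tF => /(_ _ _ _ _ ij) ->//; rewrite preimage_set0.
- by rewrite -preimage_bigcup -[X in measurable X]setTI; exact: mf.
Qed.

Lemma sigma_finite_pushforward
    (mu : set T1 -> \bar R) (f : T1 -> T2) (g : T2 -> T1) :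
    measurable_fun setT g -> cancel f g -> sigma_finite setT mu ->
  sigma_finite setT (pushforward mu f).
Proof.
move=> mg fK [F FT Foo].
exists (fun k => g @^-1` F k).
  by rewrite -preimage_bigcup -FT preimage_setT.
move=> k; have [mFk Fkoo] := Foo k; split.
  by rewrite -[X in measurable X]setTI; exact: mg.
rewrite /pushforward -comp_preimage (_ : g \o f = id) ?preimage_id//.
exact/funext.
Qed.

Lemma sigma_finite_product (m1 : {sigma_finite_measure set T1 -> \bar R})
    (m2 : {sigma_finite_measure set T2 -> \bar R}) :
  sigma_finite setT (m1 \x m2)%E.
Proof.
have /sigma_finiteP[F [TF ndF Foo]] := sigma_finiteT m1.
have /sigma_finiteP[G [TG ndG Goo]] := sigma_finiteT m2.
exists (fun n => F n `*` G n).
  rewrite -setXTT TF TG predeqE => -[x y]; split.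
    move=> [/= [n _ Fnx] [k _ Gky]]; exists (maxn n k) => //; split.
    - by move: x Fnx; exact/subsetPset/ndF/leq_maxl.
    - by move: y Gky; exact/subsetPset/ndG/leq_maxr.
  by move=> [n _ []/= ? ?]; split; exists n.
move=> k; have [? ?] := Foo k; have [? ?] := Goo k.
split; first exact: measurableX.
by rewrite product_measure1E// lte_mul_pinfty// ge0_fin_numE.
Qed.

End sigma_finite_pushforward.

Section lebesgue_tuple.
Variable R : realType.
Local Notation bR := (measurableTypeR R).

Definition tuple_of_pair n (z : bR * n.-tuple bR) : n.+1.-tuple bR :=
  [tuple of z.1 :: z.2].

Lemma measurable_tuple_of_pair n : measurable_fun setT (@tuple_of_pair n).
Proof. exact: measurable_cons. Qed.

Definition pair_of_tuple n (t : n.+1.-tuple bR) : bR * n.-tuple bR :=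
  (tnth t ord0, [tuple of behead t]).

Lemma measurable_pair_of_tuple n : measurable_fun setT (@pair_of_tuple n).
Proof.
apply: measurable_fun_pair; [exact: measurable_tnth|exact: measurable_behead].
Qed.

Lemma tuple_of_pairK n : cancel (@tuple_of_pair n) (@pair_of_tuple n).
Proof. by move=> [x t]; congr pair; apply/val_inj. Qed.

Definition lebesgue_tupleS n (mu : {sigma_finite_measure set (n.-tuple bR) -> \bar R})
  : set (n.+1.-tuple bR) -> \bar R :=
  pushforward (lebesgue_measure \x mu)%E (@tuple_of_pair n).

Section instances.
Variables (n : nat) (mu : {sigma_finite_measure set (n.-tuple bR) -> \bar R}).

HB.instance Definition _ := isMeasure.Build _ _ _ (lebesgue_tupleS mu)
  (pushforward_set0 _ _) (pushforward_ge0 _ _)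
  (pushforward_semi_sigma_additive (@measurable_tuple_of_pair n)).

HB.instance Definition _ := @Measure_isSigmaFinite.Build _ _ _
  (lebesgue_tupleS mu)
  (sigma_finite_pushforward (@measurable_pair_of_tuple n) (@tuple_of_pairK n)
    (sigma_finite_product lebesgue_measure mu)).
End instances.

(* The n-fold product of [lebesgue_measure]; see [lebesgue_tuple_rectangle]. *)
Fixpoint lebesgue_tuple n : {sigma_finite_measure set (n.-tuple bR) -> \bar R} :=
  if n is k.+1 then lebesgue_tupleS (lebesgue_tuple k) else \d_[tuple].


Lemma lebesgue_tuple_rectangle n (A : 'I_n -> set R) :
    (forall i, measurable (A i)) ->
  lebesgue_tuple n [set t | forall i, A i (tnth t i)] =
  (\prod_(i < n) lebesgue_measure (A i))%E.
Proof.
elim: n A => [|n IH] A mA.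
  rewrite big_ord0/= diracE mem_set//.
  by case.
rewrite big_ord_recl -IH; last by move=> i; exact: (mA (lift ord0 i)).
have mB : measurable [set t : n.-tuple bR | forall i, A (lift ord0 i) (tnth t i)].
  rewrite [X in measurable X](_ : _ = \bigcap_(i in setT)
      (fun t : n.-tuple bR => tnth t i) @^-1` A (lift ord0 i)).
    apply: fin_bigcap_measurable => // i _; rewrite -[X in measurable X]setTI.
    by apply: measurable_tnth => //; exact: (mA (lift ord0 i)).
  by apply/seteqP; split => t /= h i => [_|]; exact: h.
rewrite -(product_measure1E lebesgue_measure _ (mA ord0) mB).
apply: (congr1 (lebesgue_measure \x lebesgue_tuple n)%E).
apply/seteqP; split => -[x t] /=.
  move=> h; split; first exact: (h ord0).
  by move=> i; have := h (lift ord0 i); rewrite tnthS.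
move=> [hx ht] i; have [->//|i0] := eqVneq i ord0.
case: (unliftP ord0 i) i0 => [j ->|->]; last by rewrite eqxx.
by move=> _; rewrite tnthS.
Qed.

End lebesgue_tuple.
Arguments lebesgue_tuple {R} n.

Section lebesgue_mx.
Variables (R : realType) (m n : nat).
Local Notation bR := (measurableTypeR R).

Definition mx_of_tuple (t : (m * n).-tuple bR) : 'M[R]_(m, n) :=
  \matrix_(i, j) tnth t (mxvec_index i j).

Definition tuple_of_mx (X : 'M[R]_(m, n)) : (m * n).-tuple bR :=
  [tuple mxvec X ord0 k | k < m * n].

Lemma mx_of_tupleK : cancel mx_of_tuple tuple_of_mx.
Proof.
move=> t; apply: eq_from_tnth => k; rewrite tnth_mktuple.
by case/mxvec_indexP: k => i j; rewrite mxvecE mxE.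
Qed.

Lemma measurable_tuple_of_mx : measurable_fun setT tuple_of_mx.
Proof.
apply/measurable_fun_tnthP => k.
rewrite (_ : _ \o _ = fun X : 'M[R]_(m, n) => mxvec X ord0 k); last first.
  by apply/funext => X /=; rewrite tnth_mktuple.
case/mxvec_indexP: k => i j; under eq_fun do rewrite mxvecE.
apply: (measurability _ (RGenOInfty.measurableE R)).
move=> _ [_ [a ->] <-]; rewrite setTI.
apply: sub_sigma_algebra; apply: open_comp; last exact: interval_open.
by move=> X _; exact: coord_continuous.
Qed.

Lemma measurable_mx_of_tuple : measurable_fun setT mx_of_tuple.
Proof.
apply: (measurability _ (erefl : measurable = <<s @open 'M[R]_(m, n) >>)).
move=> _ [U oU <-]; rewrite setTI.
pose box (q : 'M[rat]_(m, n) * nat) := [set X : 'M[R]_(m, n) |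
  forall i j, `|X i j - ratr (q.1 i j)| < q.2.+1%:R^-1].
have -> : mx_of_tuple @^-1` U = \bigcup_q (
    if `[< box q `<=` U >] then mx_of_tuple @^-1` box q else set0).
  apply/seteqP; split => [t Ut|t [q _]]; last first.
    by case: asboolP => // bU /bU.
  have /nbhs_ballP[e /= e0 eU] : nbhs (mx_of_tuple t) U.
    exact: open_nbhs_nbhs.
  pose k := Num.truncn (2 / e).
  have ke : k.+1%:R^-1 < e / 2.
    by rewrite -[e / 2]invf_div ltf_pV2 ?posrE ?divr_gt0// truncnS_gt.
  have H i j : exists q : rat, `|mx_of_tuple t i j - ratr q| < k.+1%:R^-1.
    have : mx_of_tuple t i j - k.+1%:R^-1 < mx_of_tuple t i j + k.+1%:R^-1.
      by rewrite ltrD2l gtrN.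
    move=> /rat_in_itvoo[q]; rewrite in_itv/= => /andP[q1 q2]; exists q.
    by rewrite ltr_distlC q1.
  have {}H i : {f : 'I_n -> rat & forall j,
    `|mx_of_tuple t i j - ratr (f j)| < k.+1%:R^-1}.
    by exists (fun j => sval (cid (H i j))) => j; case: cid.
  pose q : 'M[rat]_(m, n) := \matrix_(i, j) projT1 (H i) j.
  have bt : box (q, k) (mx_of_tuple t).
    by move=> i j /=; rewrite [q i j]mxE; exact: (projT2 (H i) j).
  exists (q, k) => //; case: asboolP => // -[] X bX; apply: eU.
  split=> // i j; rewrite /ball/= (splitr e).
  have -> : mx_of_tuple t i j - X i j =
    (mx_of_tuple t i j - ratr (q i j)) - (X i j - ratr (q i j)).
    by rewrite opprB addrA subrK.
  rewrite (le_lt_trans (ler_normB _ _))// ltrD//.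
    exact: lt_trans (bt i j) ke.
  exact: lt_trans (bX i j) ke.
apply: countable_bigcupT_measurable; first exact: countableP.
move=> q; case: asboolP => // _.
rewrite (_ : _ @^-1` _ = \bigcap_(ij in [set: 'I_m * 'I_n])
    (fun t : (m * n).-tuple bR => tnth t (mxvec_index ij.1 ij.2)) @^-1`
       ball (ratr (q.1 ij.1 ij.2) : R) q.2.+1%:R^-1).
  apply: fin_bigcap_measurable => // ij _.
  rewrite -[X in measurable X]setTI; apply: measurable_tnth => //.
  exact: measurable_ball.
apply/seteqP; split => t /= h.
  by move=> [i j] _; have := h i j; rewrite mxE/= distrC.
by move=> i j; have := h (i, j) I; rewrite mxE/= distrC.
Qed.

Definition lebesgue_mx : set 'M[R]_(m, n) -> \bar R :=
  pushforward (lebesgue_tuple (m * n)) mx_of_tuple.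

HB.instance Definition _ := isMeasure.Build _ _ _ lebesgue_mx
  (pushforward_set0 _ _) (pushforward_ge0 _ _)
  (pushforward_semi_sigma_additive measurable_mx_of_tuple).

HB.instance Definition _ := @Measure_isSigmaFinite.Build _ _ _ lebesgue_mx
  (sigma_finite_pushforward measurable_tuple_of_mx mx_of_tupleK
    (sigma_finiteT (lebesgue_tuple (m * n)))).

Lemma lebesgue_mx_rectangle (A : 'I_m -> 'I_n -> set R) :
    (forall i j, measurable (A i j)) ->
  lebesgue_mx [set X | forall i j, A i j (X i j)] =
  (\prod_(i < m) \prod_(j < n) lebesgue_measure (A i j))%E.
Proof.
move=> mA; pose ij (k : 'I_(m * n)) : 'I_m * 'I_n := mxvec_indexP k.
have ijE k : uncurry (@mxvec_index m n) (ij k) = k.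
  by rewrite /ij; case: _ / (mxvec_indexP k).
have ijK i j : ij (mxvec_index i j) = (i, j).
  have idx : injective (uncurry (@mxvec_index m n)).
    by apply: (can_inj (g := enum_val \o cast_ord (esym (mxvec_cast m n)))) =>
      -[a b] /=; rewrite cast_ordK enum_rankK.
  by apply: idx; rewrite ijE.
transitivity (\prod_(k < m * n) lebesgue_measure (A (ij k).1 (ij k).2))%E.
  rewrite -lebesgue_tuple_rectangle//; congr (lebesgue_tuple _ _).
  apply/seteqP; split => t /= h.
    move=> k; case/mxvec_indexP: k => i j; rewrite ijK.
    by have := h i j; rewrite mxE.
  by move=> i j; rewrite mxE; have := h (mxvec_index i j); rewrite ijK.
rewrite pair_bigA/= (reindex _ (curry_mxvec_bij m n))/=.
by apply: eq_bigr => -[i j] _; rewrite ijK.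
Qed.

End lebesgue_mx.
Arguments lebesgue_mx {R m n}.

Section euclidean.
Variables (R : realType) (d : nat).
Implicit Types x y : 'rV[R]_d.

Definition dotv x y : R := \sum_(i < d) x ord0 i * y ord0 i.

(* The library norm on 'rV[R]_d is the sup norm, hence the use of [dotv]. *)
Definition sphere : set 'rV[R]_d := [set u | dotv u u = 1].

(* A Borel measure on the sphere is represented by a Borel measure on R^d
   that does not charge the complement of the sphere. *)
Definition carried_by_sphere (nu : set 'rV[R]_d -> \bar R) :=
  nu (~` sphere) = 0%E.

End euclidean.
Arguments sphere {R d}.

Section star_bodies.
Variables (R : realType) (d : nat).
Implicit Types (K : set 'rV[R]_d) (N : 'rV[R]_d -> R).

Definition dilations K (x : 'rV[R]_d) : set R :=
  [set t | 0 < t /\ ((fun y => t *: y) @` K) x].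

(* [inf] is real-valued, with [inf set0 = 0]: finiteness of the functional at
   [x] is the non-emptiness of [dilations K x]. *)
Definition minkowski K (x : 'rV[R]_d) : R := inf (dilations K x).

Definition star_body K :=
  [/\ compact K,
      (forall x t, K x -> 0 <= t <= 1 -> K (t *: x)),
      (forall x, dilations K x !=set0) &
      continuous (minkowski K)].

Definition symmetric_set K := K = -%R @` K.

Definition quasi_norm N :=
  exists L, [/\ star_body L, symmetric_set L & N = minkowski L].

Definition isotropic (nu : {measure set 'rV[R]_d -> \bar R}) :=
  forall i j : 'I_d,
    (\int[nu]_(u in sphere) ((u^T *m u) i j)%:E = ((1%:M : 'M[R]_d) i j)%:E)%E.

Definition lewis_position (p : R) K :=
  exists nu : {measure set 'rV[R]_d -> \bar R},
    [/\ carried_by_sphere nu, isotropic nu &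
        forall x, (((minkowski K x) `^ p)%:E =
          \int[nu]_(u in sphere) (`|dotv x u| `^ p)%:E)%E].

Definition Bpn (n : nat) (p : R) K : set 'M[R]_(n, d) :=
  [set X | \sum_(i < n) (minkowski K (row i X)) `^ p <= 1].

End star_bodies.
Arguments Bpn {R d} n p K.

Section fourier.
Variables (R : realType) (d : nat).
Local Open Scope complex_scope.

Definition Cintegral dT (T : measurableType dT) (mu : {measure set T -> \bar R})
    (D : set T) (f : T -> R[i]) : R[i] :=
  (\int[mu]_(x in D) complex.Re (f x)) +i* (\int[mu]_(x in D) complex.Im (f x)).

Definition expi (t : R) : R[i] := cos t +i* sin t.

Definition fourier (f : 'rV[R]_d -> R[i]) (x : 'rV[R]_d) : R[i] :=
  Cintegral lebesgue_mx setT (fun y => f y * expi (- (2 * pi * dotv x y))).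

Fixpoint iter_partial (s : seq 'I_d) (g : 'rV[R]_d -> R) : 'rV[R]_d -> R :=
  if s is i :: s' then 'D_(delta_mx ord0 i) (iter_partial s' g) else g.

Definition smooth (g : 'rV[R]_d -> R) := forall s,
  continuous (iter_partial s g) /\
  forall i x, derivable (iter_partial s g) x (delta_mx ord0 i).

Definition schwartz_real (g : 'rV[R]_d -> R) := smooth g /\
  forall (s : seq 'I_d) (k : 'I_d -> nat), exists M : R,
    forall x : 'rV[R]_d,
    `|(\prod_(i < d) x ord0 i ^+ k i) * iter_partial s g x| <= M.

Definition schwartz (f : 'rV[R]_d -> R[i]) :=
  schwartz_real (fun x => complex.Re (f x)) /\
  schwartz_real (fun x => complex.Im (f x)).

(* With [powR] the weight [N x `^ (- l)] is [0] rather than [+oo] at the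
   origin, which is a Lebesgue null set. *)
Definition embeds_in_Lneg (l : R) (N : 'rV[R]_d -> R) :=
  exists sigma : {finite_measure set 'rV[R]_d -> \bar R},
    carried_by_sphere sigma /\
    forall psi : 'rV[R]_d -> R[i], schwartz psi -> (forall x, psi (- x) = psi x) ->
      Cintegral lebesgue_mx setT (fun x => (N x `^ (- l))%:C * psi x) =
      Cintegral lebesgue_measure `]0, +oo[ (fun t =>
        Cintegral sigma sphere (fun theta =>
          (t `^ (l - 1))%:C * fourier psi (t *: theta))).

End fourier.

Section probabilistic.
Variable R : realType.

(* Meaningful when [0 < lebesgue_mx B < +oo]. *)
Definition uniform_on (m n : nat) dO (Omega : measurableType dO)
    (P : probability Omega R) (Y : {RV P >-> 'M[R]_(m, n)})
    (B : set 'M[R]_(m, n)) :=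
  forall A, measurable A ->
    distribution P Y A = (lebesgue_mx (A `&` B) / lebesgue_mx B)%E.

(* r^{-l} with 0^{-l} = +oo; [powR] alone would give 0. *)
Definition neg_power (l r : R) : \bar R :=
  if r == 0 then +oo%E else (r `^ (- l))%:E.

Definition log_convex_on (V : lmodType R) (C : set V) (f : V -> \bar R) :=
  forall (x y : V) (t : R), C x -> C y -> 0 < t < 1 ->
    (f (t *: x + (1 - t) *: y)%R <= f x `^ t * f y `^ (1 - t)%R)%E.

End probabilistic.

(* Main.v *)
Require Import Defs.
From HB Require Import structures.
From mathcomp Require Import all_boot all_order all_algebra.
From mathcomp Require Import complex.
From mathcomp Require Import all_classical all_reals all_analysis.
From mathcomp Require Import measurable_realfun ring lra.

Set Implicit Arguments.
Unset Strict Implicit.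
Unset Printing Implicit Defensive.

Import Order.TTheory GRing.Theory Num.Theory.
Import numFieldNormedType.Exports.

Local Open Scope classical_set_scope.
Local Open Scope ring_scope.

(* If the density of the matrix [X] is a centred Gaussian density with
   independent rows, the embedding formula turns the integral of
   [|| \sum_i c_i x_i ||^-l] into an integral over directions and radii of
   [exp (- \sum_i c_i^2 b_i(xi, xi))], where [b_i] is the covariance of row [i].
   In the variables [a_i = c_i^2] this is a mixture of exponentials of linear
   functions, hence log-convex. Log-convexity survives mixtures and limits of the
   density. As [|s|^p] is, for [p < 2], a positive mixture of the functions
   [1 - exp (- r s^2)], the density [exp (- \sum_i ||x_i||_K^p)] of a body in
   Lewis position is such a limit of mixtures; for [p = 2] it is itself Gaussian.
   By homogeneity, integrating against this density or over the ball
   [\sum_i ||x_i||_K^p <= 1] differs only by a constant factor. *)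

(** * The Gaussian integral on the line *)

(** Three obstacles shape the argument. The embedding formula tests only even functions on R^d,
    whereas the combination of the rows depends on all of them and, given all rows but one, is not
    centred. So the formula is applied to one row with a nonzero coefficient, the others being
    frozen, and its density is symmetrised. Next, cosines change sign: transforms are computed with
    [1 + cos], so that Tonelli's theorem applies in the extended reals, and the extra terms, which
    are finite, are cancelled afterwards. Finally, [f <= g^t h^(1-t)] is not linear in the density.
    It is replaced by Young inequalities with weights [t e^((t-1)r)] and [(1-t) e^(tr)], one for
    each real r; these pass to sums, mixtures and limits, and the best r gives back the geometric
    mean.

    That exp(-\int w (1 - theta)) is a mixture of Gaussians when the theta are Gaussian factors
    comes from the exponential series of \int w theta: its terms are mixtures of products of
    Gaussian factors, hence of Gaussians. A damping factor exp(-e^2 |X|^2) keeps the integrals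
    finite meanwhile. *)

Section push_measure.
Context d1 d2 (T1 : measurableType d1) (T2 : measurableType d2) (R : realType).
Variables (mu : {measure set T1 -> \bar R}) (phi : T1 -> T2).
Hypothesis mphi : measurable_fun setT phi.

Definition push_measure : {measure set T2 -> \bar R} :=
  measure_function_pushforward__canonical__measure_function_Measure mu mphi.

Lemma ge0_integral_comp (f : T2 -> \bar R) :
  measurable_fun setT f -> (forall y, 0 <= f y)%E ->
  (\int[mu]_x f (phi x) = \int[push_measure]_y f y)%E.
Proof. by move=> mf f0; rewrite (ge0_integral_pushforward mphi). Qed.

End push_measure.

Section affine_lebesgue.
Context {R : realType}.
Local Notation mu := (@lebesgue_measure R).

Lemma ge0_integral_lebesgue_opp (f : measurableTypeR R -> \bar R) :
  measurable_fun setT f -> (forall x, 0 <= f x)%E ->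
  (\int[mu]_x f (- x)%R = \int[mu]_x f x)%E.
Proof.
move=> mf f0.
have mN : measurable_fun setT (-%R : measurableTypeR R -> measurableTypeR R).
  exact: oppr_measurable.
rewrite (ge0_integral_comp mu mN)//.
by apply: eq_measure_integral => //= A mA _; exact: lebesgue_measureN.
Qed.

(** The image of Lebesgue measure under the affine map, multiplied by [r], gives every half-open
    interval its length, hence is Lebesgue measure. *)
Lemma ge0_integral_lebesgue_affine_pos (r c : R) (f : measurableTypeR R -> \bar R) :
  0 < r -> measurable_fun setT f -> (forall x, 0 <= f x)%E ->
  (\int[mu]_x f (r * x + c)%R = (r^-1)%:E * \int[mu]_x f x)%E.
Proof.
move=> r0 mf f0.
pose phi : measurableTypeR R -> measurableTypeR R := fun x => r * x + c.
have mphi : measurable_fun setT phi.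
  by apply: measurable_funD => //; apply: measurable_funM.
rewrite (ge0_integral_comp mu mphi)//.
pose nu := mscale (NngNum (ltW r0)) (push_measure mu mphi).
transitivity ((r^-1)%:E * \int[nu]_x f x)%E.
  rewrite ge0_integral_mscale//= muleA -EFinM mulVf ?gt_eqF// mul1e//.
congr (_ * _)%E; apply/esym/eq_measure_integral => A mA _.
apply: (lebesgue_measure_unique (mu := nu)) => //= _ [[a b]] _ <-.
rewrite /nu /mscale /= /pushforward.
have -> : phi @^-1` `]a, b] = `](a - c) / r, (b - c) / r]%classic.
  apply/seteqP; split => x /=; rewrite /phi !in_itv/= ltr_pdivrMr// ler_pdivlMr//;
    by rewrite ltrBlDr lerBrDr (mulrC x).
rewrite !lebesgue_measure_itv/= !lte_fin ltr_pM2r ?invr_gt0// ltrD2r.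
case: ifP => _; last by rewrite mule0.
rewrite -!EFinB -EFinM; congr EFin; field; exact: lt0r_neq0.
Qed.

Lemma ge0_integral_lebesgue_affine (r c : R) (f : measurableTypeR R -> \bar R) :
  r != 0 -> measurable_fun setT f -> (forall x, 0 <= f x)%E ->
  (\int[mu]_x f (r * x + c)%R = (`|r|^-1)%:E * \int[mu]_x f x)%E.
Proof.
move=> r0 mf f0; have [rpos|rneg|/eqP] := ltgtP 0 r; last by rewrite eq_sym (negbTE r0).
  by rewrite gtr0_norm// ge0_integral_lebesgue_affine_pos.
rewrite ltr0_norm// -ge0_integral_lebesgue_opp.
- under eq_integral do rewrite mulrN -mulNr.
  by apply: ge0_integral_lebesgue_affine_pos => //; rewrite oppr_gt0.
- apply: (measurableT_comp mf); apply: measurable_funD => //; exact: measurable_funM.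
- by move=> x.
Qed.

End affine_lebesgue.

Section gauss_fourier.
Context {R : realType}.
Local Notation mu := (@lebesgue_measure R).

Lemma integral_gauss_affine (r c : R) : r != 0 ->
  (\int[mu]_x (expR (- (r * x + c) ^+ 2))%:E = (`|r|^-1 * Num.sqrt pi)%:E)%E.
Proof.
move=> r0.
rewrite (@ge0_integral_lebesgue_affine _ r c (fun x => (gauss_fun x)%:E))//.
- by rewrite integralT_gauss EFinM.
- by apply/measurable_EFinP; exact: measurable_gauss_fun.
- by move=> x; rewrite lee_fin gauss_fun_ge0.
Qed.

Lemma integrable_gauss_affine (r c : R) : r != 0 ->
  mu.-integrable setT (fun x : R => (expR (- (r * x + c) ^+ 2))%:E).
Proof.
move=> r0; apply/integrableP; split.
  apply/measurable_EFinP; apply: measurableT_comp => //.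
  apply: measurableT_comp => //; apply: measurable_funX.
  by apply: measurable_funD => //; exact: measurable_funM.
under eq_integral do rewrite gee0_abs ?lee_fin ?expR_ge0//.
by rewrite integral_gauss_affine// ltry.
Qed.

Lemma integrable_gauss_half :
  mu.-integrable setT (fun x : R => (expR (- (x ^+ 2 / 2)))%:E).
Proof.
have s0 : Num.sqrt (2^-1 : R) != 0 by rewrite gt_eqF// sqrtr_gt0 invr_gt0.
apply: eq_integrable (integrable_gauss_affine 0 s0) => // x _.
by rewrite addr0 exprMn sqr_sqrtr ?invr_ge0// mulrC.
Qed.

Lemma normr_le_expR_half (x : R) : `|x| <= expR (x ^+ 2 / 2).
Proof.
apply: le_trans (expR_ge1Dx _).
rewrite -(real_normK (num_real x)).
have := sqr_ge0 (`|x| - 1); lra.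
Qed.

(** Half of the Gaussian exponent absorbs the factor [|x|]. The bound is integrable and free of the
    frequency, as differentiation under the integral sign requires. *)
Lemma normrM_gauss_le (x : R) : `|x| * expR (- x ^+ 2) <= expR (- (x ^+ 2 / 2)).
Proof.
have -> : - x ^+ 2 = - (x ^+ 2 / 2) - x ^+ 2 / 2 by field.
rewrite expRD mulrCA ler_piMr ?expR_ge0// -ler_pdivlMr ?expR_gt0// mul1r -expRN opprK.
exact: normr_le_expR_half.
Qed.

Let F (xi : R) := \int[mu]_x (cos (xi * x) * expR (- x ^+ 2)).

Lemma integrable_bounded_gauss_half (f : R -> R) (M : R) :
  measurable_fun setT f -> (forall x, `|f x| <= M * expR (- (x ^+ 2 / 2))) ->
  mu.-integrable setT (EFin \o f).
Proof.
move=> mf fM.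
apply: (le_integrable measurableT) (integrableZl measurableT M integrable_gauss_half).
- exact/measurable_EFinP.
- move=> x _; rewrite -EFinM !abse_EFin lee_fin.
  by apply: le_trans (fM x) _; exact: ler_norm.
Qed.

Lemma gauss_le_half (x : R) : expR (- x ^+ 2) <= expR (- (x ^+ 2 / 2)).
Proof. by rewrite ler_expR lerN2 ler_pdivrMr// ler_peMr ?sqr_ge0// ler1n. Qed.

Let mgauss : measurable_fun setT (fun x : R => expR (- x ^+ 2)).
Proof. exact: measurable_gauss_fun. Qed.

Let mcos (xi : R) : measurable_fun setT (fun x : R => cos (xi * x)).
Proof.
apply: continuous_measurable_fun => x; apply: continuous_comp.
  exact: mulrl_continuous.
exact: continuous_cos.
Qed.

Let msin (xi : R) : measurable_fun setT (fun x : R => sin (xi * x)).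
Proof.
apply: continuous_measurable_fun => x; apply: continuous_comp.
  exact: mulrl_continuous.
exact: continuous_sin.
Qed.

Lemma normr_cos_le1 (x : R) : `|cos x| <= 1.
Proof. by rewrite ler_norml cos_geN1 cos_le1. Qed.

Lemma normr_sin_le1 (x : R) : `|sin x| <= 1.
Proof. by rewrite ler_norml sin_geN1 sin_le1. Qed.

Let int_cos (xi : R) :
  mu.-integrable setT (fun x : R => (cos (xi * x) * expR (- x ^+ 2))%:E).
Proof.
apply: (@integrable_bounded_gauss_half _ 1); first exact: measurable_funM.
move=> x; rewrite mul1r normrM (ger0_norm (expR_ge0 _)).
apply: le_trans (gauss_le_half x).
by rewrite ler_piMl ?expR_ge0// normr_cos_le1.
Qed.

Let int_sin (xi : R) :
  mu.-integrable setT (fun x : R => (x * sin (xi * x) * expR (- x ^+ 2))%:E).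
Proof.
apply: (@integrable_bounded_gauss_half _ 1).
  by apply: measurable_funM => //; apply: measurable_funM.
move=> x; rewrite mul1r !normrM (ger0_norm (expR_ge0 _)).
apply: le_trans (normrM_gauss_le x).
by rewrite ler_wpM2r ?expR_ge0// ler_piMr// normr_sin_le1.
Qed.

Let is_derive_cos_gauss (a : R) :
  is_derive a 1 F (- \int[mu]_x (x * sin (a * x) * expR (- x ^+ 2))).
Proof.
pose f (xi x : R) := cos (xi * x) * expR (- x ^+ 2).
have df (xi x : R) : is_derive xi 1 (f ^~ x) (- (x * sin (xi * x) * expR (- x ^+ 2))).
  rewrite /f; apply: is_derive_eq.
  by rewrite /GRing.scale/= ; ring.
have dfE (xi x : R) : partial1of2 f xi x = - (x * sin (xi * x) * expR (- x ^+ 2)).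
  by rewrite partial1of2E derive_val.
have aI : a \in `]a - 1, a + 1[ by rewrite in_itv/= ltrBlDr ltrDl ltr01.
have Hint : forall x, `]a - 1, a + 1[%classic x -> mu.-integrable setT (EFin \o f x).
  by move=> x _; exact: int_cos.
have Hder x y : `]a - 1, a + 1[%classic x -> setT y -> derivable (f ^~ y) x 1.
  by move=> _ _; have [] := df x y.
have Hub x y : `]a - 1, a + 1[%classic x -> setT y ->
    `|partial1of2 f x y| <= expR (- (y ^+ 2 / 2)).
  move=> _ _; rewrite dfE normrN !normrM (ger0_norm (expR_ge0 _)).
  apply: le_trans (normrM_gauss_le y).
  by rewrite ler_wpM2r ?expR_ge0// ler_piMr// normr_sin_le1.
have G0 (y : R) : 0 <= expR (- (y ^+ 2 / 2)) by exact: expR_ge0.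
apply: DeriveDef.
  exact: (derivable_under_integral measurableT aI Hint Hder G0 integrable_gauss_half Hub).
rewrite -derive1E (differentiation_under_integral measurableT aI Hint Hder G0 integrable_gauss_half Hub).
under eq_Rintegral do rewrite dfE.
rewrite -[RHS]mulN1r -RintegralZl//.
  by apply: eq_Rintegral => x _; rewrite mulN1r.
exact: int_sin.
Qed.

(** Lets the fundamental theorem of calculus on segments evaluate integrals over the line. The
    truncations are dominated by [|f|]. *)
Lemma cvg_Rintegral_itv (f : R -> R) :
  mu.-integrable setT (EFin \o f) ->
  (\int[mu]_(x in `[- n%:R, n%:R]) f x) @[n --> \oo] --> \int[mu]_x f x.
Proof.
move=> intf; have mf := measurable_int _ intf.
pose D n : set R := `[- n%:R, n%:R]%classic.
pose g n x := ((f \_ (D n)) x)%:E.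
have mg n : measurable_fun setT (g n).
  have mD : measurable (D n : set (measurableTypeR R)) by exact: measurable_itv.
  apply/measurable_EFinP; apply/(measurable_restrictT f mD).
  by apply: measurable_funS (measurableT) _ _ => //; exact/measurable_EFinP.
have gf : {ae mu, forall x, setT x -> g ^~ x @ \oo --> (EFin \o f) x}.
  apply: aeW => x _; apply: cvg_near_cst.
  near=> n; rewrite /g patchE ifT//= inE /D/= in_itv/= -ler_norml.
  near: n; exact: nbhs_infty_ger.
have gle : {ae mu, forall x n, setT x -> (`|g n x| <= (abse \o (EFin \o f)) x)%E}.
  apply: aeW => x n _; rewrite /g patchE; case: ifP => // _.
  by rewrite /= normr0 lee_fin.
have [_ _ cvgf] := @dominated_convergence _ _ _ mu _ measurableT _ _ _ mg mf gf
  (integrable_abse intf) gle.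
move: cvgf; rewrite -(fineK (integrable_fin_num measurableT intf)) => /fine_cvg.
apply: cvg_trans; apply: near_eq_cvg; apply: nearW => n.
by rewrite /= [RHS]Rintegral_mkcond.
Unshelve. all: end_near. Qed.

(** Integration by parts: [h'] is the derivative of [h], which tends to zero at both ends, so its
    integral vanishes; the two terms of [h'] give the two sides. *)
Let Rintegral_sin_gauss_by_parts (a : R) :
  \int[mu]_x (x * sin (a * x) * expR (- x ^+ 2)) = a / 2 * F a.
Proof.
pose h (x : R) := sin (a * x) * expR (- x ^+ 2).
pose h' (x : R) := a * (cos (a * x) * expR (- x ^+ 2)) - 2 * (x * sin (a * x) * expR (- x ^+ 2)).
have dh (x : R) : is_derive x 1 h (h' x).
  by rewrite /h; apply: is_derive_eq; rewrite /h' /GRing.scale/= /GRing.scale/=; ring.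
have ch' : continuous h'.
  move=> x; apply: differentiable_continuous; apply/derivable1_diffP.
  by rewrite /h'.
have inth' : mu.-integrable setT (EFin \o h').
  rewrite /h' /comp; under eq_fun do rewrite EFinB !EFinM.
  apply: integrableB => //; apply: integrableZl => //.
    by under eq_fun do rewrite -EFinM; exact: int_cos.
  by under eq_fun do rewrite -!EFinM; exact: int_sin.
have h'0 : \int[mu]_x h' x = 0.
  apply: (cvg_unique _ (cvg_Rintegral_itv inth')) => //.
  have : (h n%:R - h (- n%:R)) @[n --> \oo] --> 0.
    (* At [n] and [-n] the Gaussian factor is exp(-n^2), at most exp(-n). *)
    have hle (n : nat) (x : R) : `|x| = n%:R -> `|h x| <= expR (- n%:R).
      move=> xn; rewrite /h normrM (ger0_norm (expR_ge0 _)).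
      apply: (@le_trans _ _ (expR (- x ^+ 2))).
        by rewrite ler_piMl ?expR_ge0// normr_sin_le1.
      rewrite ler_expR lerN2 -(real_normK (num_real x)) xn -natrX ler_nat.
      by case: n {xn} => // n; rewrite expnS leq_pmulr// expn_gt0.
    apply/norm_cvg0P; apply: (@squeeze_cvgr _ _ _ _ (cst 0) (fun n => 2 * expR (- n%:R))).
    + apply: nearW => n; rewrite normr_ge0/=.
      rewrite (le_trans (ler_normB _ _))// mulr_natl mulr2n lerD// hle// ?normrN ger0_norm//.
    + exact: cvg_cst.
    + by rewrite -[X in _ --> X](mulr0 (2 : R)); apply: cvgM; [exact: cvg_cst|exact: cvgn_expR].
  apply: cvg_trans; apply: near_eq_cvg; near=> n.
  have n0 : - n%:R < n%:R :> R.
    by rewrite gtrN// ltr0n; near: n; exact: nbhs_infty_gt.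
  have hc x : {for x, continuous h}.
    by apply: differentiable_continuous; apply/derivable1_diffP.
  rewrite /Rintegral (@continuous_FTC2 _ h' h)//.
  - exact: continuous_subspaceT.
  - split=> //.
    + exact: cvg_at_right_filter (hc _).
    + exact: cvg_at_left_filter (hc _).
  - by move=> x _; rewrite derive1E derive_val.
move: h'0; rewrite /h' RintegralB//; last 2 first.
- by rewrite /comp; under eq_fun do rewrite EFinM; apply: integrableZl => //; exact: int_cos.
- by rewrite /comp; under eq_fun do rewrite EFinM; apply: integrableZl => //; exact: int_sin.
rewrite !RintegralZl//; [|exact: int_sin|exact: int_cos].
by rewrite -/(F a); lra.
Unshelve. all: end_near. Qed.

(** The transform [F] solves F'(a) = -(a/2) F(a). Hence F(a) exp(a^2/4) has zero derivative and
    equals F(0), the Gaussian integral. *)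
Lemma Rintegral_cos_gauss (a : R) :
  \int[mu]_x (cos (a * x) * expR (- x ^+ 2)) = Num.sqrt pi * expR (- (a ^+ 2 / 4)).
Proof.
rewrite -/(F a).
pose G (x : R) := F x * expR (x ^+ 2 / 4).
have dG (x : R) : is_derive x 1 G 0.
  have dF := is_derive_cos_gauss x.
  rewrite /G; apply: is_derive_eq.
  by rewrite Rintegral_sin_gauss_by_parts /GRing.scale/=; field.
have GE : G a = G 0 by apply: is_derive_0_is_cst => x; exact: dG.
have F0 : F 0 = Num.sqrt pi.
  rewrite /F; under eq_Rintegral do rewrite mul0r cos0 mul1r.
  by rewrite /Rintegral integralT_gauss.
move: GE; rewrite /G F0 expr0n/= mul0r expR0 mulr1 => <-.
by rewrite expRN mulfK// gt_eqF// expR_gt0.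
Qed.

(** The integrand is odd. As the reflection formula is stated for nonnegative functions, it is
    applied to [1 + sin] and [1 - sin] times the Gaussian, whose integrals therefore agree. *)
Lemma Rintegral_sin_gauss (a : R) :
  \int[mu]_x (sin (a * x) * expR (- x ^+ 2)) = 0.
Proof.
have intS : mu.-integrable setT (EFin \o (fun x : R => sin (a * x) * expR (- x ^+ 2))).
  apply: (@integrable_bounded_gauss_half _ 1); first exact: measurable_funM.
  move=> x; rewrite mul1r normrM (ger0_norm (expR_ge0 _)).
  apply: le_trans (gauss_le_half x).
  by rewrite ler_piMl ?expR_ge0// normr_sin_le1.
have intE : mu.-integrable setT (EFin \o (fun x : R => expR (- x ^+ 2))).
  exact: integrableT_gauss.
have intD b : mu.-integrable setT (EFin \o (fun x : R => (1 + b * sin (a * x)) * expR (- x ^+ 2))).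
  under eq_fun do rewrite mulrDl mul1r -mulrA.
  rewrite /comp; under eq_fun do rewrite EFinD EFinM.
  by apply: integrableD => //; apply: integrableZl.
have E b : \int[mu]_x ((1 + b * sin (a * x)) * expR (- x ^+ 2)) =
    Num.sqrt pi + b * \int[mu]_x (sin (a * x) * expR (- x ^+ 2)).
  under eq_Rintegral do rewrite mulrDl mul1r -mulrA.
  rewrite RintegralD ?RintegralZl//.
    by congr (_ + _); rewrite /Rintegral integralT_gauss.
  by rewrite /comp; under eq_fun do rewrite EFinM; apply: integrableZl.
have : \int[mu]_x ((1 + 1 * sin (a * x)) * expR (- x ^+ 2)) =
    \int[mu]_x ((1 + (-1) * sin (a * x)) * expR (- x ^+ 2)).
  rewrite /Rintegral; congr fine.
  rewrite -ge0_integral_lebesgue_opp.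
  - by apply: eq_integral => x _; rewrite mulrN sinN sqrrN mul1r mulN1r.
  - apply/measurable_EFinP; apply: measurable_funM => //; apply: measurable_funD => //.
    exact: (measurable_funM (measurable_cst _) (msin a)).
  - move=> x; rewrite lee_fin mulr_ge0 ?expR_ge0// mul1r.
rewrite !E mul1r mulN1r => /addrI/eqP.
by rewrite -addr_eq0 -mulr2n mulrn_eq0/= => /eqP.
Qed.

(* Adding [1] to the cosine keeps the integrand nonnegative, so that Tonelli's
   theorem applies without integrability conditions. *)
Lemma integral_1Dcos_gauss (theta a : R) :
  (\int[mu]_x ((1 + cos (theta + a * x)) * expR (- x ^+ 2))%:E =
   (Num.sqrt pi * (1 + cos theta * expR (- (a ^+ 2 / 4))))%:E)%E.
Proof.
have intC : mu.-integrable setT (EFin \o (fun x : R => cos (a * x) * expR (- x ^+ 2))).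
  exact: int_cos.
have intS : mu.-integrable setT (EFin \o (fun x : R => sin (a * x) * expR (- x ^+ 2))).
  apply: (@integrable_bounded_gauss_half _ 1); first exact: measurable_funM.
  move=> x; rewrite mul1r normrM (ger0_norm (expR_ge0 _)).
  apply: le_trans (gauss_le_half x).
  by rewrite ler_piMl ?expR_ge0// normr_sin_le1.
have intE : mu.-integrable setT (EFin \o (fun x : R => expR (- x ^+ 2))).
  exact: integrableT_gauss.
have fE x : (1 + cos (theta + a * x)) * expR (- x ^+ 2) =
   expR (- x ^+ 2) + (cos theta * (cos (a * x) * expR (- x ^+ 2)) -
   sin theta * (sin (a * x) * expR (- x ^+ 2))).
  by rewrite cosD; ring.
have intC' : mu.-integrable setT (EFin \o (fun x : R => cos theta * (cos (a * x) * expR (- x ^+ 2)))).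
  by rewrite /comp; under eq_fun do rewrite EFinM; exact: integrableZl.
have intS' : mu.-integrable setT (EFin \o (fun x : R => sin theta * (sin (a * x) * expR (- x ^+ 2)))).
  by rewrite /comp; under eq_fun do rewrite EFinM; exact: integrableZl.
have intB : mu.-integrable setT (EFin \o (fun x : R => cos theta * (cos (a * x) * expR (- x ^+ 2)) -
   sin theta * (sin (a * x) * expR (- x ^+ 2)))).
  by rewrite /comp; under eq_fun do rewrite EFinB; exact: integrableB.
under eq_integral do rewrite fE.
rewrite -[LHS]fineK; last first.
  apply: integrable_fin_num => //.
  by under eq_fun do rewrite EFinD; exact: integrableD.
congr EFin; rewrite -/(Rintegral _ _ _) RintegralD// RintegralB// !RintegralZl//.
rewrite Rintegral_cos_gauss Rintegral_sin_gauss {1}/Rintegral integralT_gauss/=.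
by ring.
Qed.

End gauss_fourier.

(** * Integration over tuples and matrices *)

Lemma emeasurable_prod d (T : measurableType d) (R : realType) (I : Type)
    (s : seq I) (f : I -> T -> \bar R) :
  (forall i, measurable_fun setT (f i)) ->
  measurable_fun setT (fun x => \prod_(i <- s) f i x)%E.
Proof.
move=> mf; elim: s => [|i s IH].
  by under eq_fun do rewrite big_nil; exact: measurable_cst.
by under eq_fun do rewrite big_cons; exact: emeasurable_funM.
Qed.

Section lebesgue_tuple_integral.
Context {R : realType}.
Local Notation mu := (@lebesgue_measure R).
Local Notation bR := (measurableTypeR R).

Lemma ge0_integral_lebesgue_tuple0 (F : 0.-tuple bR -> \bar R) :
  measurable_fun setT F -> (forall t, 0 <= F t)%E ->
  (\int[lebesgue_tuple 0]_t F t = F [tuple])%E.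
Proof.
move=> mF F0; rewrite [LHS](_ : _ = \int[\d_([tuple] : 0.-tuple bR)]_t F t)%E//.
by rewrite integral_dirac// diracT mul1e.
Qed.

Lemma ge0_integral_lebesgue_tupleS n (F : n.+1.-tuple bR -> \bar R) :
  measurable_fun setT F -> (forall t, 0 <= F t)%E ->
  (\int[lebesgue_tuple n.+1]_t F t =
   \int[mu]_x \int[lebesgue_tuple n]_t F (tuple_of_pair (x, t)))%E.
Proof.
move=> mF F0.
have mp := @measurable_tuple_of_pair R n.
transitivity (\int[(mu \x lebesgue_tuple n)%E]_z F (tuple_of_pair z))%E.
  exact: (@ge0_integral_pushforward _ _ _ _ _ _ mp (mu \x lebesgue_tuple n)%E setT F).
rewrite fubini_tonelli1//.
exact: (measurableT_comp mF mp).
Qed.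

Lemma measurable_tuple_mktuple d (T : measurableType d) n (f : 'I_n -> T -> bR) :
  (forall i, measurable_fun setT (f i)) ->
  measurable_fun setT (fun x => [tuple f i x | i < n]).
Proof.
move=> mf; apply/measurable_fun_tnthP => i.
by rewrite (_ : _ \o _ = f i)//; apply/funext => x /=; rewrite tnth_mktuple.
Qed.

(** Tonelli's theorem peels off one coordinate at a time, and each contributes a factor [|r|^-1]. *)
Lemma ge0_integral_lebesgue_tuple_affine n (r : R) (c : 'I_n -> R)
    (F : n.-tuple bR -> \bar R) :
  r != 0 -> measurable_fun setT F -> (forall t, 0 <= F t)%E ->
  (\int[lebesgue_tuple n]_t F [tuple (r * tnth t i + c i)%R | i < n] =
   (`|r|^-1 ^+ n)%:E * \int[lebesgue_tuple n]_t F t)%E.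
Proof.
move=> r0; elim: n c F => [|n IH] c F mF F0.
  rewrite !ge0_integral_lebesgue_tuple0 ?expr0 ?mul1e//.
    by congr F; exact: tuple0.
  by apply: (measurableT_comp mF); apply: measurable_tuple_mktuple => -[].
pose c' (i : 'I_n) := c (lift ord0 i).
have aff_cons x t : [tuple (r * tnth (tuple_of_pair (x, t)) i + c i)%R | i < n.+1] =
    tuple_of_pair (r * x + c ord0, [tuple (r * tnth t i + c' i)%R | i < n]).
  apply: eq_from_tnth => i; rewrite tnth_mktuple.
  by case: (unliftP ord0 i) => [j ->|->//]; rewrite !tnthS tnth_mktuple.
have maff m (b : 'I_m -> R) :
    measurable_fun setT (fun t : m.-tuple bR => [tuple (r * tnth t i + b i)%R | i < m]).
  apply: measurable_tuple_mktuple => i; apply: measurable_funD => //.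
  by apply: measurable_funM => //; exact: measurable_tnth.
rewrite !ge0_integral_lebesgue_tupleS//; last exact: (measurableT_comp mF (maff _ _)).
under eq_integral do under eq_integral do rewrite aff_cons.
have mF' x : measurable_fun setT (fun t : n.-tuple bR => F (tuple_of_pair (x, t))).
  apply: (measurableT_comp mF); apply: (measurableT_comp (@measurable_tuple_of_pair R n)).
  exact: measurable_pair1.
under eq_integral => x _.
  rewrite (IH c' (fun t => F (tuple_of_pair (r * x + c ord0, t))))//.
  over.
have mG : measurable_fun setT (fun x : bR => \int[lebesgue_tuple n]_t F (tuple_of_pair (x, t)))%E.
  apply: (measurable_fun_fubini_tonelli_F (m2 := lebesgue_tuple n)
    (fun z : bR * n.-tuple bR => F (tuple_of_pair z))) => //.
  exact: (measurableT_comp mF (@measurable_tuple_of_pair R n)).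
have G0 (x : bR) : (0 <= \int[lebesgue_tuple n]_t F (tuple_of_pair (x, t)))%E.
  by apply: integral_ge0.
rewrite ge0_integralZl; last 4 first.
- by [].
- by apply: (measurableT_comp mG); apply: measurable_funD => //; exact: measurable_funM.
- by move=> x _; exact: G0.
- by rewrite lee_fin exprn_ge0// invr_ge0.
rewrite (@ge0_integral_lebesgue_affine R r (c ord0)
  (fun x => \int[lebesgue_tuple n]_t F (tuple_of_pair (x, t)))%E r0 mG G0).
by rewrite muleA -EFinM exprSr.
Qed.

Lemma integral_lebesgue_tuple_prod n (h : R -> \bar R) :
  measurable_fun setT h -> (forall x, 0 <= h x)%E ->
  (\int[lebesgue_tuple n]_t (\prod_(i < n) h (tnth t i)) =
   \prod_(i < n) \int[mu]_x h x)%E.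
Proof.
move=> mh h0.
have mprod m : measurable_fun setT (fun t : m.-tuple bR => \prod_(i < m) h (tnth t i))%E.
  apply: emeasurable_prod => i.
  exact: (measurableT_comp mh (measurable_tnth i)).
elim: n => [|n IH].
  by rewrite big_ord0 ge0_integral_lebesgue_tuple0// ?big_ord0// => t; rewrite big_ord0.
rewrite ge0_integral_lebesgue_tupleS//; last by move=> t; exact: prode_ge0.
rewrite big_ord_recl -IH.
transitivity (\int[mu]_x (h x * \int[lebesgue_tuple n]_t \prod_(i < n) h (tnth t i)))%E.
  apply: eq_integral => x _; rewrite -ge0_integralZl//; first last.
  - by move=> t _; exact: prode_ge0.
  - exact: mprod.
  apply: eq_integral => t _; rewrite big_ord_recl [tnth _ ord0]/=; congr (_ * _)%E.
  by apply: eq_bigr => i _; rewrite tnthS.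
rewrite ge0_integralZr//.
by apply: integral_ge0 => t _; exact: prode_ge0.
Qed.

(** Integrating out all coordinates but the first leaves a multiple of 1 + k cos, with k in [0,1].
    To stay with nonnegative integrands this is split as (1 - k) + k (1 + cos). *)
Lemma integral_1Dcos_gauss_tuple n (theta : R) (u : 'I_n -> R) :
  (\int[lebesgue_tuple n]_t ((1 + cos (theta + \sum_(i < n) u i * tnth t i))
      * expR (- \sum_(i < n) tnth t i ^+ 2))%:E =
   (Num.sqrt pi ^+ n * (1 + cos theta * expR (- ((\sum_(i < n) u i ^+ 2) / 4))))%:E)%E.
Proof.
have mf m th (v : 'I_m -> R) : measurable_fun setT (fun t : m.-tuple bR =>
   ((1 + cos (th + \sum_(i < m) v i * tnth t i)) * expR (- \sum_(i < m) tnth t i ^+ 2))%:E).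
  apply/measurable_EFinP; apply: measurable_funM.
    apply: measurable_funD => //; apply: (measurableT_comp (continuous_measurable_fun (@continuous_cos R))).
    apply: measurable_funD => //; apply: measurable_sum => i.
    by apply: measurable_funM => //; exact: measurable_tnth.
  apply: (measurableT_comp (@measurable_expR R)); apply: measurableT_comp => //.
  by apply: measurable_sum => i; apply: measurable_funX; exact: measurable_tnth.
have f0 m th (v : 'I_m -> R) (t : m.-tuple bR) : (0 <=
   ((1 + cos (th + \sum_(i < m) v i * tnth t i)) * expR (- \sum_(i < m) tnth t i ^+ 2))%:E)%E.
  by rewrite lee_fin mulr_ge0 ?expR_ge0// -lerBlDl sub0r cos_geN1.
elim: n theta u => [|n IH] theta u.
  rewrite ge0_integral_lebesgue_tuple0// !big_ord0 !(addr0, oppr0, mul0r, expR0, mulr1).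
  by rewrite expr0 mul1r.
pose u' (i : 'I_n) := u (lift ord0 i).
rewrite ge0_integral_lebesgue_tupleS//.
set row_charfun := expR (- ((\sum_(i < n) u' i ^+ 2) / 4)).
have kap01 : 0 <= row_charfun <= 1.
  rewrite expR_ge0/= -expR0 ler_expR oppr_le0 mulr_ge0//.
  by apply: sumr_ge0 => i _; exact: sqr_ge0.
pose C : R := Num.sqrt pi ^+ n.
(* The constant 1 is written [1 + cos (pi / 2 + 0 * x)], so that [integral_1Dcos_gauss] evaluates
   both terms. *)
transitivity (\int[mu]_x (((C * (1 - row_charfun)) * ((1 + cos (pi / 2 + 0 * x)) * expR (- x ^+ 2)))%:E +
   ((C * row_charfun) * ((1 + cos (theta + u ord0 * x)) * expR (- x ^+ 2)))%:E))%E.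
  apply: eq_integral => x _.
  transitivity (\int[lebesgue_tuple n]_t ((expR (- x ^+ 2))%:E *
    ((1 + cos (theta + u ord0 * x + \sum_(i < n) u' i * tnth t i))
      * expR (- \sum_(i < n) tnth t i ^+ 2))%:E))%E.
    apply: eq_integral => t _; rewrite -EFinM; congr EFin.
    rewrite !big_ord_recl [tnth _ ord0]/= opprD expRD addrA.
    under eq_bigr do rewrite tnthS.
    under [in X in _ * (_ * expR (- X))]eq_bigr do rewrite tnthS.
    by rewrite /u' mulrCA.
  rewrite ge0_integralZl; [|by []|exact: mf|by move=> t _; exact: f0|by rewrite lee_fin expR_ge0].
  rewrite IH -EFinM -EFinD; congr EFin.
  rewrite -/C -/row_charfun mul0r addr0 cos_pihalf; ring.
have m1 th w : measurable_fun setT (fun x : bR => (1 + cos (th + w * x)) * expR (- x ^+ 2)).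
  apply: measurable_funM; last exact: measurable_gauss_fun.
  apply: measurable_funD => //; apply: (measurableT_comp (continuous_measurable_fun (@continuous_cos R))).
  by apply: measurable_funD => //; exact: measurable_funM.
have p1 th w (x : bR) : 0 <= (1 + cos (th + w * x)) * expR (- x ^+ 2).
  by rewrite mulr_ge0 ?expR_ge0// -lerBlDl sub0r cos_geN1.
have C0 : 0 <= C by rewrite exprn_ge0// sqrtr_ge0.
have [k0 k1] := andP kap01.
have E th w c : 0 <= c ->
  (\int[mu]_x (c * ((1 + cos (th + w * x)) * expR (- x ^+ 2)))%:E =
   (c * (Num.sqrt pi * (1 + cos th * expR (- (w ^+ 2 / 4)))))%:E)%E.
  move=> c0; under eq_integral do rewrite EFinM.
  rewrite ge0_integralZl//; first by rewrite integral_1Dcos_gauss.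
  - by apply/measurable_EFinP; exact: m1.
have c1 : 0 <= C * (1 - row_charfun) by rewrite mulr_ge0// subr_ge0.
have c2 : 0 <= C * row_charfun by rewrite mulr_ge0.
rewrite ge0_integralD//; first last.
- by apply/measurable_EFinP; exact: measurable_funM.
- by move=> x _; rewrite lee_fin mulr_ge0.
- by apply/measurable_EFinP; exact: measurable_funM.
- by move=> x _; rewrite lee_fin mulr_ge0.
rewrite !E// -EFinD; congr EFin.
rewrite cos_pihalf big_ord_recl mulrDl opprD expRD -/row_charfun (exprS (Num.sqrt pi) n) -/C.
by ring.
Qed.

End lebesgue_tuple_integral.

Section lebesgue_mx_integral.
Context {R : realType} {m n : nat}.
Local Notation mu := (@lebesgue_measure R).
Local Notation bR := (measurableTypeR R).
Local Notation M := 'M[R]_(m, n).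

Definition mxdot (X Y : M) : R := \sum_i \sum_j X i j * Y i j.

Lemma mxdotC X Y : mxdot X Y = mxdot Y X.
Proof. by apply: eq_bigr => i _; apply: eq_bigr => j _; rewrite mulrC. Qed.

Lemma mxdotDl X Y Z : mxdot (X + Y) Z = mxdot X Z + mxdot Y Z.
Proof.
rewrite -big_split; apply: eq_bigr => i _ /=; rewrite -big_split.
by apply: eq_bigr => j _; rewrite mxE mulrDl.
Qed.

Lemma mxdotZl a X Y : mxdot (a *: X) Y = a * mxdot X Y.
Proof.
rewrite mulr_sumr; apply: eq_bigr => i _; rewrite mulr_sumr.
by apply: eq_bigr => j _; rewrite mxE mulrA.
Qed.

Lemma mxdotDr X Y Z : mxdot X (Y + Z) = mxdot X Y + mxdot X Z.
Proof. by rewrite !(mxdotC X) mxdotDl. Qed.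

Lemma mxdotZr a X Y : mxdot X (a *: Y) = a * mxdot X Y.
Proof. by rewrite !(mxdotC X) mxdotZl. Qed.

Lemma mxdotNl X Y : mxdot (- X) Y = - mxdot X Y.
Proof. by rewrite -scaleN1r mxdotZl mulN1r. Qed.

Lemma mxdotNr X Y : mxdot X (- Y) = - mxdot X Y.
Proof. by rewrite -scaleN1r mxdotZr mulN1r. Qed.

Lemma mxdot0l X : mxdot 0 X = 0.
Proof. by rewrite -(scale0r X) mxdotZl mul0r. Qed.

Lemma mxdot_ge0 X : 0 <= mxdot X X.
Proof. by apply: sumr_ge0 => i _; apply: sumr_ge0 => j _; rewrite -expr2 sqr_ge0. Qed.

Lemma sqr_entry_le_mxdot (X : M) i j : X i j ^+ 2 <= mxdot X X.
Proof.
rewrite /mxdot (bigD1 i)//= (bigD1 j)//= -expr2 -addrA lerDl addr_ge0//.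
  by apply: sumr_ge0 => k _; rewrite -expr2 sqr_ge0.
by apply: sumr_ge0 => i' _; apply: sumr_ge0 => k _; rewrite -expr2 sqr_ge0.
Qed.

Lemma continuous_measurable_mx (f : M -> R) :
  continuous f -> measurable_fun setT f.
Proof.
move=> cf; apply: (measurability _ (RGenOInfty.measurableE R)).
move=> _ [_ [a ->] <-]; rewrite setTI.
apply: sub_sigma_algebra; apply: open_comp; last exact: interval_open.
by move=> X _; exact: cf.
Qed.

Lemma measurable_mx_entry i j : measurable_fun setT (fun X : M => X i j : R).
Proof. by apply: continuous_measurable_mx => X; exact: coord_continuous. Qed.

Lemma measurable_fun_mx d (T : measurableType d) (f : T -> M) :
  (forall i j, measurable_fun setT (fun x => f x i j : R)) -> measurable_fun setT f.
Proof.
move=> mf.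
rewrite (_ : f = @mx_of_tuple R m n \o (fun x => tuple_of_mx (f x))); last first.
  apply/funext => x /=; apply/matrixP => i j.
  by rewrite mxE tnth_mktuple mxvecE.
apply: (measurableT_comp (@measurable_mx_of_tuple R m n)).
apply/measurable_fun_tnthP => k.
rewrite (_ : _ \o _ = fun x => mxvec (f x) ord0 k); last first.
  by apply/funext => x /=; rewrite tnth_mktuple.
by case/mxvec_indexP: k => i j; under eq_fun do rewrite mxvecE; exact: mf.
Qed.

Lemma measurable_mxdot d (T : measurableType d) (f g : T -> M) :
  measurable_fun setT f -> measurable_fun setT g ->
  measurable_fun setT (fun x => mxdot (f x) (g x)).
Proof.
move=> mf mg; apply: measurable_sum => i; apply: measurable_sum => j.
apply: measurable_funM.
  exact: (measurableT_comp (measurable_mx_entry i j) mf).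
exact: (measurableT_comp (measurable_mx_entry i j) mg).
Qed.

Lemma measurable_mx_add d (T : measurableType d) (f g : T -> M) :
  measurable_fun setT f -> measurable_fun setT g ->
  measurable_fun setT (fun x => f x + g x).
Proof.
move=> mf mg; apply: measurable_fun_mx => i j.
under eq_fun do rewrite mxE.
apply: measurable_funD.
  exact: (measurableT_comp (measurable_mx_entry i j) mf).
exact: (measurableT_comp (measurable_mx_entry i j) mg).
Qed.

Lemma measurable_mx_scale d (T : measurableType d) (a : T -> R) (f : T -> M) :
  measurable_fun setT a -> measurable_fun setT f ->
  measurable_fun setT (fun x => a x *: f x).
Proof.
move=> ma mf; apply: measurable_fun_mx => i j.
under eq_fun do rewrite mxE.
apply: measurable_funM => //.
exact: (measurableT_comp (measurable_mx_entry i j) mf).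
Qed.

Lemma ge0_integral_lebesgue_mx (F : M -> \bar R) :
  measurable_fun setT F -> (forall X, 0 <= F X)%E ->
  (\int[lebesgue_mx]_X F X = \int[lebesgue_tuple (m * n)]_t F (mx_of_tuple t))%E.
Proof.
move=> mF F0.
exact: (@ge0_integral_pushforward _ _ _ _ _ _ (@measurable_mx_of_tuple R m n)
  (lebesgue_tuple (m * n)) setT F).
Qed.

Lemma ge0_integral_lebesgue_mx_affine (r : R) (C : M) (F : M -> \bar R) :
  r != 0 -> measurable_fun setT F -> (forall X, 0 <= F X)%E ->
  (\int[lebesgue_mx]_X F (r *: X + C)%R =
   (`|r|^-1 ^+ (m * n))%:E * \int[lebesgue_mx]_X F X)%E.
Proof.
move=> r0 mF F0.
have mA : measurable_fun setT (fun X : M => r *: X + C).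
  by apply: measurable_mx_add => //; apply: measurable_mx_scale.
rewrite !ge0_integral_lebesgue_mx//; last exact: (measurableT_comp mF mA).
rewrite -(@ge0_integral_lebesgue_tuple_affine _ _ r (fun k => mxvec C ord0 k)
  (fun t => F (mx_of_tuple t)))//; last first.
  exact: (measurableT_comp mF (@measurable_mx_of_tuple R m n)).
apply: eq_integral => t _; congr F; apply/matrixP => i j.
by rewrite !mxE tnth_mktuple mxvecE.
Qed.

Lemma ge0_integral_lebesgue_mx_shift (C : M) (F : M -> \bar R) :
  measurable_fun setT F -> (forall X, 0 <= F X)%E ->
  (\int[lebesgue_mx]_X F (X + C)%R = \int[lebesgue_mx]_X F X)%E.
Proof.
move=> mF F0; have := ge0_integral_lebesgue_mx_affine C (oner_neq0 R) mF F0.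
rewrite normr1 invr1 expr1n mul1e => <-.
by apply: eq_integral => X _; rewrite scale1r.
Qed.

Lemma ge0_integral_lebesgue_mx_scale (r : R) (F : M -> \bar R) :
  r != 0 -> measurable_fun setT F -> (forall X, 0 <= F X)%E ->
  (\int[lebesgue_mx]_X F (r *: X)%R =
   (`|r|^-1 ^+ (m * n))%:E * \int[lebesgue_mx]_X F X)%E.
Proof.
move=> r0 mF F0; rewrite -(ge0_integral_lebesgue_mx_affine 0 r0 mF F0).
by apply: eq_integral => X _; rewrite addr0.
Qed.

Lemma ge0_integral_lebesgue_mx_opp (F : M -> \bar R) :
  measurable_fun setT F -> (forall X, 0 <= F X)%E ->
  (\int[lebesgue_mx]_X F (- X)%R = \int[lebesgue_mx]_X F X)%E.
Proof.
move=> mF F0.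
have N0 : (-1 : R) != 0 by rewrite oppr_eq0 oner_eq0.
have := ge0_integral_lebesgue_mx_scale N0 mF F0.
rewrite normrN normr1 invr1 expr1n mul1e => <-.
by apply: eq_integral => X _; rewrite scaleN1r.
Qed.

Lemma sum_mxvec_index (f : 'I_m -> 'I_n -> R) (g : 'I_(m * n) -> R) :
  (forall i j, g (mxvec_index i j) = f i j) ->
  \sum_(k < m * n) g k = \sum_i \sum_j f i j.
Proof.
move=> fg; rewrite (reindex _ (curry_mxvec_bij m n))/= pair_bigA/=.
by apply: eq_bigr => -[i j] _; rewrite /= fg.
Qed.

Lemma eprod_mxvec_index (f : 'I_m -> 'I_n -> \bar R) (g : 'I_(m * n) -> \bar R) :
  (forall i j, g (mxvec_index i j) = f i j) ->
  (\prod_(k < m * n) g k = \prod_i \prod_j f i j)%E.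
Proof.
move=> fg; rewrite (reindex _ (curry_mxvec_bij m n))/= pair_bigA/=.
by apply: eq_bigr => -[i j] _; rewrite /= fg.
Qed.

Lemma integral_1Dcos_gauss_mx (e theta : R) (U : M) : e != 0 ->
  (\int[lebesgue_mx]_X ((1 + cos (theta + mxdot U X)) * expR (- (e ^+ 2 * mxdot X X)))%:E =
   ((`|e|^-1 * Num.sqrt pi) ^+ (m * n) *
     (1 + cos theta * expR (- (mxdot U U / (4 * e ^+ 2)))))%:E)%E.
Proof.
move=> e0.
pose F (X : M) := ((1 + cos (theta + mxdot (e^-1 *: U) X)) * expR (- mxdot X X))%:E.
have mF : measurable_fun setT F.
  apply/measurable_EFinP; apply: measurable_funM.
    apply: measurable_funD => //; apply: (measurableT_comp (continuous_measurable_fun (@continuous_cos R))).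
    by apply: measurable_funD => //; apply: measurable_mxdot.
  apply: (measurableT_comp (@measurable_expR R)); apply: measurableT_comp => //.
  exact: measurable_mxdot.
have F0 X : (0 <= F X)%E.
  by rewrite lee_fin mulr_ge0 ?expR_ge0// -lerBlDl sub0r cos_geN1.
transitivity (\int[lebesgue_mx]_X F (e *: X))%E.
  apply: eq_integral => X _; congr (((1 + cos (_ + _)) * expR (- _))%:E).
    by rewrite mxdotZl mxdotZr mulKf.
  by rewrite mxdotZl mxdotZr mulrA.
rewrite ge0_integral_lebesgue_mx_scale// ge0_integral_lebesgue_mx//.
transitivity ((`|e|^-1 ^+ (m * n))%:E * \int[lebesgue_tuple (m * n)]_t
   ((1 + cos (theta + \sum_(k < m * n) mxvec (e^-1 *: U) ord0 k * tnth t k))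
      * expR (- \sum_(i < m * n) tnth t i ^+ 2))%:E)%E.
  congr (_ * _)%E; apply: eq_integral => t _; congr (((1 + cos (_ + _)) * expR (- _))%:E);
    by apply/esym/sum_mxvec_index => i j; rewrite ?mxvecE !mxE ?expr2.
rewrite integral_1Dcos_gauss_tuple -EFinM; congr EFin.
rewrite exprMn -mulrA; congr (_ * (_ * (1 + _ * expR (- _)))).
rewrite (@sum_mxvec_index (fun i j => e^-1 ^+ 2 * (U i j * U i j))); last first.
  by move=> i j; rewrite mxvecE !mxE exprMn (expr2 (U i j)).
rewrite /mxdot mulr_suml mulr_suml; apply: eq_bigr => i _.
rewrite mulr_suml mulr_suml; apply: eq_bigr => j _.
by field.
Qed.

Lemma measurable_set1_mx (X : M) : measurable [set X].
Proof.
have -> : [set X] = \bigcap_(i in setT) \bigcap_(j in setT) [set Y : M | Y i j = X i j].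
  apply/seteqP; split=> [Y -> //|Y h]; apply/matrixP => i j; exact: (h i I j I).
apply: fin_bigcap_measurable => // i _; apply: fin_bigcap_measurable => // j _.
rewrite -[X in measurable X]setTI.
exact: (measurable_mx_entry i j measurableT (measurable_set1 (X i j : bR))).
Qed.

(** A point is a rectangle whose sides are null. With no entries at all the measure would be a Dirac
    mass, whence the two positivity conditions. *)
Lemma lebesgue_mx_set1 (X : M) : (0 < m)%N -> (0 < n)%N -> lebesgue_mx [set X] = 0%E.
Proof.
case: m n X => // m' [//|n'] X _ _.
rewrite (_ : [set X] = [set Y | forall i j, [set X i j] (Y i j)]); last first.
  by apply/seteqP; split=> [Y -> //|Y h]; apply/matrixP => i j; exact: h.
rewrite (@lebesgue_mx_rectangle _ _ _ (fun i j => [set X i j])).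
  by rewrite big_ord_recl big_ord_recl lebesgue_measure_set1 !mul0e.
by move=> i j; exact: (measurable_set1 (X i j : bR)).
Qed.

End lebesgue_mx_integral.

Lemma dotvE (R : realType) d (x y : 'rV[R]_d) : dotv x y = mxdot x y.
Proof. by rewrite /mxdot big_ord1. Qed.

(** * Gaussian densities with independent rows *)

(** Parallelogram identity, with the square of [X + k *: Y] dropped. *)
Lemma mxdot_shift_le (R : realType) m n (X Y : 'M[R]_(m, n)) (k : R) :
  mxdot (X + (- k) *: Y) (X + (- k) *: Y) <= 2 * mxdot X X + 2 * k ^+ 2 * mxdot Y Y.
Proof.
rewrite -subr_ge0; apply: le_trans (mxdot_ge0 (X + k *: Y)) _.
rewrite !(mxdotDl, mxdotDr, mxdotZl, mxdotZr) (mxdotC Y X) le_eqVlt.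
by apply/orP; left; apply/eqP; ring.
Qed.

Section gaussian.
Context {R : realType} {n d : nat}.
Local Notation mu := (@lebesgue_measure R).
Local Notation M := 'M[R]_(n, d).

(** Each pair (i, u) of the list adds a rank-one form that sees row i only, so the rows stay
    independent. The list format allows induction and makes the family stable under multiplication
    by the corresponding Gaussian factors; the term in [e] keeps the form positive definite. *)
Definition quad (e : R) (s : seq ('I_n * 'rV[R]_d)) (X : M) : R :=
  e ^+ 2 * mxdot X X + \sum_(q <- s) mxdot (row q.1 X) q.2 ^+ 2.

Definition gauss e s X : R := expR (- quad e s X).

Lemma gauss_ge0 e s X : 0 <= gauss e s X.
Proof. exact: expR_ge0. Qed.

Lemma quad_ge e s X : e ^+ 2 * mxdot X X <= quad e s X.
Proof. by rewrite lerDl; apply: sumr_ge0 => q _; exact: sqr_ge0. Qed.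

Lemma quadN e s X : quad e s (- X) = quad e s X.
Proof.
rewrite /quad mxdotNl mxdotNr opprK; congr (_ + _).
by apply: eq_bigr => q _; rewrite linearN mxdotNl sqrrN.
Qed.

Lemma measurable_row (i : 'I_n) : measurable_fun setT (fun X : M => row i X).
Proof.
apply: measurable_fun_mx => k j.
by under eq_fun do rewrite mxE; exact: measurable_mx_entry.
Qed.

Lemma measurable_quad e s : measurable_fun setT (quad e s).
Proof.
apply: measurable_funD.
  by apply: measurable_funM => //; apply: measurable_mxdot.
apply: measurable_sum => q; apply: measurable_funX.
by apply: measurable_mxdot => //; exact: measurable_row.
Qed.

Lemma measurable_gauss e s : measurable_fun setT (gauss e s).
Proof.
apply: (measurableT_comp (@measurable_expR R)); apply: measurableT_comp => //.
exact: measurable_quad.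
Qed.

Definition bilinear_form (b : 'rV[R]_d -> 'rV[R]_d -> R) :=
  [/\ forall x y z, b (x + y) z = b x z + b y z,
      forall a x y, b (a *: x) y = a * b x y & forall x y, b x y = b y x].

Definition rowform (b : 'I_n -> 'rV[R]_d -> 'rV[R]_d -> R) (U : M) : R :=
  \sum_i b i (row i U) (row i U).

(* [gauss e s] is, up to the factor [C], the density of a centred Gaussian
   vector with independent rows; [b i] is the covariance of row [i], so that its
   characteristic function is [expR (- rowform b U)]. *)
Definition has_covariance (f : M -> R) (C : R) b :=
  forall theta U,
  (\int[lebesgue_mx]_X ((1 + cos (theta + mxdot U X)) * f X)%:E =
   (C * (1 + cos theta * expR (- rowform b U)))%:E)%E.

Lemma mxdot_row (i : 'I_n) (u : 'rV[R]_d) (X : M) :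
  mxdot (\matrix_(k, j) (u ord0 j *+ (k == i))) X = mxdot (row i X) u.
Proof.
rewrite {2}/mxdot big_ord1 /mxdot (bigD1 i)//= -[RHS]addr0; congr (_ + _).
  by apply: eq_bigr => j _; rewrite !mxE eqxx mulr1n mulrC.
apply: big1 => k ki; apply: big1 => j _.
by rewrite mxE (negbTE ki) mul0r.
Qed.

Lemma gauss_covariance_nil e : e != 0 ->
  exists C b c, [/\ 0 < C, 0 < c, forall i, bilinear_form (b i),
    forall i x, c * mxdot x x <= b i x x & has_covariance (gauss e [::]) C b].
Proof.
move=> e0; have e2 : 0 < 4 * e ^+ 2 by rewrite mulr_gt0// lt_def sqr_ge0 sqrf_eq0 e0.
exists ((`|e|^-1 * Num.sqrt pi) ^+ (n * d)), (fun _ x y => mxdot x y / (4 * e ^+ 2)), (4 * e ^+ 2)^-1.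
split.
- by rewrite exprn_gt0// mulr_gt0 ?invr_gt0 ?normr_gt0// sqrtr_gt0 pi_gt0.
- by rewrite invr_gt0.
- move=> _; split=> [x y z|a x y|x y]; first by rewrite mxdotDl mulrDl.
    by rewrite mxdotZl mulrA.
  by rewrite mxdotC.
- by move=> _ x; rewrite mulrC.
- move=> theta U; rewrite /gauss /quad.
  under eq_integral do rewrite big_nil addr0.
  rewrite integral_1Dcos_gauss_mx//; congr ((_ * (1 + _ * expR (- _)))%:E).
  rewrite /rowform -mulr_suml; congr (_ / _); apply: eq_bigr => i _.
  by rewrite /mxdot big_ord1; apply: eq_bigr => j _; rewrite !mxE.
Qed.

Lemma has_covariance_mass f C b : has_covariance f C b ->
  (\int[lebesgue_mx]_X (f X)%:E = C%:E)%E.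
Proof.
move=> /(_ (pi / 2) 0); rewrite cos_pihalf mul0r addr0 mulr1 => <-.
by apply: eq_integral => X _; rewrite mxdot0l addr0 cos_pihalf addr0 mul1r.
Qed.

Lemma bilinear_sqr b x u (s : R) : bilinear_form b ->
  b (x + (2 * s) *: u) (x + (2 * s) *: u) =
  b x x + 4 * s * b x u + 4 * s ^+ 2 * b u u.
Proof.
move=> [bD bZ bC]; rewrite bD bZ (bC x) (bC u) !bD !bZ (bC u); ring.
Qed.

Lemma measurable_rowform_line b (U V : M) : (forall i, bilinear_form (b i)) ->
  measurable_fun setT (fun s : R => rowform b (U + (2 * s) *: V)).
Proof.
move=> bil; apply: measurable_sum => i.
under eq_fun do rewrite linearD linearZ/= bilinear_sqr//.
apply: measurable_funD.
  by apply: measurable_funD => //; apply: measurable_funM => //; exact: measurable_funM.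
by apply: measurable_funM => //; apply: measurable_funM => //; exact: measurable_funX.
Qed.

(** Sherman-Morrison formula: the effect on the forms [b] of multiplying the density by exp(-<x,
    u>^2), with x the row [i0]. *)
Let rank1_form (b : 'I_n -> 'rV[R]_d -> 'rV[R]_d -> R) (i0 : 'I_n) u (i : 'I_n) x y :=
  b i x y - if i == i0 then 4 * b i x u * b i y u / (1 + 4 * b i u u) else 0.

(** Completing the square in [s]: the form at the shifted frequency plus s^2 is the updated form
    plus (sqrt D s + c)^2, and the Gaussian integral in [s] then gives the factor 1 / sqrt D. *)
Lemma integral_gauss_rank1 (b : 'I_n -> 'rV[R]_d -> 'rV[R]_d -> R) (i0 : 'I_n) u
    (U : M) (theta : R) :
  bilinear_form (b i0) -> 0 <= b i0 u u ->
  (\int[mu]_s ((1 + cos theta * expR (- rowform b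
        (U + (2 * s) *: \matrix_(k, j) (u ord0 j *+ (k == i0))))) * expR (- s ^+ 2))%:E =
   (Num.sqrt pi * (1 + (Num.sqrt (1 + 4 * b i0 u u))^-1 * cos theta *
      expR (- rowform (rank1_form b i0 u) U)))%:E)%E.
Proof.
move=> bil b0.
set D := 1 + 4 * b i0 u u.
have D0 : 0 < D by rewrite ltr_wpDr// mulr_ge0.
pose c := 2 * b i0 (row i0 U) u / Num.sqrt D.
have sD0 : Num.sqrt D != 0 by rewrite gt_eqF// sqrtr_gt0.
have rowE s i : row i (U + (2 * s) *: \matrix_(k, j) (u ord0 j *+ (k == i0))) =
    if i == i0 then row i U + (2 * s) *: u else row i U.
  apply/rowP => j; rewrite !mxE; case: eqP => _; rewrite !mxE ?mulr1n//.
  by rewrite mulr0n mulr0 addr0.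
have formE s : rowform b (U + (2 * s) *: \matrix_(k, j) (u ord0 j *+ (k == i0))) + s ^+ 2 =
    rowform (rank1_form b i0 u) U + (Num.sqrt D * s + c) ^+ 2.
  rewrite /rowform (bigD1 i0)//= rowE eqxx bilinear_sqr//.
  rewrite [in RHS](bigD1 i0)//= {1}/rank1_form eqxx -/D.
  have -> : \sum_(i < n | i != i0) b i
      (row i (U + (2 * s) *: \matrix_(k, j) (u ord0 j *+ (k == i0))))
      (row i (U + (2 * s) *: \matrix_(k, j) (u ord0 j *+ (k == i0)))) =
      \sum_(i < n | i != i0) rank1_form b i0 u i (row i U) (row i U).
    by apply: eq_bigr => i ii0; rewrite rowE /rank1_form (negbTE ii0) subr0.
  rewrite /c sqrrD !exprMn exprVn sqr_sqrtr ?ltW//.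
  have -> : b i0 u u = (D - 1) / 4 by rewrite /D addrC addKr mulrAC divff ?mul1r// mulr1.
  rewrite (_ : Num.sqrt D * s * (2 * b i0 (row i0 U) u / Num.sqrt D) =
     s * (2 * b i0 (row i0 U) u) * (Num.sqrt D / Num.sqrt D)); last by ring.
  rewrite divff// mulr1.
  have Dn0 : D != 0 by rewrite gt_eqF.
  by field.
transitivity (\int[mu]_s ((expR (- s ^+ 2))%:E + (cos theta * expR (- rowform (rank1_form b i0 u) U))%:E *
   (expR (- (Num.sqrt D * s + c) ^+ 2))%:E))%E.
  apply: eq_integral => s _; rewrite -EFinM -EFinD; congr EFin.
  rewrite mulrDl mul1r -!mulrA -!expRD; congr (_ + _ * expR _).
  by rewrite -opprD formE opprD.
rewrite integralD//.
- rewrite integralZl//; last exact: integrable_gauss_affine.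
  rewrite integralT_gauss integral_gauss_affine// -EFinM -EFinD; congr EFin.
  by rewrite ger0_norm ?sqrtr_ge0//; ring.
- exact: integrableT_gauss.
- by apply: integrableZl => //; exact: integrable_gauss_affine.
Qed.

Lemma gauss_cons e i u s X :
  gauss e ((i, u) :: s) X = gauss e s X * expR (- mxdot (row i X) u ^+ 2).
Proof. by rewrite /gauss /quad big_cons/= -expRD; congr expR; ring. Qed.

Lemma cos1D_ge0 (x : R) : 0 <= 1 + cos x.
Proof. by rewrite -lerBlDl sub0r cos_geN1. Qed.

(** Induction on the list. A new factor exp(-beta^2) is the average of cos(2 beta s) over a Gaussian
    variable s; since beta is linear in [X], this amounts to averaging the characteristic function
    already known over the shifted frequencies U + 2 s V. *)
Lemma gauss_covariance e s : e != 0 ->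
  exists C b c, [/\ 0 < C, 0 < c, forall i, bilinear_form (b i),
    forall i x, c * mxdot x x <= b i x x & has_covariance (gauss e s) C b].
Proof.
move=> e0; elim: s => [|[i0 u] s [C [b [c [C0 c0 bil bc cov]]]]].
  exact: gauss_covariance_nil.
have bpos i x : 0 <= b i x x.
  by apply: le_trans (bc i x); rewrite mulr_ge0 ?mxdot_ge0// ltW.
pose D := 1 + 4 * b i0 u u.
have D0 : 0 < D by rewrite ltr_wpDr// mulr_ge0.
pose V : M := \matrix_(k, j) (u ord0 j *+ (k == i0)).
have sD0 : 0 < Num.sqrt D by rewrite sqrtr_gt0.
have cc0 : 0 < 2 + 8 * c * mxdot u u.
  by rewrite ltr_wpDr// !mulr_ge0 ?mxdot_ge0// ltW.
exists (C / Num.sqrt D), (rank1_form b i0 u), (c / (2 + 8 * c * mxdot u u)).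
split.
- by rewrite divr_gt0.
- by rewrite divr_gt0.
- move=> i; have [bD bZ bC] := bil i; rewrite /rank1_form; split.
  + by move=> x y z; rewrite !bD; case: ifP => _; ring.
  + by move=> a x y; rewrite !bZ; case: ifP => _; ring.
  + by move=> x y; rewrite bC; case: ifP => _; ring.
- move=> i x; rewrite mulrAC ler_pdivrMr// /rank1_form; case: eqP => [->|_]; last first.
    rewrite subr0; apply: le_trans (bc i x) _.
    rewrite ler_peMr// (le_trans (ler1n _ 2))// lerDl !mulr_ge0 ?mxdot_ge0//.
    exact: ltW.
  (* This [t] minimises b(x + 2tu, x + 2tu) + t^2, and the minimum is the updated form at [x].
     Writing x = y - 2tu then bounds |x|^2 by |y|^2 and t^2; the denominator 2 + 8 c |u|^2 is chosen
     to absorb both coefficients. *)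
  set t := - (2 * b i0 x u / D).
  have -> : b i0 x x - 4 * b i0 x u * b i0 x u / (1 + 4 * b i0 u u) =
      b i0 (x + (2 * t) *: u) (x + (2 * t) *: u) + t ^+ 2.
    rewrite bilinear_sqr// /t -/D.
    have -> : b i0 u u = (D - 1) / 4 by rewrite /D addrC addKr mulrAC divff ?mul1r// mulr1.
    have Dn0 : D != 0 by rewrite gt_eqF.
    by field.
  set y := x + (2 * t) *: u.
  have xy : mxdot x x <= 2 * mxdot y y + 8 * t ^+ 2 * mxdot u u.
    have -> : x = y + (- (2 * t)) *: u by rewrite /y scaleNr addrK.
    have -> : 8 * t ^+ 2 = 2 * (2 * t) ^+ 2 by move: t {y} => t; ring.
    exact: mxdot_shift_le.
  apply: (@le_trans _ _ (c * (2 * mxdot y y + 8 * t ^+ 2 * mxdot u u))).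
    by rewrite ler_pM2l.
  have := bc i0 y; set B := b i0 y y; set Y := mxdot y y => cB.
  have B0 : 0 <= B by exact: bpos.
  have u0 := mxdot_ge0 u; have t0 := sqr_ge0 t.
  have h1 : 0 <= c * mxdot u u * B by rewrite !mulr_ge0// ltW.
  rewrite [leRHS]mulrDl.
  have -> : c * (2 * Y + 8 * t ^+ 2 * mxdot u u) = 2 * (c * Y) + 8 * c * mxdot u u * t ^+ 2 by ring.
  have -> : B * (2 + 8 * c * mxdot u u) = 2 * B + 8 * (c * mxdot u u * B) by ring.
  have -> : t ^+ 2 * (2 + 8 * c * mxdot u u) = 2 * t ^+ 2 + 8 * c * mxdot u u * t ^+ 2 by ring.
  lra.
- pose f := gauss e s; pose beta (X : M) := mxdot (row i0 X) u.
  have mbeta : measurable_fun setT beta.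
    by apply: measurable_mxdot => //; exact: measurable_row.
  have mcos : measurable_fun setT (@cos R) by exact: (continuous_measurable_fun (@continuous_cos R)).
  have mf : measurable_fun setT f := measurable_gauss e s.
  (* The factor exp(-beta^2) multiplies only the cosine here, since 1 + cos(phi) exp(-beta^2) is the
     Gaussian average of the nonnegative function 1 + cos(phi + 2 beta s). *)
  have key theta U :
     (\int[lebesgue_mx]_X ((1 + cos (theta + mxdot U X) * expR (- beta X ^+ 2)) * f X)%:E =
     (C * (1 + (Num.sqrt D)^-1 * cos theta * expR (- rowform (rank1_form b i0 u) U)))%:E)%E.
    pose G (z : M * R) := ((1 + cos (theta + mxdot U z.1 + (2 * beta z.1) * z.2)) * expR (- z.2 ^+ 2) * f z.1)%:E.
    have mG : measurable_fun setT G.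
      apply/measurable_EFinP; apply: measurable_funM; last exact: measurableT_comp.
      apply: measurable_funM; last first.
        apply: (measurableT_comp (@measurable_expR R)); apply: measurableT_comp => //.
        exact: measurable_funX.
      apply: measurable_funD => //; apply: (measurableT_comp mcos).
      apply: measurable_funD.
        apply: measurable_funD => //; exact: measurable_mxdot.
      apply: measurable_funM => //; apply: measurable_funM => //.
      exact: measurableT_comp.
    have G0 z : (0 <= G z)%E.
      by rewrite lee_fin !mulr_ge0 ?expR_ge0 ?gauss_ge0 ?cos1D_ge0.
    have spi0 : Num.sqrt pi != 0 :> R by rewrite gt_eqF// sqrtr_gt0 pi_gt0.
    transitivity (((Num.sqrt pi)^-1)%:E * \int[lebesgue_mx]_X \int[mu]_s G (X, s))%E.
      rewrite -ge0_integralZl//; first last.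
      - by move=> X _; apply: integral_ge0.
      - exact: (measurable_fun_fubini_tonelli_F (m2 := mu) G).
      apply: eq_integral => X _.
      transitivity (((Num.sqrt pi)^-1)%:E * ((f X)%:E * \int[mu]_s
         ((1 + cos (theta + mxdot U X + (2 * beta X) * s)) * expR (- s ^+ 2))%:E))%E.
        rewrite integral_1Dcos_gauss -!EFinM; congr EFin.
        rewrite (_ : (2 * beta X) ^+ 2 / 4 = beta X ^+ 2); last by field.
        rewrite (mulrC (f X)) -mulrA mulKf//.
      congr (_ * _)%E; rewrite -ge0_integralZl.
      - by apply: eq_integral => x _; rewrite -EFinM mulrC.
      - by [].
      - apply/measurable_EFinP; apply: measurable_funM; last exact: measurable_gauss_fun.
        apply: measurable_funD => //; apply: (measurableT_comp mcos).
        by apply: measurable_funD => //; exact: measurable_funM.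
      - by move=> x _; rewrite lee_fin mulr_ge0 ?expR_ge0 ?cos1D_ge0.
      - by rewrite lee_fin gauss_ge0.
    rewrite (fubini_tonelli (m1 := lebesgue_mx) (m2 := mu) G mG G0).
    transitivity (((Num.sqrt pi)^-1)%:E * \int[mu]_s (C%:E * ((1 + cos theta *
        expR (- rowform b (U + (2 * s) *: V))) * expR (- s ^+ 2))%:E))%E.
      congr (_ * _)%E; apply: eq_integral => x _.
      transitivity ((expR (- x ^+ 2))%:E * \int[lebesgue_mx]_X
         ((1 + cos (theta + mxdot (U + (2 * x) *: V) X)) * f X)%:E)%E.
        rewrite -ge0_integralZl.
        - apply: eq_integral => X _; rewrite /G/= -EFinM mulrA (mulrC (expR _)).
          congr ((_ * _ * _)%:E); congr (1 + cos _).
          by rewrite mxdotDl mxdotZl mxdot_row -/(beta X); ring.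
        - by [].
        - apply/measurable_EFinP; apply: measurable_funM => //.
          apply: measurable_funD => //; apply: (measurableT_comp mcos).
          by apply: measurable_funD => //; exact: measurable_mxdot.
        - by move=> X _; rewrite lee_fin mulr_ge0 ?gauss_ge0 ?cos1D_ge0.
        - by rewrite lee_fin expR_ge0.
      by rewrite cov -!EFinM; congr EFin; ring.
    rewrite ge0_integralZl.
    - rewrite (integral_gauss_rank1 _ _ (bil i0) (bpos i0 u)).
      rewrite -!EFinM; congr EFin; rewrite -/D.
      by rewrite (mulrCA C) mulKf.
    - by [].
    - apply/measurable_EFinP; apply: measurable_funM; last exact: measurable_gauss_fun.
      apply: measurable_funD => //; apply: measurable_funM => //.
      apply: (measurableT_comp (@measurable_expR R)); apply: measurableT_comp => //.
      exact: measurable_rowform_line.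
    - move=> x _; rewrite lee_fin mulr_ge0 ?expR_ge0//.
      have p : 0 <= rowform b (U + (2 * x) *: V) by apply: sumr_ge0 => i _; exact: bpos.
      rewrite -lerBlDl sub0r; have := cos_geN1 theta; have := cos_le1 theta.
      have : expR (- rowform b (U + (2 * x) *: V)) <= 1 by rewrite -[leRHS]expR0 ler_expR oppr_le0.
      have := expR_ge0 (- rowform b (U + (2 * x) *: V)).
      by move: (expR _) (cos theta) => y z; nra.
    - by rewrite lee_fin ltW.
  move=> theta U.
  have Efin : forall x y : R, forall A : \bar R, (A + x%:E = y%:E -> A = (y - x)%:E)%E.
    move=> x y A h; rewrite EFinB -h addeK//.
  have := key theta U.
  (* To move exp(-beta^2) in front of the 1 as well, subtract the integral of (1 - exp(-beta^2)) f;
     it is [key] at phase pi and frequency 0. *)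
  have -> : (\int[lebesgue_mx]_X ((1 + cos (theta + mxdot U X) * expR (- beta X ^+ 2)) * f X)%:E =
    \int[lebesgue_mx]_X ((1 + cos (theta + mxdot U X)) * gauss e ((i0, u) :: s) X)%:E +
    \int[lebesgue_mx]_X ((1 + cos (pi + mxdot 0 X) * expR (- beta X ^+ 2)) * f X)%:E)%E.
    rewrite -ge0_integralD.
    - apply: eq_integral => X _; rewrite -EFinD; congr EFin.
      by rewrite gauss_cons mxdot0l addr0 cospi -/(beta X) -/(f X); ring.
    - by [].
    - by move=> X _; rewrite lee_fin mulr_ge0 ?gauss_ge0 ?cos1D_ge0.
    - apply/measurable_EFinP; apply: measurable_funM; last exact: measurable_gauss.
      apply: measurable_funD => //; apply: (measurableT_comp mcos).
      by apply: measurable_funD => //; exact: measurable_mxdot.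
    - move=> X _; rewrite lee_fin mulr_ge0 ?gauss_ge0// mxdot0l addr0 cospi mulN1r subr_ge0.
      by rewrite -expR0 ler_expR oppr_le0 sqr_ge0.
    - apply/measurable_EFinP; apply: measurable_funM => //; apply: measurable_funD => //.
      apply: measurable_funM.
        apply: (measurableT_comp mcos).
        by apply: measurable_funD => //; exact: measurable_mxdot.
      apply: (measurableT_comp (@measurable_expR R)); apply: measurableT_comp => //.
      exact: measurable_funX.
  rewrite key => /Efin ->; congr EFin.
  have -> : rowform (rank1_form b i0 u) 0 = 0.
    apply: big1 => i _; have [bD bZ bC] := bil i.
    rewrite row0 /rank1_form.
    have z y : b i 0 y = 0 by rewrite -(scale0r 0) bZ mul0r.
    by rewrite !z; case: ifP => _; rewrite ?mulr0 ?mul0r subr0.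
  by rewrite oppr0 expR0 cospi; ring.
Qed.

End gaussian.

(** * Schwartz functions *)

Section directional_derivatives.
Context {R : realType} {d : nat}.
Local Notation V := 'rV[R]_d.

(** Reduces directional derivatives to derivatives in one variable, where the chain rule for [expR]
    is available. *)
Lemma is_derive_line (f : V -> R) (x v : V) (a : R) :
  is_derive (0 : R) 1 (fun t : R => f (t *: v + x)) a <-> is_derive x v f a.
Proof.
have E : (fun h : R => h^-1 *: (f (h *: v + x) - f x)) =
    (fun h : R => h^-1 *: (f ((h *: 1 + 0) *: v + x) - f (0 *: v + x))).
  by apply/funext => h; rewrite addr0 scale0r add0r [h *: 1]mulr1.
split=> -[d1 d2]; apply: DeriveDef.
- by rewrite /derivable E.
- by rewrite -d2 /derive E.
- by move: d1; rewrite /derivable E.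
- by rewrite -d2 /derive E.
Qed.

Lemma is_derive_expRN (h : V -> R) (x v : V) (a : R) :
  is_derive x v h a -> is_derive x v (fun y => expR (- h y)) (- a * expR (- h x)).
Proof.
move=> /is_derive_line dh; apply/is_derive_line.
have dN : is_derive (0 : R) 1 (fun t : R => - h (t *: v + x)) (- a) by exact: is_deriveN.
have := @is_derive1_comp R expR (fun t : R => - h (t *: v + x)) 0 _ _ (is_derive_expR _) dN.
by rewrite scale0r add0r mulrC.
Qed.

(** Polynomial functions, described by closure properties: induction gives what Schwartz estimates
    require, namely polynomial derivatives and polynomial growth. *)
Inductive polyfun : (V -> R) -> Prop :=
| polyfun_cst c : polyfun (fun=> c)
| polyfun_coord i : polyfun (fun y => y ord0 i)
| polyfunD P Q : polyfun P -> polyfun Q -> polyfun (fun y => P y + Q y)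
| polyfunM P Q : polyfun P -> polyfun Q -> polyfun (fun y => P y * Q y).

Lemma polyfun_sum (I : Type) (s : seq I) (P : I -> V -> R) :
  (forall i, polyfun (P i)) -> polyfun (fun y => \sum_(i <- s) P i y).
Proof.
move=> pP; elim: s => [|i s IH].
  by under eq_fun do rewrite big_nil; exact: polyfun_cst.
by under eq_fun do rewrite big_cons; exact: polyfunD.
Qed.

Lemma polyfun_prod (I : Type) (s : seq I) (P : I -> V -> R) :
  (forall i, polyfun (P i)) -> polyfun (fun y => \prod_(i <- s) P i y).
Proof.
move=> pP; elim: s => [|i s IH].
  by under eq_fun do rewrite big_nil; exact: polyfun_cst.
by under eq_fun do rewrite big_cons; exact: polyfunM.
Qed.

Lemma polyfunX (P : V -> R) k : polyfun P -> polyfun (fun y => P y ^+ k).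
Proof.
move=> pP; elim: k => [|k IH].
  by under eq_fun do rewrite expr0; exact: polyfun_cst.
by under eq_fun do rewrite exprS; exact: polyfunM.
Qed.

Lemma polyfun_continuous P : polyfun P -> continuous P.
Proof.
elim=> [c|i|P1 P2 _ c1 _ c2|P1 P2 _ c1 _ c2] x.
- exact: cst_continuous.
- exact: coord_continuous.
- by apply: (@continuousD _ _ _ P1 P2); [exact: c1|exact: c2].
- by apply: (@continuousM _ _ P1 P2); [exact: c1|exact: c2].
Qed.

Lemma polyfun_derive P i : polyfun P ->
  exists2 P', polyfun P' & forall x, is_derive x (delta_mx ord0 i) P (P' x).
Proof.
elim=> [c|j|P1 P2 p1 [Q1 q1 d1] p2 [Q2 q2 d2]|P1 P2 p1 [Q1 q1 d1] p2 [Q2 q2 d2]].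
- by exists (fun=> 0); [exact: polyfun_cst|move=> x; exact: is_derive_cst].
- exists (fun=> (i == j)%:R); [exact: polyfun_cst|move=> x].
  apply/is_derive_line.
  rewrite (_ : (fun t : R => _) = (fun t : R => t * (i == j)%:R + x ord0 j)); last first.
    by apply/funext => t; rewrite !mxE/= (eq_sym j).
  by apply: is_derive_eq; rewrite addr0 /GRing.scale/= mulr0 add0r mulr1.
- exists (fun y => Q1 y + Q2 y); first exact: polyfunD.
  by move=> x; exact: is_deriveD.
- exists (fun y => P1 y * Q2 y + P2 y * Q1 y).
    by apply: polyfunD; exact: polyfunM.
  by move=> x; exact: is_deriveM.
Qed.

Lemma polyfun_growth P : polyfun P ->
  exists C k, 0 <= C /\ forall y, `|P y| <= C * (1 + mxdot y y) ^+ k.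
Proof.
have g1 (y : V) k : 1 <= (1 + mxdot y y) ^+ k.
  by rewrite exprn_ege1// lerDl mxdot_ge0.
elim=> [c|i|P1 P2 _ [C1 [k1 [C10 b1]]] _ [C2 [k2 [C20 b2]]]
          |P1 P2 _ [C1 [k1 [C10 b1]]] _ [C2 [k2 [C20 b2]]]].
- by exists `|c|, 0%N; split=> // y; rewrite expr0 mulr1.
- exists 1, 1%N; split=> // y; rewrite mul1r expr1.
  have := sqr_entry_le_mxdot y ord0 i.
  rewrite -(real_normK (num_real (y ord0 i))).
  by have := sqr_ge0 (`|y ord0 i| - 1); have := mxdot_ge0 y; nra.
- exists (C1 + C2), (k1 + k2)%N; split=> [|y]; first exact: addr_ge0.
  rewrite (le_trans (ler_normD _ _))// mulrDl exprD lerD//.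
    by rewrite (le_trans (b1 y))// ler_wpM2l// ler_peMr// (le_trans ler01).
  by rewrite (le_trans (b2 y))// ler_wpM2l// ler_peMl// (le_trans ler01).
- exists (C1 * C2), (k1 + k2)%N; split=> [|y]; first exact: mulr_ge0.
  by rewrite normrM exprD mulrACA ler_pM.
Qed.

(** From x^k / k! <= exp x at x = c (1 + t); the shift by 1 accounts for the factor [expR c]. *)
Lemma exprn_expR_le (c t : R) k : 0 < c -> 0 <= t ->
  (1 + t) ^+ k * expR (- (c * t)) <= c^-1 ^+ k * k`!%:R * expR c.
Proof.
move=> c0 t0.
have x0 : 0 <= c * (1 + t) by rewrite mulr_ge0 ?(ltW c0)// addr_ge0.
have H : (c * (1 + t)) ^+ k <= k`!%:R * expR (c * (1 + t)).
  case: k => [|k]; first by rewrite expr0 mul1r -[leLHS]expR0 ler_expR.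
  rewrite -ler_pdivrMl ?ltr0n ?fact_gt0// mulrC.
  by rewrite (le_trans _ (expR_ge1Dxn k x0))// lerDr.
rewrite expRN ler_pdivrMr ?expR_gt0// -!mulrA -expRD.
rewrite (_ : c + c * t = c * (1 + t)); last by rewrite mulrDr mulr1.
have -> : (1 + t) ^+ k = c^-1 ^+ k * (c * (1 + t)) ^+ k.
  by rewrite -exprMn mulKf// gt_eqF.
by rewrite ler_pM2l// exprn_gt0// invr_gt0.
Qed.

Section polyfun_exp.
Variables (h : V -> R) (c C0 : R).
Hypotheses (ph : polyfun h) (c0 : 0 < c) (hc : forall y, c * mxdot y y - C0 <= h y).

(** Products of a polynomial with [expR (- h)] are stable under partial derivatives: the polynomial
    factor Q becomes Q' - Q h'. *)
Lemma iter_partial_polyfun_exp s P : polyfun P -> exists2 Q, polyfun Q &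
  iter_partial s (fun y => P y * expR (- h y)) = (fun y => Q y * expR (- h y)).
Proof.
move=> pP; elim: s => [|i s [Q pQ IH]] /=; first by exists P.
have [Q' pQ' dQ] := polyfun_derive i pQ; have [h' ph' dh] := polyfun_derive i ph.
exists (fun y => Q' y + Q y * (-1 * h' y)).
  by do 3 ?[exact: polyfun_cst|apply: polyfunD|apply: polyfunM] => //; exact: polyfun_cst.
rewrite IH; apply/funext => x.
have dE := is_derive_expRN (dh x); have dQx := dQ x.
have := @is_deriveM _ _ Q (fun y => expR (- h y)) x (delta_mx ord0 i) _ _ dQx dE.
move=> [_ ->]; rewrite /GRing.scale/=; ring.
Qed.

Lemma schwartz_real_polyfun_exp P : polyfun P ->
  schwartz_real (fun y => P y * expR (- h y)).
Proof.
move=> pP; split=> [s|s k].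
  have [Q pQ ->] := iter_partial_polyfun_exp s pP; split.
    move=> x; apply: (@continuousM _ _ Q (fun y => expR (- h y))).
      exact: polyfun_continuous.
    apply: (@continuous_comp _ _ _ (fun y => - h y) expR); last exact: continuous_expR.
    by apply: (@continuousN _ _ _ h); exact: polyfun_continuous.
  move=> i x; have [Q' pQ' dQ] := polyfun_derive i pQ; have [h' ph' dh] := polyfun_derive i ph.
  have dE := is_derive_expRN (dh x); have dQx := dQ x.
  by have [] := @is_deriveM _ _ Q (fun y => expR (- h y)) x (delta_mx ord0 i) _ _ dQx dE.
have [Q pQ ->] := iter_partial_polyfun_exp s pP.
pose T (x : V) := \prod_(i < d) x ord0 i ^+ k i * Q x.
have pT : polyfun T.
  apply: polyfunM => //; apply: polyfun_prod => i; apply: polyfunX.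
  exact: polyfun_coord.
have [C [m [C_ge0 TC]]] := polyfun_growth pT.
exists (C * (c^-1 ^+ m * m`!%:R * expR c) * expR C0) => x.
rewrite mulrA normrM (ger0_norm (expR_ge0 _)).
apply: (@le_trans _ _ (C * (1 + mxdot x x) ^+ m * (expR (- (c * mxdot x x)) * expR C0))).
  by rewrite ler_pM ?expR_ge0//; [exact: TC|rewrite -expRD ler_expR; have := hc x; lra].
rewrite mulrA ler_pM2r ?expR_gt0// -mulrA ler_wpM2l//.
by rewrite exprn_expR_le// mxdot_ge0.
Qed.

End polyfun_exp.

Lemma smoothD (f g : V -> R) s : smooth f -> smooth g ->
  iter_partial s (fun x => f x + g x) = (fun x => iter_partial s f x + iter_partial s g x).
Proof.
move=> sf sg; elim: s => //= i s ->; apply/funext => x.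
have [_ /(_ i x) df] := sf s; have [_ /(_ i x) dg] := sg s.
exact: (@deriveD _ _ _ (iter_partial s f) (iter_partial s g)).
Qed.

Lemma schwartz_realD (f g : V -> R) : schwartz_real f -> schwartz_real g ->
  schwartz_real (fun x => f x + g x).
Proof.
move=> [sf bf] [sg bg]; split=> [s|s k].
  rewrite smoothD//; have [cf df] := sf s; have [cg dg] := sg s; split.
    move=> x; apply: (@continuousD _ _ _ (iter_partial s f) (iter_partial s g)).
      exact: cf.
    exact: cg.
  by move=> i x; apply: (@derivableD _ _ _ (iter_partial s f) (iter_partial s g)).
have [M1 h1] := bf s k; have [M2 h2] := bg s k.
exists (M1 + M2) => x; rewrite smoothD// mulrDr (le_trans (ler_normD _ _))//.
exact: lerD.
Qed.

End directional_derivatives.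

Section schwartz_gauss.
Context {R : realType} {d : nat}.
Local Notation V := 'rV[R]_d.

(** From |y|^2 <= 2 |y - z|^2 + 2 |z|^2. This is the quadratic growth that makes a Gaussian with any
    centre a Schwartz function. *)
Lemma quad_shift_ge (e r : R) (s : seq ('I_1 * V)) (y z : V) : r != 0 ->
  e ^+ 2 / r ^+ 2 / 2 * mxdot y y - e ^+ 2 / r ^+ 2 * mxdot z z <=
  quad e s (r^-1 *: (y - z)).
Proof.
move=> r0; apply: le_trans (quad_ge e s _).
rewrite mxdotZl mxdotZr.
have := mxdot_shift_le (y - z) z (-1).
rewrite opprK scale1r subrK sqrrN expr1n mulr1 => H.
have c1 : 0 <= e ^+ 2 / r ^+ 2 by rewrite divr_ge0 ?sqr_ge0.
have -> : e ^+ 2 * (r^-1 * (r^-1 * mxdot (y - z) (y - z))) =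
   e ^+ 2 / r ^+ 2 * mxdot (y - z) (y - z) by rewrite -exprVn; ring.
move: c1 H; set A := mxdot (y - z) (y - z); set B := mxdot y y; set D := mxdot z z.
by set k := e ^+ 2 / r ^+ 2 => k0 H; nra.
Qed.

Lemma schwartz_real_gauss (e r : R) (s : seq ('I_1 * V)) (z : V) :
  e != 0 -> r != 0 ->
  schwartz_real (fun y : V => gauss e s (r^-1 *: (y - z))).
Proof.
move=> e0 r0; pose h y := quad e s (r^-1 *: (y - z)).
have c0 : 0 < e ^+ 2 / r ^+ 2 / 2.
  by rewrite !divr_gt0// lt_def sqr_ge0 sqrf_eq0 ?e0 ?r0.
have pE (i : 'I_1) (j : 'I_d) : polyfun (fun y : V => (r^-1 *: (y - z)) i j).
  rewrite (_ : (fun y : V => _) = (fun y : V => r^-1 * (y ord0 j + - z ord0 j))); last first.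
    by apply/funext => y; rewrite !mxE (ord1 i).
  apply: polyfunM; first exact: polyfun_cst.
  by apply: polyfunD; [exact: polyfun_coord|exact: polyfun_cst].
have ph : polyfun h.
  apply: polyfunD.
    apply: polyfunM; first exact: polyfun_cst.
    by apply: polyfun_sum => i; apply: polyfun_sum => j; exact: polyfunM.
  apply: polyfun_sum => q; apply: polyfunX.
  apply: polyfun_sum => i; apply: polyfun_sum => j; apply: polyfunM.
    by under eq_fun do rewrite mxE; exact: pE.
  exact: polyfun_cst.
have hc y := quad_shift_ge e s y z r0.
have := schwartz_real_polyfun_exp ph c0 hc (polyfun_cst 1).
by congr schwartz_real; apply/funext => y; rewrite mul1r.
Qed.

End schwartz_gauss.

(** * Integrability of negative powers *)

Lemma measurable_expRN (R : realType) d (T : measurableType d) (D : set T) (f : T -> R) :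
  measurable_fun D f -> measurable_fun D (fun x => expR (- f x)).
Proof.
move=> mf; apply: (measurableT_comp (@measurable_expR R)).
exact: (measurableT_comp (@oppr_measurable R setT)).
Qed.

Section power_integrals.
Context {R : realType}.
Local Notation mu := (@lebesgue_measure R).

(** The interval is exhausted by the segments [1/(n+2), 1], which avoid the singularity and are
    never reduced to a point; the fundamental theorem of calculus bounds the integral over each by
    the same constant. *)
Lemma integral_powR_itv01 (k : R) : -1 < k ->
  (\int[mu]_(x in `]0%R, 1%R]) (x `^ k)%:E <= ((k + 1)^-1)%:E)%E.
Proof.
move=> k1; have k10 : 0 < k + 1 by rewrite -ltrBlDr sub0r.
have kn0 : k + 1 != 0 by rewrite gt_eqF.
pose F n : set (measurableTypeR R) := `[n.+2%:R^-1, 1]%classic.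
have FU : `]0%R, 1%R]%classic = \bigcup_n F n.
  apply/seteqP; split=> [x /=|x [n _]]; rewrite ?/F/= !in_itv/= => /andP[x0 x1].
    exists (Num.truncn x^-1) => //; rewrite /F/= in_itv/= x1 andbT.
    rewrite invf_ple ?posrE//; apply: ltW; apply: (lt_trans (truncnS_gt _)).
    by rewrite ltr_nat.
  by rewrite x1 andbT (lt_le_trans _ x0)// invr_gt0.
have mF n : measurable (F n) by exact: measurable_itv.
have mp D : measurable_fun (D : set (measurableTypeR R)) (fun x : R => (x `^ k)%:E).
  by apply/measurable_EFinP; apply: measurable_funTS; exact: measurable_powR.
rewrite FU.
have cvF := @ge0_nondecreasing_set_cvg_integral _ _ _ F (fun x => (x `^ k)%:E) mu.
have {}cvF := cvF _ mF (fun=> mp _) (fun _ x _ => powR_ge0 x k : (0 <= (x `^ k)%:E)%E).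
have ndF : {homo F : n m / (n <= m)%N >-> (n <= m)%O}.
  move=> n m nm; apply/subsetPset => x; rewrite /F/= !in_itv/= => /andP[h ->].
  by rewrite andbT (le_trans _ h)// lef_pV2 ?posrE// ler_nat.
rewrite -(cvg_lim _ (cvF ndF))//; apply: lime_le.
  by apply/cvg_ex; eexists; exact: cvF.
apply: nearW => n.
have n1 : n.+2%:R^-1 < 1 :> R by rewrite invf_lt1// ltr1n.
have n0 : 0 < n.+2%:R^-1 :> R by rewrite invr_gt0.
pose G (x : R) := (k + 1)^-1 * x `^ (k + 1).
have dG (x : R) : 0 < x -> is_derive x 1 G (x `^ k).
  move=> x0; have dp := is_derive1_powR (k + 1) x0; rewrite /G.
  by apply: is_derive_eq; rewrite addrK /GRing.scale/= mulrA mulVf// mul1r.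
have cG (x : R) : 0 < x -> {for x, continuous G}.
  move=> x0; have [dx _] := dG x x0.
  by apply: differentiable_continuous; exact/derivable1_diffP.
rewrite (@continuous_FTC2 _ (fun x => x `^ k) G)//.
- rewrite -EFinB lee_fin /G powR1 mulr1 gerBl mulr_ge0 ?powR_ge0//.
  by rewrite invr_ge0 ltW.
- apply: derivable_within_continuous => x; rewrite in_itv/= => /andP[x0 _].
  by have [] := is_derive1_powR k (lt_le_trans n0 x0).
- split.
  + by move=> x; rewrite in_itv/= => /andP[x0 _]; have [] := dG x (lt_trans n0 x0).
  + exact: cvg_at_right_filter (cG _ n0).
  + by apply: cvg_at_left_filter; apply: cG.
- move=> x; rewrite in_itv/= => /andP[x0 _]; rewrite derive1E.
  by have [_ ->] := dG x (lt_trans n0 x0).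
Qed.

Lemma exprn_expR_half (x : R) m : 0 <= x ->
  x ^+ m * expR (- x) <= 2 ^+ m * m`!%:R * expR (- (x / 2)).
Proof.
move=> x0.
have -> : expR (- x) = expR (- (x / 2)) * expR (- (x / 2)).
  by rewrite -expRD; congr expR; field.
rewrite mulrA ler_wpM2r ?expR_ge0// expRN ler_pdivrMr ?expR_gt0//.
have -> : x ^+ m = 2 ^+ m * (x / 2) ^+ m by rewrite -exprMn mulrC divfK.
rewrite -mulrA ler_wpM2l ?exprn_ge0//.
have x20 : 0 <= x / 2 by rewrite divr_ge0.
case: m => [|m]; first by rewrite expr0 mul1r -[leLHS]expR0 ler_expR.
rewrite -ler_pdivrMl ?ltr0n ?fact_gt0// mulrC.
by rewrite (le_trans _ (expR_ge1Dxn m x20))// lerDr.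
Qed.

Lemma integral_expR_half : (\int[mu]_(x in `]0%R, +oo[) (expR (- (x / 2)))%:E < +oo)%E.
Proof.
have h0 : 0 < 2^-1 :> R by rewrite invr_gt0.
have mpdf : measurable_fun setT (fun x => (2 * exponential_pdf (2^-1 : R) x)%:E).
  apply/measurable_EFinP; apply: measurable_funM => //.
  exact: measurable_exponential_pdf.
have pdf0 (x : R) : (0 <= (2 * exponential_pdf (2^-1 : R) x)%:E)%E.
  by rewrite lee_fin mulr_ge0// exponential_pdf_ge0// ltW.
apply: (@le_lt_trans _ _ (\int[mu]_x (2 * exponential_pdf (2^-1) x)%:E)%E).
  apply: (@le_trans _ _ (\int[mu]_(x in `]0%R, +oo[) (2 * exponential_pdf (2^-1) x)%:E)%E); last first.
    by apply: ge0_subset_integral => //; exact: measurable_itv.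
  rewrite le_eqVlt; apply/orP; left; apply/eqP; apply: eq_integral => x.
  rewrite inE/= in_itv/= andbT => x0.
  rewrite exponential_pdfE ?ltW//=.
  by congr EFin; rewrite mulrA divff// mul1r mulNr mulrC.
under eq_integral do rewrite EFinM.
rewrite ge0_integralZl//.
- by rewrite integral_exponential_pdf// mule1 ltry.
- by apply/measurable_EFinP; exact: measurable_exponential_pdf.
- by move=> x _; rewrite lee_fin exponential_pdf_ge0// ltW.
Qed.

(** Below 1 the exponential is at most 1 and the power is integrable. Above 1 the power is at most
    x^m with m an integer, which half of the exponential absorbs. *)
Lemma integral_gamma_lty (k : R) : -1 < k ->
  (\int[mu]_(x in `]0%R, +oo[) (x `^ k * expR (- x))%:E < +oo)%E.
Proof.
move=> k1; pose m := (Num.truncn `|k|).+1.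
have km : k <= m%:R by rewrite (le_trans (ler_norm k))// ltW// truncnS_gt.
pose C := 2 ^+ m * m`!%:R : R.
have C0 : 0 <= C by rewrite mulr_ge0// exprn_ge0.
pose D : set (measurableTypeR R) := `]0, +oo[%classic.
pose D1 : set (measurableTypeR R) := `]0, 1]%classic.
have mD : measurable D by exact: measurable_itv.
have mD1 : measurable D1 by exact: measurable_itv.
have mp A : measurable_fun (A : set (measurableTypeR R)) (fun x : R => (x `^ k)%:E).
  by apply/measurable_EFinP; apply: measurable_funTS; exact: measurable_powR.
have me A : measurable_fun (A : set (measurableTypeR R)) (fun x : R => (expR (- (x / 2)))%:E).
  apply/measurable_EFinP; apply: measurable_funTS; apply: (measurableT_comp (@measurable_expR R)).
  by apply: measurableT_comp => //; exact: measurable_funM.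
pose g (x : R) := (((fun x => (x `^ k)%:E) \_ D1) x)%E.
have mg : measurable_fun D g.
  by apply: measurable_funTS; apply/(measurable_restrictT _ mD1).
have g0 x : (0 <= g x)%E.
  by rewrite /g patchE; case: ifP => // _; rewrite lee_fin powR_ge0.
apply: (@le_lt_trans _ _ (\int[mu]_(x in D) (g x + C%:E * (expR (- (x / 2)))%:E))%E).
  apply: ge0_le_integral => //.
  - by move=> x _; rewrite lee_fin mulr_ge0 ?powR_ge0 ?expR_ge0.
  - apply/measurable_EFinP; apply: measurable_funTS; apply: measurable_funM.
      exact: measurable_powR.
    exact: measurable_expRN.
  - by apply: emeasurable_funD => //; apply: emeasurable_funM => //.
  - move=> x; rewrite /D/= in_itv/= andbT => x0.
    have [x1|x1] := leP x 1.
      rewrite /g patchE ifT; last by rewrite inE /D1/= in_itv/= x0.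
      rewrite -EFinM -EFinD lee_fin ler_wpDr ?mulr_ge0 ?expR_ge0//.
      by rewrite ler_piMr ?powR_ge0// -[leRHS]expR0 ler_expR oppr_le0 ltW.
    apply: (@le_trans _ _ (C%:E * (expR (- (x / 2)))%:E)%E); last exact: leeDr.
    rewrite -EFinM lee_fin; apply: le_trans (exprn_expR_half m (ltW x0)).
    by rewrite ler_wpM2r ?expR_ge0// -powR_mulrn ?(ltW x0)// ler_powR// ltW.
rewrite ge0_integralD//; first last.
- by apply: emeasurable_funM => //.
- by move=> x _; rewrite mule_ge0// lee_fin expR_ge0.
rewrite lte_add_pinfty//.
- rewrite /g -integral_mkcondr; apply: le_lt_trans (ltry (k + 1)^-1).
  rewrite (_ : D `&` D1 = D1); first exact: integral_powR_itv01.
  apply/setIidPr => x; rewrite /D /D1/= !in_itv/= andbT => /andP[] //.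
- rewrite ge0_integralZl//.
    by rewrite lte_mul_pinfty//; [exact: integral_expR_half].
Qed.

(** The left side is the tangent of the parabola at t = 1/(2c), the point where its slope is 1. *)
Lemma sqr_ge_affine (c t : R) : 0 < c -> t - (4 * c)^-1 <= c * t ^+ 2.
Proof.
move=> c0; rewrite -subr_ge0.
have -> : c * t ^+ 2 - (t - (4 * c)^-1) = c * (t - (2 * c)^-1) ^+ 2.
  by field; rewrite gt_eqF.
by rewrite mulr_ge0 ?sqr_ge0// ltW.
Qed.

Lemma integral_powR_gauss_lty (k c : R) : -1 < k -> 0 < c ->
  (\int[mu]_(x in `]0%R, +oo[) (x `^ k * expR (- (c * x ^+ 2)))%:E < +oo)%E.
Proof.
move=> k1 c0; pose D : set (measurableTypeR R) := `]0, +oo[%classic.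
have mD : measurable D by exact: measurable_itv.
have mG : measurable_fun D (fun x : R => (x `^ k * expR (- x))%:E).
  apply/measurable_EFinP; apply: measurable_funTS; apply: measurable_funM.
    exact: measurable_powR.
  exact: measurable_expRN.
apply: (@le_lt_trans _ _ (\int[mu]_(x in D) ((expR (4 * c)^-1)%:E * (x `^ k * expR (- x))%:E))%E).
  apply: ge0_le_integral => //.
  - by move=> x _; rewrite lee_fin mulr_ge0 ?powR_ge0 ?expR_ge0.
  - apply/measurable_EFinP; apply: measurable_funTS; apply: measurable_funM.
      exact: measurable_powR.
    apply: measurable_expRN.
    by apply: measurable_funM => //; exact: measurable_funX.
  - by apply: emeasurable_funM.
  - move=> x _; rewrite -EFinM lee_fin [leRHS]mulrCA ler_wpM2l ?powR_ge0// -expRD ler_expR.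
    by have := sqr_ge_affine x c0; lra.
rewrite ge0_integralZl//.
- by rewrite lte_mul_pinfty// ?lee_fin ?expR_ge0//; exact: integral_gamma_lty.
- by move=> x _; rewrite lee_fin mulr_ge0 ?powR_ge0 ?expR_ge0.
Qed.

Lemma integral_neg_power_gauss_lty (alpha rho c : R) :
  0 < alpha < 1 -> 0 < rho -> 0 < c ->
  (\int[mu]_x (neg_power alpha (`|x| / rho) * (expR (- (c * x ^+ 2)))%:E) < +oo)%E.
Proof.
move=> /andP[a0 a1] r0 c0.
pose h (x : R) : \bar R := (neg_power alpha (`|x| / rho) * (expR (- (c * x ^+ 2)))%:E)%E.
pose D : set (measurableTypeR R) := `]0, +oo[%classic.
have mD : measurable D by exact: measurable_itv.
pose q (x : R) := rho `^ alpha * (`|x| `^ (- alpha) * expR (- (c * x ^+ 2))).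
have q0 x : 0 <= q x by rewrite !mulr_ge0 ?powR_ge0 ?expR_ge0.
have mq : measurable_fun setT q.
  apply: measurable_funM => //; apply: measurable_funM.
    by apply: (measurableT_comp (measurable_powR (- alpha))); exact: normr_measurable.
  apply: measurable_expRN.
  by apply: measurable_funM => //; exact: measurable_funX.
have hq (x : R) : x != 0 -> h x = (q x)%:E.
  move=> x0; rewrite /h /neg_power ifF; last first.
    by rewrite mulf_eq0 normr_eq0 (negbTE x0) invr_eq0 gt_eqF.
  rewrite -EFinM; congr EFin; rewrite /q powRM// ?invr_ge0 ?(ltW r0)// mulrAC mulrC; congr (_ * _).
  by rewrite -powR_inv1 ?ltW// -powRrM mulN1r opprK.
have intq : (\int[mu]_(x in D) (q x)%:E < +oo)%E.
  rewrite (_ : (\int[mu]_(x in D) _)%E = (\int[mu]_(x in D) ((rho `^ alpha)%:E *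
      (x `^ (- alpha) * expR (- (c * x ^+ 2)))%:E))%E); last first.
    apply: eq_integral => x; rewrite inE /D/= in_itv/= andbT => x0.
    by rewrite /q gtr0_norm// EFinM.
  rewrite ge0_integralZl//.
  - rewrite lte_mul_pinfty// ?lee_fin ?powR_ge0//.
    by apply: integral_powR_gauss_lty => //; rewrite ltrN2.
  - apply/measurable_EFinP; apply: measurable_funTS; apply: measurable_funM.
      exact: measurable_powR.
    apply: measurable_expRN.
    by apply: measurable_funM => //; exact: measurable_funX.
  - by move=> x _; rewrite lee_fin mulr_ge0 ?powR_ge0 ?expR_ge0.
  - by rewrite lee_fin powR_ge0.
have qN x : q (- x) = q x by rewrite /q normrN sqrrN.
pose p (x : R) := ((fun x => (q x)%:E) \_ D) x.
have mp : measurable_fun setT p.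
  apply/(measurable_restrictT _ mD); apply: measurable_funTS.
  exact/measurable_EFinP.
have p0 x : (0 <= p x)%E.
  by rewrite /p patchE; case: ifP => // _; rewrite lee_fin.
(* By parity the function is the sum of its restriction to the positive half-line and of the
   reflection of that restriction, except at 0, where it is infinite; that point is null. *)
apply: (@le_lt_trans _ _ (\int[mu]_x (p x + p (- x)%R))%E).
  have pE (y : R) : p y = if 0 < y then (q y)%:E else 0%E.
    rewrite /p patchE (_ : (y \in D) = (0 < y))//.
    by apply/idP/idP; rewrite inE /D/= in_itv/= andbT.
  have h_p (x : R) : x != 0 -> h x = (p x + p (- x)%R)%E.
    move=> x0; rewrite hq// !pE oppr_gt0 qN.
    by have [xn|xp|xx] := ltgtP x 0; rewrite ?adde0 ?add0e//; rewrite xx eqxx in x0.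
  rewrite le_eqVlt; apply/orP; left; apply/eqP.
  have mN1 : measurable ([set 0] : set (measurableTypeR R)) by exact: measurable_set1.
  have mpp : measurable_fun setT (fun x => p x + p (- x)%R)%E.
    apply: emeasurable_funD => //; apply: (measurableT_comp mp).
    exact: oppr_measurable.
  have mh : measurable_fun setT h.
    rewrite (_ : h = (fun x => if x == 0 then +oo%E else (q x)%:E)); last first.
      apply/funext => x; case: eqP => [->|/eqP x0]; last exact: hq.
      rewrite /h /neg_power normr0 mul0r eqxx expr0n/= mulr0 oppr0 expR0.
      by rewrite mule1.
    apply: measurable_fun_ifT => //.
      apply: (measurable_fun_eqr (f := id) (g := cst 0)) => //.
    exact/measurable_EFinP.
  rewrite (ge0_negligible_integral mN1)//; last 2 first.
  - move=> x _; rewrite mule_ge0 ?lee_fin ?expR_ge0//.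
    by rewrite /neg_power; case: ifP => // _; rewrite lee_fin powR_ge0.
  - exact: lebesgue_measure_set1.
  rewrite [RHS](ge0_negligible_integral mN1)//; last 2 first.
  - by move=> x _; exact: adde_ge0.
  - exact: lebesgue_measure_set1.
  apply: eq_integral => x; rewrite inE/= => -[_ /eqP x0]; exact: h_p.
have mpN : measurable_fun setT (fun x : measurableTypeR R => p (- x)).
  by apply: (measurableT_comp mp); exact: oppr_measurable.
rewrite ge0_integralD//.
rewrite (@ge0_integral_lebesgue_opp R p)//.
rewrite -/p /p -integral_mkcond.
by rewrite lte_add_pinfty.
Qed.

End power_integrals.

(** * Gauges of star bodies *)

Section star_body_theory.
Context {R : realType} {d : nat}.
Local Notation V := 'rV[R]_d.
Variable L : set V.
Hypothesis sL : star_body L.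

Lemma dilations_lb (x : V) : lbound (dilations L x) 0.
Proof. by move=> t [t0 _]; exact: ltW. Qed.

Lemma has_inf_dilations (x : V) : has_inf (dilations L x).
Proof. by have [_ _ + _] := sL => /(_ x) dx; split => //; exists 0; exact: dilations_lb. Qed.

Lemma minkowski_ge0 (x : V) : 0 <= Defs.minkowski L x.
Proof. by apply: lb_le_inf; [exact: (has_inf_dilations x).1|exact: dilations_lb]. Qed.

Lemma minkowski_leZ (r : R) (x : V) : 0 < r -> Defs.minkowski L (r *: x) <= r * Defs.minkowski L x.
Proof.
move=> r0; rewrite -ler_pdivrMl//; apply: lb_le_inf; first exact: (has_inf_dilations x).1.
move=> t [t0 [y Ly yx]]; rewrite ler_pdivrMl//.
apply: ge_inf; first by exists 0; exact: dilations_lb.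
by split; [exact: mulr_gt0|exists y => //; rewrite -yx scalerA].
Qed.

Lemma minkowski0 : Defs.minkowski L 0 = 0.
Proof.
apply/eqP; rewrite eq_le minkowski_ge0 andbT.
have h0 : 0 < 2^-1 :> R by rewrite invr_gt0.
have := minkowski_leZ 0 h0; rewrite scaler0.
by have := minkowski_ge0 0; lra.
Qed.

(** The inequality for [r] and the one for [r^-1] together give equality. *)
Lemma minkowskiZ (r : R) (x : V) : 0 <= r -> Defs.minkowski L (r *: x) = r * Defs.minkowski L x.
Proof.
rewrite le_eqVlt => /orP[/eqP <-|r0]; first by rewrite scale0r mul0r minkowski0.
apply/eqP; rewrite eq_le minkowski_leZ//=.
have ri0 : 0 < r^-1 by rewrite invr_gt0.
have := minkowski_leZ (r *: x) ri0.
by rewrite scalerA mulVf ?gt_eqF// scale1r ler_pdivlMl.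
Qed.

Lemma minkowskiN (x : V) : symmetric_set L -> Defs.minkowski L (- x) = Defs.minkowski L x.
Proof.
move=> LN; congr inf; apply/seteqP; split=> t [t0 [y Ly yx]]; split=> //.
  exists (- y); last by rewrite scalerN yx opprK.
  by rewrite LN; exists y.
exists (- y); last by rewrite scalerN yx.
by rewrite LN; exists y.
Qed.

(** Compactness of [L] bounds the coordinates of its points. The gauge therefore controls every
    coordinate, which makes it definite and bounds its negative powers. *)
Lemma minkowski_bound : exists2 rho, 0 < rho & forall (x : V) i, `|x ord0 i| <= rho * Defs.minkowski L x.
Proof.
have [cL _ _ _] := sL.
have [M [_ bM]] := compact_bounded cL.
pose rho := Num.max M 0 + 1.
have rho0 : 0 < rho by rewrite ltr_pwDr// le_max lexx orbT.
have Mrho : M < rho by rewrite ltr_pwDr// le_max lexx.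
exists rho => // x i; rewrite -ler_pdivrMl//; apply: lb_le_inf; first exact: (has_inf_dilations x).1.
move=> t [t0 [y Ly <-]]; rewrite ler_pdivrMl// mxE normrM gtr0_norm// mulrC ler_wpM2r ?(ltW t0)//.
have := bM rho Mrho y Ly; apply: le_trans.
rewrite -[leRHS]/(mx_norm y) mx_normrE.
exact: (le_bigmax _ (fun ij => `|y ij.1 ij.2|) (ord0, i)).
Qed.

Lemma minkowski_eq0 (x : V) : (Defs.minkowski L x == 0) = (x == 0).
Proof.
apply/eqP/eqP => [Nx|->]; last exact: minkowski0.
have [rho _ b] := minkowski_bound.
apply/rowP => i; have := b x i; rewrite Nx mulr0 normr_le0 => /eqP ->.
by rewrite mxE.
Qed.

Lemma measurable_minkowski : measurable_fun setT (Defs.minkowski L).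
Proof. by have [_ _ _ cN] := sL; exact: continuous_measurable_mx. Qed.

End star_body_theory.

Section neg_power_theory.
Context {R : realType}.

Lemma neg_power_ge0 (l r : R) : (0 <= neg_power l r)%E.
Proof. by rewrite /neg_power; case: ifP => // _; rewrite lee_fin powR_ge0. Qed.

Lemma neg_power_gt0 (l r : R) : 0 <= r -> (0 < neg_power l r)%E.
Proof.
move=> r0; rewrite /neg_power; case: eqP => [//|/eqP rn0]; rewrite lte_fin powR_gt0//.
by rewrite lt_def rn0.
Qed.

Lemma neg_powerM (l c r : R) : 0 < c -> 0 <= r ->
  (neg_power l (c * r) = (c `^ (- l))%:E * neg_power l r)%E.
Proof.
move=> c0 r0; rewrite /neg_power mulf_eq0 gt_eqF//=; case: ifP => _.
  by rewrite gt0_muley// lte_fin powR_gt0.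
by rewrite powRM// ltW.
Qed.

Lemma measurable_neg_power (l : R) : measurable_fun setT (neg_power l).
Proof.
apply: measurable_fun_ifT => //.
  exact: (measurable_fun_eqr (f := id) (g := cst 0)).
by apply/measurable_EFinP; exact: measurable_powR.
Qed.

End neg_power_theory.

Section local_integrability.
Context {R : realType} {d : nat}.
Local Notation V := 'rV[R]_d.
Local Notation mu := (@lebesgue_measure R).
Variable L : set V.
Hypothesis sL : star_body L.
Local Notation N := (Defs.minkowski L).

(** The power -l is shared equally among the d coordinates, each of which the gauge controls. When l
    < d each factor has an exponent of modulus l/d < 1, integrable near 0 on the line. If a
    coordinate vanishes the right side is infinite. *)
Lemma neg_power_minkowski_le (l rho : R) (y : V) : (0 < d)%N -> 0 < l -> 0 < rho ->
  (forall (x : V) i, `|x ord0 i| <= rho * N x) ->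
  (neg_power l (N y) <= \prod_(i < d) neg_power (l / d%:R) (`|y ord0 i| / rho))%E.
Proof.
move=> d0 l0 rho0 b.
have [/existsP[i /eqP yi]|/existsPn y0] := boolP [exists i, y ord0 i == 0].
  rewrite (bigD1 i)//=.
  have -> : neg_power (l / d%:R) (`|y ord0 i| / rho) = +oo%E.
    by rewrite /neg_power yi normr0 mul0r eqxx.
  rewrite gt0_mulye ?leey//; elim/big_ind : _ => // [x z|j _]; first exact: mule_gt0.
  by rewrite neg_power_gt0// divr_ge0// ltW.
have dn0 : d%:R != 0 :> R by rewrite pnatr_eq0 -lt0n.
have Ny : 0 < N y.
  rewrite lt_def minkowski_ge0// andbT minkowski_eq0//.
  by apply/negP => /eqP y00; have := y0 (Ordinal d0); rewrite y00 mxE eqxx.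
rewrite {1}/neg_power gt_eqF//.
have -> : (\prod_(i < d) neg_power (l / d%:R) (`|y ord0 i| / rho))%E =
    (\prod_(i < d) (`|y ord0 i| / rho) `^ (- (l / d%:R)))%:E.
  rewrite -prodEFin; apply: eq_bigr => i _; rewrite /neg_power ifF//.
  by rewrite mulf_eq0 normr_eq0 (negbTE (y0 i)) invr_eq0 gt_eqF.
rewrite lee_fin.
have -> : N y `^ (- l) = \prod_(i < d) N y `^ (- (l / d%:R)).
  rewrite prodr_const card_ord -powR_mulrn ?powR_ge0// -powRrM mulNr divfK//.
apply: ler_prod => i _; rewrite powR_ge0/=.
have yi0 : 0 < `|y ord0 i| / rho by rewrite divr_gt0// normr_gt0 y0.
have yN : `|y ord0 i| / rho <= N y by rewrite ler_pdivrMr// mulrC.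
rewrite !powRN lef_pV2 ?posrE ?powR_gt0//.
have ld0 : 0 <= l / d%:R by rewrite divr_ge0 ?ler0n// ltW.
by apply: ge0_ler_powR => //; rewrite nnegrE ltW.
Qed.

Lemma integral_minkowski_gauss_lty (l c : R) : 0 < l < d%:R -> 0 < c ->
  (\int[lebesgue_mx]_y (neg_power l (N y) * (expR (- (c * mxdot y y)))%:E) < +oo)%E.
Proof.
move=> /andP[l0 ld] c0.
have d0 : (0 < d)%N by rewrite -(ltr_nat R) (lt_trans l0).
have [rho rho0 b] := minkowski_bound sL.
pose h (x : R) := (neg_power (l / d%:R) (`|x| / rho) * (expR (- (c * x ^+ 2)))%:E)%E.
have h0 x : (0 <= h x)%E by rewrite mule_ge0 ?neg_power_ge0// lee_fin expR_ge0.
have mexp : measurable_fun setT (fun x : R => (expR (- (c * x ^+ 2)))%:E).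
  by apply/measurable_EFinP; apply: measurable_expRN; apply: measurable_funM.
have mh : measurable_fun setT h.
  apply: emeasurable_funM => //; apply: (measurableT_comp (measurable_neg_power _)).
  by apply: measurable_funM => //; exact: normr_measurable.
have prodh0 (y : V) : (0 <= \prod_(i < d) h (y ord0 i))%E by exact: prode_ge0.
have mprodh : measurable_fun setT (fun y : V => \prod_(i < d) h (y ord0 i))%E.
  apply: emeasurable_prod => i.
  exact: (measurableT_comp mh (measurable_mx_entry ord0 i)).
apply: (@le_lt_trans _ _ (\int[lebesgue_mx]_y \prod_(i < d) h (y ord0 i))%E).
  apply: ge0_le_integral => //.
  - by move=> y _; rewrite mule_ge0 ?neg_power_ge0// lee_fin expR_ge0.
  - apply: emeasurable_funM.
      apply: (measurableT_comp (measurable_neg_power _)); exact: measurable_minkowski.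
    apply/measurable_EFinP; apply: measurable_expRN; apply: measurable_funM => //.
    exact: measurable_mxdot.
  - move=> y _; rewrite /h big_split/= prodEFin.
    have -> : \prod_(i < d) expR (- (c * y ord0 i ^+ 2)) = expR (- (c * mxdot y y)).
      rewrite -expR_sum /mxdot big_ord1 mulr_sumr -sumrN.
      by congr expR; apply: eq_bigr => i _; rewrite expr2.
    rewrite lee_wpmul2r ?lee_fin ?expR_ge0//.
    exact: neg_power_minkowski_le.
rewrite ge0_integral_lebesgue_mx//.
rewrite (_ : (\int[_]_t _)%E = (\int[lebesgue_tuple (1 * d)]_t \prod_(k < 1 * d) h (tnth t k))%E).
  rewrite integral_lebesgue_tuple_prod//.
  rewrite (_ : (\int[mu]_x h x)%E = (fine (\int[mu]_x h x))%:E).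
    by rewrite prodEFin ltry.
  rewrite fineK// ge0_fin_numE ?integral_ge0//.
  apply: integral_neg_power_gauss_lty => //.
  by rewrite divr_gt0 ?ltr0n//= ltr_pdivrMr ?ltr0n// mul1r.
apply: eq_integral => t _; rewrite (@eprod_mxvec_index _ 1 d (fun i j => h (mx_of_tuple t i j))).
  by rewrite big_ord1.
by move=> i j; rewrite mxE.
Qed.

End local_integrability.

(** * Conditioning on one row *)

Section shear.
Context {R : realType} {n d : nat}.
Local Notation M := 'M[R]_(n, d).
Local Notation V := 'rV[R]_d.

Definition rowcomb (c : 'I_n -> R) (X : M) : V := \sum_i c i *: row i X.

Lemma measurable_rowcomb c : measurable_fun setT (rowcomb c).
Proof.
apply: measurable_fun_mx => i j.
rewrite (_ : (fun X : M => _) = (fun X => \sum_(k < n) c k * X k j)); last first.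
  by apply/funext => X; rewrite summxE; apply: eq_bigr => k _; rewrite !mxE.
apply: measurable_sum => k; apply: measurable_funM => //.
exact: measurable_mx_entry.
Qed.

Lemma mxdot_sum_row (X Y : M) : mxdot X Y = \sum_i mxdot (row i X) (row i Y).
Proof.
apply: eq_bigr => i _; rewrite /mxdot big_ord1.
by apply: eq_bigr => j _; rewrite !mxE.
Qed.

Lemma mxdot_rowcomb c (xi : V) (X : M) :
  mxdot (rowcomb c X) xi = mxdot (\matrix_(i, j) (c i * xi ord0 j)) X.
Proof.
rewrite mxdot_sum_row /rowcomb.
transitivity (\sum_i mxdot (c i *: row i X) xi).
  elim/big_rec2 : _ => [|i y1 y2 _ <-]; first by rewrite mxdot0l.
  by rewrite mxdotDl.
apply: eq_bigr => i _.
have -> : row i (\matrix_(i0, j) (c i0 * xi ord0 j)) = c i *: xi.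
  by apply/rowP => j; rewrite !mxE.
by rewrite !mxdotZl mxdotC.
Qed.

Variable i0 : 'I_n.

Definition setrow (w : V) (X : M) : M := \matrix_(i, j) if i == i0 then w ord0 j else X i j.

Lemma row_setrow w X i : row i (setrow w X) = if i == i0 then w else row i X.
Proof. by apply/rowP => j; rewrite !mxE; case: ifP => _; rewrite ?mxE. Qed.

Lemma setrowE w X : setrow w X = X + setrow (w - row i0 X) 0.
Proof.
apply/matrixP => i j; rewrite !mxE; case: eqP => [->|_]; last by rewrite addr0.
by rewrite addrC subrK.
Qed.

Definition own_row (s : seq ('I_n * V)) : seq ('I_1 * V) :=
  [seq (ord0, q.2) | q <- s & q.1 == i0].

Definition other_rows (s : seq ('I_n * V)) := [seq q <- s | q.1 != i0].

Lemma quad_setrow e s w X :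
  quad e s (setrow w X) + e ^+ 2 * mxdot (row i0 X) (row i0 X) =
  quad e (own_row s) w + quad e (other_rows s) X.
Proof.
rewrite /quad.
rewrite [RHS]addrACA -mulrDr addrAC -mulrDr.
have -> : mxdot (setrow w X) (setrow w X) + mxdot (row i0 X) (row i0 X) =
    mxdot w w + mxdot X X.
  rewrite !(mxdot_sum_row X) !(mxdot_sum_row (setrow w X)) !(bigD1 i0 isT)/=.
  rewrite row_setrow eqxx addrAC -addrA; congr (_ + (_ + _)).
  by apply: eq_bigr => i ii0; rewrite row_setrow (negbTE ii0).
congr (_ + _); rewrite /own_row big_map !big_filter (bigID (fun q => q.1 == i0))/=.
congr (_ + _); apply: eq_bigr => q qi0; rewrite row_setrow.
  rewrite qi0; congr (mxdot _ _ ^+ 2).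
  by apply/rowP => j; rewrite mxE.
by rewrite (negbTE qi0).
Qed.

Lemma gauss_setrow e s w X :
  gauss e s (setrow w X) * expR (- (e ^+ 2 * mxdot (row i0 X) (row i0 X))) =
  gauss e (own_row s) w * gauss e (other_rows s) X.
Proof. by rewrite /gauss -!expRD -!opprD quad_setrow. Qed.

Lemma rowcomb_setrow c w X :
  rowcomb c (setrow w X) = c i0 *: w + rowcomb c (setrow 0 X).
Proof.
rewrite /rowcomb (bigD1 i0)//= row_setrow eqxx; congr (_ + _).
rewrite [RHS](bigD1 i0)//= row_setrow eqxx scaler0 add0r.
by apply: eq_bigr => i ii0; rewrite !row_setrow (negbTE ii0).
Qed.

Lemma measurable_setrow dT (T : measurableType dT) (f : T -> V) (g : T -> M) :
  measurable_fun setT f -> measurable_fun setT g ->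
  measurable_fun setT (fun x => setrow (f x) (g x)).
Proof.
move=> mf mg; apply: measurable_fun_mx => i j.
under eq_fun do rewrite mxE.
case: (i == i0).
  exact: (measurableT_comp (measurable_mx_entry ord0 j) mf).
exact: (measurableT_comp (measurable_mx_entry i j) mg).
Qed.

(* A dummy row [w] with the Gaussian density centred at row [i0] is added; the
   invariance of Lebesgue measure under the shear [X |-> X + e_i0 w] and
   Tonelli's theorem then exchange the two rows. *)
Lemma integral_setrow (e : R) (H : M -> \bar R) :
  measurable_fun setT H -> (forall X, 0 <= H X)%E ->
  ((\int[lebesgue_mx]_w (gauss e [::] (w : V))%:E) * \int[lebesgue_mx]_X H X =
  \int[lebesgue_mx]_X \int[lebesgue_mx]_w
    (H (setrow w X) * (expR (- (e ^+ 2 * mxdot (row i0 X) (row i0 X))))%:E))%E.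
Proof.
move=> mH H0.
pose b (w : V) := (expR (- (e ^+ 2 * mxdot w w)))%:E.
have b0 w : (0 <= b w)%E by rewrite lee_fin expR_ge0.
have bE w : (gauss e [::] w)%:E = b w by rewrite /gauss /quad big_nil addr0.
have mb : measurable_fun setT b.
  apply/measurable_EFinP; apply: measurable_expRN; apply: measurable_funM => //.
  exact: measurable_mxdot.
have mr : measurable_fun setT (fun X : M => row i0 X) by exact: measurable_row.
have mopp : measurable_fun setT (fun w : V => - w).
  by under eq_fun do rewrite -scaleN1r; exact: measurable_mx_scale.
have mrow1 : measurable_fun setT (fun z : M * V => row i0 z.1).
  exact: (measurableT_comp mr).
pose B := (\int[lebesgue_mx]_w b w)%E.
have B0 : (0 <= B)%E by exact: integral_ge0.
transitivity (\int[lebesgue_mx]_X \int[lebesgue_mx]_w (H X * b (row i0 X - w)%R))%E.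
  under [in LHS]eq_integral do rewrite bE.
  rewrite -ge0_integralZl//; apply: eq_integral => X _.
  have mbX : measurable_fun setT (fun w : V => b (row i0 X - w)).
    by apply: (measurableT_comp mb); exact: measurable_mx_add.
  rewrite muleC ge0_integralZl; last 4 first.
  - by [].
  - exact: mbX.
  - by move=> w _; exact: b0.
  - exact: H0.
  congr (_ * _)%E; rewrite -(ge0_integral_lebesgue_mx_opp mb b0).
  rewrite -(ge0_integral_lebesgue_mx_shift (- row i0 X) (measurableT_comp mb mopp)
    (fun w => b0 (- w))).
  by apply: eq_integral => w _; rewrite /comp/= opprD opprK addrC.
pose F1 (z : M * V) := (H z.1 * b (row i0 z.1 - z.2)%R)%E.
have mF1 : measurable_fun setT F1.
  apply: emeasurable_funM; first exact: (measurableT_comp mH).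
  apply: (measurableT_comp mb); apply: measurable_mx_add => //.
  exact: (measurableT_comp mopp).
have F10 z : (0 <= F1 z)%E by exact: mule_ge0.
apply: etrans; first exact: (fubini_tonelli (m1 := lebesgue_mx) (m2 := lebesgue_mx) F1 mF1 F10).
pose F2 (z : M * V) := (H (z.1 + setrow z.2 0)%R * b (row i0 z.1))%E.
have mset : measurable_fun setT (fun z : M * V => z.1 + setrow z.2 0).
  by apply: measurable_mx_add => //; exact: measurable_setrow.
have mF2 : measurable_fun setT F2.
  apply: emeasurable_funM; first exact: (measurableT_comp mH).
  exact: (measurableT_comp mb).
transitivity (\int[lebesgue_mx]_w \int[lebesgue_mx]_X F2 (X, w))%E.
  apply: eq_integral => w _.
  (* Translating [X] by the matrix whose only nonzero row is [w] frees the damping factor from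
     [w]. *)
  rewrite -[LHS](ge0_integral_lebesgue_mx_shift (setrow w 0)); last 2 first.
  - exact: (measurableT_comp mF1 (measurable_pair2 w)).
  - by move=> X; exact: mule_ge0.
  apply: eq_integral => X _; rewrite /F1 /F2/=; congr (_ * b _)%E.
  by rewrite linearD/= row_setrow eqxx addrK.
rewrite -(fubini_tonelli (m1 := lebesgue_mx) (m2 := lebesgue_mx) F2 mF2); last first.
  by move=> z; exact: mule_ge0.
apply: eq_integral => X _.
(* Translating [w] by minus the row [i0] turns the addition of [w] to that row into its replacement
   by [w]. *)
rewrite -[LHS](ge0_integral_lebesgue_mx_shift (- row i0 X)); last 2 first.
- exact: (measurableT_comp mF2 (measurable_pair1 X)).
- by move=> w; exact: mule_ge0.
by apply: eq_integral => w _; rewrite /F2/= -setrowE.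
Qed.

(** Given the rows other than [i0], the combination is [c i0 *: w] plus a constant, where [w] has
    density [gauss e (own_row s)]. The factor on the left is the mass of a dummy row; on the right
    that row sits at place [i0] in [gauss e (other_rows s)], where only the damping acts on it. *)
Lemma integral_rowcomb_gauss (e : R) s c (F : V -> \bar R) :
  measurable_fun setT F -> (forall y, 0 <= F y)%E ->
  ((\int[lebesgue_mx]_w (gauss e [::] (w : V))%:E) *
     \int[lebesgue_mx]_X (F (rowcomb c X) * (gauss e s X)%:E) =
  \int[lebesgue_mx]_X ((gauss e (other_rows s) X)%:E *
    \int[lebesgue_mx]_w (F (c i0 *: w + rowcomb c (setrow 0 X))%R *
      (gauss e (own_row s) w)%:E)))%E.
Proof.
move=> mF F0; rewrite integral_setrow//; first last.
- by move=> X; rewrite mule_ge0// lee_fin gauss_ge0.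
- apply: emeasurable_funM; first exact: (measurableT_comp mF (measurable_rowcomb c)).
  by apply/measurable_EFinP; exact: measurable_gauss.
apply: eq_integral => X _; rewrite -ge0_integralZl.
- apply: eq_integral => w _.
  by rewrite -muleA -EFinM gauss_setrow rowcomb_setrow muleCA -EFinM mulrC.
- by [].
- apply: emeasurable_funM.
    apply: (measurableT_comp mF); apply: measurable_mx_add => //.
    exact: measurable_mx_scale.
  by apply/measurable_EFinP; exact: measurable_gauss.
- by move=> w _; rewrite mule_ge0// lee_fin gauss_ge0.
- by rewrite lee_fin gauss_ge0.
Qed.

End shear.

(** * Polar integrals and the embedding formula *)

Section polar_integral.
Context {R : realType} {d : nat}.
Local Notation V := 'rV[R]_d.
Local Notation mu := (@lebesgue_measure R).
Variables (l : R) (sigma : {finite_measure set V -> \bar R}).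

(** The radial weight, extended by zero outside positive radii and unit directions: polar integrals
    then run over a full product space, as Tonelli's theorem wants. *)
Definition polar_weight (z : R * V) : R :=
  if (0 < z.1) && (dotv z.2 z.2 == 1) then z.1 `^ (l - 1) else 0.

(** The right side of the embedding formula, with an arbitrary function in the place of the Fourier
    transform and with values in the extended reals. *)
Definition polar (H : V -> \bar R) : \bar R :=
  (\int[mu]_t \int[sigma]_theta ((polar_weight (t, theta))%:E * H (t *: theta)%R))%E.

Lemma measurable_dotv : measurable_fun setT (fun u : V => dotv u u).
Proof. by under eq_fun do rewrite dotvE; exact: measurable_mxdot. Qed.

Lemma measurable_sphere : measurable (@sphere R d).
Proof.
rewrite -[X in measurable X]setTI.
exact: (measurable_dotv measurableT (measurable_set1 (1 : measurableTypeR R))).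
Qed.

Lemma polar_weight_ge0 z : 0 <= polar_weight z.
Proof. by rewrite /polar_weight; case: ifP => // _; exact: powR_ge0. Qed.

Lemma measurable_polar_weight : measurable_fun setT polar_weight.
Proof.
apply: measurable_fun_ifT => //.
  apply: measurable_and.
    exact: measurable_fun_ltr.
  apply: measurable_fun_eqr => //.
  exact: (measurableT_comp measurable_dotv).
exact: (measurableT_comp (measurable_powR (l - 1))).
Qed.

Let measurable_scale : measurable_fun setT (fun z : R * V => z.1 *: z.2).
Proof. by apply: measurable_mx_scale. Qed.

Lemma measurable_polar_integrand (H : V -> \bar R) : measurable_fun setT H ->
  measurable_fun setT (fun z : R * V => ((polar_weight z)%:E * H (z.1 *: z.2)%R)%E).
Proof.
move=> mH; apply: emeasurable_funM.
  by apply/measurable_EFinP; exact: measurable_polar_weight.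
exact: (measurableT_comp mH measurable_scale).
Qed.

Lemma measurable_polar_inner (H : V -> \bar R) :
  measurable_fun setT H -> (forall x, 0 <= H x)%E ->
  measurable_fun setT (fun t : R =>
    \int[sigma]_theta ((polar_weight (t, theta))%:E * H (t *: theta)%R))%E.
Proof.
move=> mH H0.
apply: (measurable_fun_fubini_tonelli_F (m2 := sigma)
  (fun z : R * V => ((polar_weight z)%:E * H (z.1 *: z.2)%R)%E)).
  exact: measurable_polar_integrand.
by move=> z; rewrite mule_ge0// lee_fin polar_weight_ge0.
Qed.

Lemma measurable_polar_section (H : V -> \bar R) (t : R) :
  measurable_fun setT H ->
  measurable_fun setT (fun theta : V => (polar_weight (t, theta))%:E * H (t *: theta)%R)%E.
Proof.
by move=> mH; exact: (measurableT_comp (measurable_polar_integrand mH) (measurable_pair1 t)).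
Qed.

Lemma polar_ge0 (H : V -> \bar R) : (forall x, 0 <= H x)%E -> (0 <= polar H)%E.
Proof.
move=> H0; apply: integral_ge0 => t _; apply: integral_ge0 => th _.
by rewrite mule_ge0// lee_fin polar_weight_ge0.
Qed.

Lemma polarZ (k : R) (H : V -> \bar R) : 0 <= k ->
  measurable_fun setT H -> (forall x, 0 <= H x)%E ->
  polar (fun x => k%:E * H x)%E = (k%:E * polar H)%E.
Proof.
move=> k0 mH H0; rewrite /polar -ge0_integralZl//; last 2 first.
- exact: measurable_polar_inner.
- by move=> t _; apply: integral_ge0 => th _; rewrite mule_ge0// lee_fin polar_weight_ge0.
apply: eq_integral => t _; rewrite -ge0_integralZl//; last 2 first.
- exact: measurable_polar_section.
- by move=> th _; rewrite mule_ge0// lee_fin polar_weight_ge0.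
by apply: eq_integral => th _; rewrite muleCA.
Qed.

Lemma polarD (H1 H2 : V -> \bar R) :
  measurable_fun setT H1 -> (forall x, 0 <= H1 x)%E ->
  measurable_fun setT H2 -> (forall x, 0 <= H2 x)%E ->
  polar (fun x => H1 x + H2 x)%E = (polar H1 + polar H2)%E.
Proof.
move=> mH1 H10 mH2 H20; rewrite /polar -ge0_integralD//; first last.
- exact: measurable_polar_inner.
- by move=> t _; apply: integral_ge0 => th _; rewrite mule_ge0// lee_fin polar_weight_ge0.
- exact: measurable_polar_inner.
- by move=> t _; apply: integral_ge0 => th _; rewrite mule_ge0// lee_fin polar_weight_ge0.
apply: eq_integral => t _; rewrite -ge0_integralD//; first last.
- exact: measurable_polar_section.
- by move=> th _; rewrite mule_ge0// lee_fin polar_weight_ge0.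
- exact: measurable_polar_section.
- by move=> th _; rewrite mule_ge0// lee_fin polar_weight_ge0.
by apply: eq_integral => th _; rewrite ge0_muleDr.
Qed.

Lemma polar_inner_le (H : V -> R) (M c : R) (t : R) :
  measurable_fun setT H -> (forall x, 0 <= H x) ->
  (forall x, H x <= M * expR (- (c * mxdot x x))) ->
  (\int[sigma]_theta ((polar_weight (t, theta))%:E * (H (t *: theta)%R)%:E) <=
    (if 0 < t then M * (t `^ (l - 1) * expR (- (c * t ^+ 2))) else 0)%:E * sigma setT)%E.
Proof.
move=> mH H0 HM.
have M0 : 0 <= M.
  by have := le_trans (H0 0) (HM 0); rewrite mxdot0l mulr0 oppr0 expR0 mulr1.
have k0 : 0 <= if 0 < t then M * (t `^ (l - 1) * expR (- (c * t ^+ 2))) else 0.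
  by case: ifP => // _; rewrite !mulr_ge0 ?powR_ge0 ?expR_ge0.
rewrite -integral_cst//; apply: ge0_le_integral => //.
- by move=> th _; rewrite -EFinM lee_fin mulr_ge0// polar_weight_ge0.
- by apply: (@measurable_polar_section (EFin \o H)); exact/measurable_EFinP.
- move=> th _; rewrite -EFinM lee_fin /polar_weight/=.
  have [t0|t0] := ltP 0 t; last by rewrite mul0r.
  have [/eqP thS/=|thS/=] := boolP (dotv th th == 1); last first.
    by rewrite mul0r !mulr_ge0 ?powR_ge0 ?expR_ge0.
  rewrite mulrCA ler_wpM2l ?powR_ge0//; apply: le_trans (HM _) _.
  by rewrite mxdotZl mxdotZr -dotvE thS mulr1 expr2.
Qed.

(** Positivity of [l] gives integrability of t^(l-1) near 0, the Gaussian bound gives it at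
    infinity, and [sigma] has finite mass. *)
Lemma polar_lty (H : V -> R) (M c : R) : 0 < l -> 0 < c ->
  measurable_fun setT H -> (forall x, 0 <= H x) ->
  (forall x, H x <= M * expR (- (c * mxdot x x))) ->
  (polar (EFin \o H) < +oo)%E.
Proof.
move=> l0 c0 mH H0 HM.
have M0 : 0 <= M.
  by have := le_trans (H0 0) (HM 0); rewrite mxdot0l mulr0 oppr0 expR0 mulr1.
have sfin : sigma setT \is a fin_num by exact: fin_num_measure.
pose D : set (measurableTypeR R) := `]0, +oo[%classic.
have mD : measurable D by exact: measurable_itv.
pose g (t : R) := t `^ (l - 1) * expR (- (c * t ^+ 2)).
have mg : measurable_fun setT g.
  apply: measurable_funM; first exact: measurable_powR.
  by apply: measurable_expRN; apply: measurable_funM => //; exact: measurable_funX.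
have g0 t : 0 <= g t by rewrite mulr_ge0 ?powR_ge0 ?expR_ge0.
pose k (t : R) := if 0 < t then M * g t else 0.
have k0 t : 0 <= k t by rewrite /k; case: ifP => // _; exact: mulr_ge0.
have mk : measurable_fun setT k.
  by apply: measurable_fun_ifT => //; [exact: measurable_fun_ltr|exact: measurable_funM].
apply: (@le_lt_trans _ _ (\int[mu]_t ((k t)%:E * sigma setT))%E).
  apply: ge0_le_integral => //.
  - by move=> t _; apply: integral_ge0 => th _; rewrite -EFinM lee_fin mulr_ge0// polar_weight_ge0.
  - apply: measurable_polar_inner; first exact/measurable_EFinP.
    by move=> x; rewrite lee_fin.
  - by apply: emeasurable_funM => //; exact/measurable_EFinP.
  - by move=> t _; exact: polar_inner_le.
rewrite ge0_integralZr//; first last.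
- by move=> t _; rewrite lee_fin.
- exact/measurable_EFinP.
have kint : (\int[mu]_t (k t)%:E < +oo)%E.
  rewrite (_ : (\int[mu]_t _)%E = (\int[mu]_(t in D) (M%:E * (g t)%:E))%E).
    rewrite ge0_integralZl//.
    - by rewrite lte_mul_pinfty//; apply: integral_powR_gauss_lty => //; lra.
    - by apply: measurable_funTS; exact/measurable_EFinP.
    - by move=> t _; rewrite lee_fin.
  rewrite [RHS]integral_mkcond; apply: eq_integral => t _.
  rewrite patchE /k (_ : (t \in D) = (0 < t)); first by case: ifP => // _; rewrite EFinM.
  by apply/idP/idP; rewrite inE /D/= in_itv/= andbT.
rewrite -(fineK sfin) muleC lte_mul_pinfty//.
by rewrite lee_fin fine_ge0.
Qed.

Lemma polar_inner_sphere (H : V -> \bar R) (t : R) : 0 < t ->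
  (\int[sigma]_theta ((polar_weight (t, theta))%:E * H (t *: theta)%R) =
   \int[sigma]_(theta in sphere) ((t `^ (l - 1))%:E * H (t *: theta)%R))%E.
Proof.
move=> t0; rewrite [RHS]integral_mkcond; apply: eq_integral => th _.
rewrite patchE /polar_weight/= t0/= (_ : (th \in sphere) = (dotv th th == 1)).
  by case: ifP => // _; rewrite mul0e.
by apply/idP/eqP; rewrite inE.
Qed.

(** Passage between [polar] and the real-valued iterated integrals of the embedding formula.
    Integrability at both levels is recorded because differences of such integrals are taken
    later. *)
Lemma polar_Rintegral (H : V -> R) (M c : R) : 0 < l -> 0 < c ->
  measurable_fun setT H -> (forall x, 0 <= H x) ->
  (forall x, H x <= M * expR (- (c * mxdot x x))) ->
  [/\ forall t, 0 < t ->
        sigma.-integrable sphere (fun theta => (t `^ (l - 1) * H (t *: theta))%:E),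
      mu.-integrable `]0%R, +oo[ (fun t =>
        (\int[sigma]_(theta in sphere) (t `^ (l - 1) * H (t *: theta)))%:E) &
      \int[mu]_(t in `]0, +oo[) \int[sigma]_(theta in sphere) (t `^ (l - 1) * H (t *: theta)) =
      fine (polar (EFin \o H))].
Proof.
move=> l0 c0 mH H0 HM.
have sfin : sigma setT \is a fin_num by exact: fin_num_measure.
pose D : set (measurableTypeR R) := `]0, +oo[%classic.
have mD : measurable D by exact: measurable_itv.
have DE t : (t \in D) = (0 < t).
  by apply/idP/idP; rewrite inE /D/= in_itv/= andbT.
have inner_lty t : (\int[sigma]_theta ((polar_weight (t, theta))%:E * (H (t *: theta)%R)%:E) < +oo)%E.
  apply: le_lt_trans (polar_inner_le t mH H0 HM) _.
  by rewrite -(fineK sfin) -EFinM ltry.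
have mHE : measurable_fun setT (EFin \o H) by exact/measurable_EFinP.
have HE0 x : (0 <= (EFin \o H) x)%E by rewrite lee_fin.
pose inner t : \bar R := (\int[sigma]_theta ((polar_weight (t, theta))%:E * (H (t *: theta)%R)%:E))%E.
have minner : measurable_fun setT inner := measurable_polar_inner mHE HE0.
have inner0 t : (0 <= inner t)%E.
  by apply: integral_ge0 => th _; rewrite -EFinM lee_fin mulr_ge0// polar_weight_ge0.
have innerE t : 0 < t -> inner t =
    (\int[sigma]_(theta in sphere) (t `^ (l - 1) * H (t *: theta))%:E)%E.
  by move=> t0; rewrite /inner (polar_inner_sphere (EFin \o H))//.
have RE t : 0 < t ->
    (\int[sigma]_(theta in sphere) (t `^ (l - 1) * H (t *: theta)))%:E = inner t.
  move=> t0; rewrite /Rintegral -innerE// fineK// ge0_fin_numE//.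
  exact: inner_lty.
have polarE : polar (EFin \o H) = (\int[mu]_(t in D) inner t)%E.
  rewrite [RHS]integral_mkcond; apply: eq_integral => t _.
  rewrite patchE DE; case: ifPn => // t0.
  by apply: integral0_eq => th _; rewrite /polar_weight/= (negbTE t0) mul0e.
have Hlty := polar_lty l0 c0 mH H0 HM.
split.
- move=> t t0; apply/integrableP; split.
    apply/measurable_EFinP; apply: measurable_funTS; apply: measurable_funM => //.
    by apply: (measurableT_comp mH); exact: measurable_mx_scale.
  under eq_integral do rewrite gee0_abs ?lee_fin ?mulr_ge0 ?powR_ge0//.
  by rewrite -innerE//; exact: inner_lty.
- apply: (@eq_integrable _ _ _ _ _ mD inner).
    by move=> t; rewrite DE => t0; rewrite RE.
  apply/integrableP; split; first exact: measurable_funTS.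
  under eq_integral do rewrite gee0_abs//.
  by rewrite -polarE.
- rewrite /Rintegral polarE; congr fine; apply: eq_integral => t.
  by rewrite DE => t0; rewrite -RE.
Qed.

End polar_integral.

Lemma integral_scale_shift (R : realType) d (r : R) (z : 'rV[R]_d)
    (G : 'rV[R]_d -> \bar R) :
  0 < r -> measurable_fun setT G -> (forall y, 0 <= G y)%E ->
  (\int[lebesgue_mx]_y G y = (r ^+ d)%:E * \int[lebesgue_mx]_w G (r *: w + z)%R)%E.
Proof.
move=> r0 mG G0; have rn0 : r != 0 by rewrite gt_eqF.
rewrite (ge0_integral_lebesgue_mx_affine z rn0 mG G0) mul1n (gtr0_norm r0).
by rewrite muleA -EFinM -exprMn divff// expr1n mul1e.
Qed.

Section embedding.
Context {R : realType} {d : nat}.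
Local Notation V := 'rV[R]_d.
Local Notation mu := (@lebesgue_measure R).
Variables (l : R) (L : set V) (sigma : {finite_measure set V -> \bar R}).
Hypotheses (l0d : 0 < l < d%:R) (sL : star_body L) (symL : symmetric_set L).
Local Notation N := (Defs.minkowski L).
Hypothesis embed : forall psi : V -> R[i], schwartz psi -> (forall x, psi (- x) = psi x) ->
  Cintegral lebesgue_mx setT (fun x => ((N x `^ (- l))%:C * psi x)%C) =
  Cintegral lebesgue_measure `]0, +oo[ (fun t =>
    Cintegral sigma sphere (fun theta =>
      ((t `^ (l - 1))%:C * fourier psi (t *: theta))%C)).

(** Real part of the embedding formula: for a real [psi] the sines contribute only to the imaginary
    part of the Fourier transform. *)
Lemma embed_real (psi : V -> R) : schwartz_real psi -> (forall x, psi (- x) = psi x) ->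
  \int[lebesgue_mx]_x (N x `^ (- l) * psi x) =
  \int[mu]_(t in `]0, +oo[) \int[sigma]_(theta in sphere)
     (t `^ (l - 1) * \int[lebesgue_mx]_y (psi y * cos (2 * pi * mxdot (t *: theta) y))).
Proof.
move=> spsi psiN.
have s0 : schwartz_real (fun _ : V => 0 : R).
  have := schwartz_real_polyfun_exp (h := fun y : V => mxdot y y) (c := 1) (C0 := 0) _ ltr01 _ (polyfun_cst 0).
  rewrite (_ : (fun y : V => 0 * _) = (fun=> 0)); last by apply/funext => y; rewrite mul0r.
  apply; last by move=> y; rewrite mul1r subr0.
  by apply: polyfun_sum => i; apply: polyfun_sum => j; rewrite (ord1 i); apply: polyfunM; exact: polyfun_coord.
have := @embed (fun x => (psi x)%:C)%C (conj spsi s0).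
have psiNC x : ((psi (- x))%:C = (psi x)%:C)%C by rewrite psiN.
move=> /(_ psiNC) /(congr1 (@complex.Re R)) /=.
have ReM (a : R) (w : R[i]) : complex.Re (a%:C * w)%C = a * complex.Re w.
  by case: w => x y; rewrite /= mul0r subr0.
under eq_Rintegral do rewrite mul0r subr0.
move=> ->; apply: eq_Rintegral => t _; apply: eq_Rintegral => th _.
rewrite mul0r subr0; congr (_ * _); apply: eq_Rintegral => y _.
by rewrite mul0r subr0 cosN dotvE.
Qed.

Variables (e r Cg cg : R) (s : seq ('I_1 * V)) (b : 'I_1 -> V -> V -> R).
Hypotheses (e0 : e != 0) (r0 : 0 < r) (Cg0 : 0 < Cg) (cg0 : 0 < cg).
Hypothesis bil : bilinear_form (b ord0).
Hypothesis bcg : forall x, cg * mxdot x x <= b ord0 x x.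
Hypothesis cov : has_covariance (gauss e s) Cg b.
Local Notation g := (gauss e s).

(** Characteristic function, at frequency 2 pi xi, of [r] times a vector with the normalised density
    [g]. *)
Definition row_charfun (xi : V) : R := expR (- b ord0 ((2 * pi * r) *: xi) ((2 * pi * r) *: xi)).

Lemma gaussN (x : V) : g (- x) = g x.
Proof. by rewrite /gauss quadN. Qed.

Let meN (z : V) : measurable_fun setT (fun y : V => (g (r^-1 *: (y - z)))%:E).
Proof.
apply/measurable_EFinP; apply: (measurableT_comp (measurable_gauss e s)).
by apply: measurable_mx_scale => //; exact: measurable_mx_add.
Qed.

Lemma integral_gauss_shift (F : V -> \bar R) (z : V) :
  measurable_fun setT F -> (forall y, 0 <= F y)%E ->
  (\int[lebesgue_mx]_y (F y * (g (r^-1 *: (y - z)))%:E) =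
   (r ^+ d)%:E * \int[lebesgue_mx]_w (F (r *: w + z)%R * (g w)%:E))%E.
Proof.
move=> mF F0.
pose G (y : V) := (F y * (g (r^-1 *: (y - z)))%:E)%E.
have mG : measurable_fun setT G by exact: emeasurable_funM.
have G0 y : (0 <= G y)%E by rewrite mule_ge0// lee_fin gauss_ge0.
have rn0 : r != 0 by rewrite gt_eqF.
transitivity ((r ^+ d)%:E * \int[lebesgue_mx]_w G (r *: w + z)%R)%E.
  exact: (integral_scale_shift z r0 mG G0).
rewrite (eq_integral (fun w : V => F (r *: w + z)%R * (g w)%:E)%E); first by [].
by move=> w _; rewrite /G addrK scalerA mulVf// scale1r.
Qed.

Lemma rowform_row (U : V) : rowform b U = b ord0 U U.
Proof. by rewrite /rowform big_ord1; congr (b ord0 _ _); apply/rowP => j; rewrite mxE. Qed.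

Lemma integral_1Dcos_gauss_shift (xi z : V) :
  (\int[lebesgue_mx]_y ((1 + cos (2 * pi * mxdot xi y))%:E * (g (r^-1 *: (y - z)))%:E) =
   (r ^+ d * Cg * (1 + cos (2 * pi * mxdot xi z) * row_charfun xi))%:E)%E.
Proof.
rewrite (integral_gauss_shift (F := fun y => (1 + cos (2 * pi * mxdot xi y))%:E)).
- rewrite (_ : (\int[_]_w _)%E = (\int[lebesgue_mx]_w ((1 + cos (2 * pi * mxdot xi z +
      mxdot ((2 * pi * r) *: xi) w)) * g w)%:E)%E); last first.
    apply: eq_integral => w _; rewrite -EFinM; congr ((_ * _)%:E); congr (1 + cos _).
    by rewrite mxdotDr mxdotZr mxdotZl; ring.
  by rewrite cov -EFinM rowform_row /row_charfun mulrA.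
- apply/measurable_EFinP; apply: measurable_funD => //.
  apply: (measurableT_comp (continuous_measurable_fun (@continuous_cos R))).
  by apply: measurable_funM => //; exact: measurable_mxdot.
- by move=> y; rewrite lee_fin cos1D_ge0.
Qed.

#[local] Opaque gauss.

(** A Gaussian centred at [z] is not even, and the embedding formula tests even functions; hence the
    sum with its mirror image. *)
Let psi z (y : V) := g (r^-1 *: (y - z)) + g (r^-1 *: (y - (- z))).

Let psiN z y : psi z (- y) = psi z y.
Proof. by rewrite /psi addrC -[g (_ *: (- y - z))]gaussN -[g (_ *: (- y - - z))]gaussN -!scalerN !opprD !opprK. Qed.

Let schwartz_psi z : schwartz_real (psi z).
Proof.
have rn0 : r != 0 by rewrite gt_eqF.
by apply: schwartz_realD; exact: schwartz_real_gauss.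
Qed.

Let measurable_psi z : measurable_fun setT (psi z).
Proof. by apply: measurable_funD; apply/measurable_EFinP; exact: meN. Qed.

Let psi_ge0 z y : 0 <= psi z y.
Proof. by rewrite addr_ge0// gauss_ge0. Qed.

(** The difference of the integrals of [psi] against [1 + cos] and against 1, both of nonnegative
    functions and both finite. *)
Lemma fourier_psi z (xi : V) :
  \int[lebesgue_mx]_y (psi z y * cos (2 * pi * mxdot xi y)) =
  2 * r ^+ d * Cg * (cos (2 * pi * mxdot xi z) * row_charfun xi).
Proof.
have mc : measurable_fun setT (fun y : V => 1 + cos (2 * pi * mxdot xi y)).
  apply: measurable_funD => //.
  apply: (measurableT_comp (continuous_measurable_fun (@continuous_cos R))).
  by apply: measurable_funM => //; exact: measurable_mxdot.
have E1 x : (\int[lebesgue_mx]_y (psi z y * (1 + cos (2 * pi * mxdot x y)))%:E =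
   (2 * r ^+ d * Cg * (1 + cos (2 * pi * mxdot x z) * row_charfun x))%:E)%E.
  have mcx : measurable_fun setT (fun y : V => (1 + cos (2 * pi * mxdot x y))%:E).
    apply/measurable_EFinP; apply: measurable_funD => //.
    apply: (measurableT_comp (continuous_measurable_fun (@continuous_cos R))).
    by apply: measurable_funM => //; exact: measurable_mxdot.
  transitivity (\int[lebesgue_mx]_y ((1 + cos (2 * pi * mxdot x y))%:E * (g (r^-1 *: (y - z)))%:E +
      (1 + cos (2 * pi * mxdot x y))%:E * (g (r^-1 *: (y - - z)))%:E))%E.
    apply: eq_integral => y _; rewrite -!EFinM -EFinD; congr EFin.
    by rewrite /psi mulrC mulrDr.
  rewrite ge0_integralD.
  - apply: etrans (congr2 (fun u v : \bar R => (u + v)%E) (integral_1Dcos_gauss_shift x z)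
      (integral_1Dcos_gauss_shift x (- z))) _.
    rewrite -EFinD mxdotNr mulrN cosN; congr EFin.
    by move: (1 + _) => u; ring.
  - by [].
  - by move=> y _; rewrite -EFinM lee_fin mulr_ge0 ?gauss_ge0 ?cos1D_ge0.
  - exact: emeasurable_funM.
  - by move=> y _; rewrite -EFinM lee_fin mulr_ge0 ?gauss_ge0 ?cos1D_ge0.
  - exact: emeasurable_funM.
have kap0 : row_charfun 0 = 1.
  have [_ bZ _] := bil; rewrite /row_charfun scaler0.
  by rewrite -{1}(scale0r (0 : V)) bZ mul0r oppr0 expR0.
have int1 : lebesgue_mx.-integrable setT (EFin \o (fun y => psi z y * (1 + cos (2 * pi * mxdot xi y)))).
  apply/integrableP; split; first by apply/measurable_EFinP; exact: measurable_funM.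
  under eq_integral do rewrite gee0_abs ?lee_fin ?mulr_ge0 ?cos1D_ge0//.
  by rewrite E1 ltry.
have E0 : (\int[lebesgue_mx]_y (psi z y)%:E = (2 * r ^+ d * Cg)%:E)%E.
  have := E1 0; under eq_integral do rewrite mxdot0l mulr0 cos0.
  rewrite mxdot0l mulr0 cos0 kap0 mulr1 => H.
  rewrite (_ : (\int[_]_y _)%E = (2^-1%:E * \int[lebesgue_mx]_y (psi z y * (1 + 1))%:E)%E).
    by rewrite H -EFinM; congr EFin; field.
  rewrite -ge0_integralZl.
  - by apply: eq_integral => y _; rewrite -EFinM; congr EFin; field.
  - by [].
  - by apply/measurable_EFinP; exact: measurable_funM.
  - by move=> y _; rewrite lee_fin mulr_ge0// addr_ge0.
  - by rewrite lee_fin invr_ge0.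
have int0 : lebesgue_mx.-integrable setT (EFin \o psi z).
  apply/integrableP; split; first exact/measurable_EFinP.
  under eq_integral do rewrite gee0_abs ?lee_fin//.
  by rewrite E0 ltry.
transitivity (\int[lebesgue_mx]_y (psi z y * (1 + cos (2 * pi * mxdot xi y)) - psi z y)).
  by apply: eq_Rintegral => y _; rewrite (mulrDr (psi z y)) mulr1 addrAC subrr add0r.
rewrite RintegralB// /Rintegral E1 E0/=.
by move: (cos _) (row_charfun _) => u v; ring.
Qed.

Lemma measurable_form (bb : V -> V -> R) : bilinear_form bb -> measurable_fun setT (fun x => bb x x).
Proof.
move=> [bD bZ bC].
have b0 y : bb 0 y = 0 by rewrite -(scale0r (0 : V)) bZ mul0r.
have bS (x y : V) : bb x y = \sum_j x ord0 j * bb (delta_mx ord0 j) y.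
  rewrite {1}(row_sum_delta x); elim/big_rec2 : _ => [|j u v _ <-]; first exact: b0.
  by rewrite bD bZ.
rewrite (_ : (fun x => _) = (fun x : V => \sum_j x ord0 j * \sum_k x ord0 k *
     bb (delta_mx ord0 k) (delta_mx ord0 j))); last first.
  by apply/funext => x; rewrite bS; apply: eq_bigr => j _; rewrite bC bS.
apply: measurable_sum => j; apply: measurable_funM; first exact: measurable_mx_entry.
apply: measurable_sum => k; apply: measurable_funM => //; exact: measurable_mx_entry.
Qed.

Lemma measurable_row_charfun : measurable_fun setT row_charfun.
Proof.
apply: measurable_expRN.
apply: (measurableT_comp (measurable_form bil)).
by apply: measurable_mx_scale.
Qed.

Lemma row_charfun_ge0 xi : 0 <= row_charfun xi. Proof. exact: expR_ge0. Qed.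

Lemma row_charfun_le xi : row_charfun xi <= expR (- (cg * (2 * pi * r) ^+ 2 * mxdot xi xi)).
Proof.
rewrite ler_expR lerN2; apply: le_trans (bcg _).
by rewrite mxdotZl mxdotZr expr2 !mulrA.
Qed.

Let cpos : 0 < cg * (2 * pi * r) ^+ 2.
Proof. by rewrite mulr_gt0// exprn_gt0// mulr_gt0// mulr_gt0// pi_gt0. Qed.

Let lpos : 0 < l. Proof. by have /andP[] := l0d. Qed.

Let mu0 : measurable_fun setT (fun y : V => neg_power l (N y)).
Proof. apply: (measurableT_comp (measurable_neg_power l)); exact: measurable_minkowski. Qed.

Lemma polar_row_charfun_lty : (polar l sigma (EFin \o row_charfun) < +oo)%E.
Proof.
apply: (@polar_lty _ _ _ sigma row_charfun 1 (cg * (2 * pi * r) ^+ 2)) => //.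
- exact: measurable_row_charfun.
- exact: row_charfun_ge0.
- by move=> x; rewrite mul1r row_charfun_le.
Qed.

Lemma integral_neg_power_psi z :
  (\int[lebesgue_mx]_y (neg_power l (N y) * (psi z y)%:E) < +oo)%E.
Proof.
have rn0 : r != 0 by rewrite gt_eqF.
pose c := e ^+ 2 / r ^+ 2 / 2; pose C0 := e ^+ 2 / r ^+ 2 * mxdot z z.
have c0 : 0 < c by rewrite !divr_gt0// lt_def sqr_ge0 sqrf_eq0 ?e0 ?rn0.
have le y : psi z y <= 2 * expR C0 * expR (- (c * mxdot y y)).
  rewrite -mulrA mulr_natl mulr2n lerD// -expRD ler_expR lerNl opprD opprK addrC.
    exact: quad_shift_ge.
  by apply: le_trans (quad_shift_ge _ _ _ _ rn0); rewrite mxdotNl mxdotNr opprK.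
have mE : measurable_fun setT (fun y : V => expR (- (c * mxdot y y))).
  by apply: measurable_expRN; apply: measurable_funM => //; exact: measurable_mxdot.
apply: (@le_lt_trans _ _ (\int[lebesgue_mx]_y ((2 * expR C0)%:E *
   (neg_power l (N y) * (expR (- (c * mxdot y y)))%:E)))%E).
  apply: ge0_le_integral => //.
  - by move=> y _; rewrite mule_ge0 ?neg_power_ge0// lee_fin.
  - by apply: emeasurable_funM => //; exact/measurable_EFinP.
  - by apply: emeasurable_funM => //; apply: emeasurable_funM => //; exact/measurable_EFinP.
  - move=> y _; rewrite muleCA lee_wpmul2l ?neg_power_ge0//.
    by rewrite -EFinM lee_fin.
rewrite ge0_integralZl.
- by rewrite lte_mul_pinfty ?lee_fin ?mulr_ge0 ?expR_ge0//; exact: integral_minkowski_gauss_lty.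
- by [].
- by apply: emeasurable_funM => //; exact/measurable_EFinP.
- by move=> y _; rewrite mule_ge0 ?neg_power_ge0// lee_fin expR_ge0.
- by rewrite lee_fin mulr_ge0 ?expR_ge0.
Qed.

(** The two powers differ only at the origin, where one is infinite and the other 0; the origin is
    null because d > 0. *)
Lemma integral_neg_power_psiE z :
  (\int[lebesgue_mx]_y (neg_power l (N y) * (psi z y)%:E) =
   \int[lebesgue_mx]_y (N y `^ (- l) * psi z y)%:E)%E.
Proof.
have d0 : (0 < d)%N.
  by have /andP[h1 h2] := l0d; rewrite -(ltr_nat R) (lt_trans h1 h2).
have m0 : measurable [set (0 : V)] by exact: measurable_set1_mx.
have null : lebesgue_mx [set (0 : V)] = 0%E by exact: lebesgue_mx_set1.
rewrite (ge0_negligible_integral m0)//; last 2 first.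
- by apply: emeasurable_funM => //; exact/measurable_EFinP.
- by move=> y _; rewrite mule_ge0 ?neg_power_ge0// lee_fin.
rewrite [RHS](ge0_negligible_integral m0)//; last 2 first.
- apply/measurable_EFinP; apply: measurable_funM => //.
  by apply: (measurableT_comp (measurable_powR (- l))); exact: measurable_minkowski.
- by move=> y _; rewrite lee_fin mulr_ge0 ?powR_ge0.
apply: eq_integral => y; rewrite inE/= => -[_ y0].
by rewrite /neg_power minkowski_eq0// ifF//; apply/eqP.
Qed.

(** The gauge and [g] are even, so the centres [z] and [-z] contribute equally. *)
Lemma integral_neg_power_psi_shift z :
  (\int[lebesgue_mx]_y (neg_power l (N y) * (psi z y)%:E) =
   (2 * r ^+ d)%:E * \int[lebesgue_mx]_w (neg_power l (N (r *: w + z)%R) * (g w)%:E))%E.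
Proof.
have Fge y : (0 <= neg_power l (N y))%E by exact: neg_power_ge0.
have E : (\int[lebesgue_mx]_y (neg_power l (N y) * (g (r^-1 *: (y - - z)))%:E) =
     \int[lebesgue_mx]_y (neg_power l (N y) * (g (r^-1 *: (y - z)))%:E))%E.
  pose G y := (neg_power l (N y) * (g (r^-1 *: (y - z)))%:E)%E.
  have mG : measurable_fun setT G by exact: emeasurable_funM.
  have G0 y : (0 <= G y)%E by apply: mule_ge0; [exact: Fge|rewrite lee_fin; exact: gauss_ge0].
  rewrite -[RHS](ge0_integral_lebesgue_mx_opp mG G0).
  apply: eq_integral => y _; rewrite /G (minkowskiN _ symL).
  have -> : g (r^-1 *: (y - - z)) = g (r^-1 *: (- y - z)); last by [].
  by rewrite -gaussN -scalerN opprD !opprK.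
transitivity (\int[lebesgue_mx]_y (neg_power l (N y) * (g (r^-1 *: (y - z)))%:E +
    neg_power l (N y) * (g (r^-1 *: (y - - z)))%:E))%E.
  by apply: eq_integral => y _; rewrite /psi EFinD ge0_muleDr ?lee_fin ?gauss_ge0.
rewrite ge0_integralD.
- have S : (\int[lebesgue_mx]_y (neg_power l (N y) * (g (r^-1 *: (y - z)))%:E) =
      (r ^+ d)%:E * \int[lebesgue_mx]_w (neg_power l (N (r *: w + z)%R) * (g w)%:E))%E.
    exact: (integral_gauss_shift z mu0 Fge).
  rewrite [X in (_ + X)%E]E S.
  move: (\int[lebesgue_mx]_w (neg_power l (N (r *: w + z)%R) * (g w)%:E))%E => I; have rd0 : 0 <= r ^+ d by rewrite exprn_ge0 ?ltW.
  rewrite -ge0_muleDl; [|by rewrite lee_fin|by rewrite lee_fin].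
  by rewrite -EFinD; congr (_%:E * _)%E; ring.
- by [].
- by move=> y _; apply: mule_ge0; [exact: Fge|rewrite lee_fin; exact: gauss_ge0].
- by apply: emeasurable_funM; [exact: mu0|exact: meN].
- by move=> y _; apply: mule_ge0; [exact: Fge|rewrite lee_fin; exact: gauss_ge0].
- by apply: emeasurable_funM; [exact: mu0|exact: meN].
Qed.

(** The embedding formula tested on [psi z], divided by 2 r^d. The cosine of the transform is
    written (1 + cos) - 1 and the subtracted term is moved to the left, so that all terms are
    nonnegative. *)
Lemma embed_gauss z :
  (\int[lebesgue_mx]_w (neg_power l (N (r *: w + z)%R) * (g w)%:E) +
     Cg%:E * polar l sigma (EFin \o row_charfun) =
   Cg%:E * polar l sigma (fun xi => ((1 + cos (2 * pi * mxdot xi z)) * row_charfun xi)%:E))%E.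
Proof.
pose k1 xi := (1 + cos (2 * pi * mxdot xi z)) * row_charfun xi.
pose A : \bar R := (\int[lebesgue_mx]_w (neg_power l (N (r *: w + z)%R) * (g w)%:E))%E.
have mk1 : measurable_fun setT k1.
  apply: measurable_funM; last exact: measurable_row_charfun.
  apply: measurable_funD => //.
  apply: (measurableT_comp (continuous_measurable_fun (@continuous_cos R))).
  by apply: measurable_funM => //; exact: measurable_mxdot.
have k1_ge0 xi : 0 <= k1 xi by rewrite mulr_ge0 ?cos1D_ge0 ?row_charfun_ge0.
have k1_le xi : k1 xi <= 2 * expR (- (cg * (2 * pi * r) ^+ 2 * mxdot xi xi)).
  rewrite ler_pM ?cos1D_ge0 ?row_charfun_ge0 ?row_charfun_le//.
  by have := cos_le1 (2 * pi * mxdot xi z); lra.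
have kap_le1 xi : row_charfun xi <= 1 * expR (- (cg * (2 * pi * r) ^+ 2 * mxdot xi xi)).
  by rewrite mul1r row_charfun_le.
have [i1 I1 E1] := polar_Rintegral sigma lpos cpos mk1 k1_ge0 k1_le.
have [i0 I0 E0] := polar_Rintegral sigma lpos cpos measurable_row_charfun row_charfun_ge0 kap_le1.
have fin1 : polar l sigma (EFin \o k1) \is a fin_num.
  rewrite ge0_fin_numE; last by apply: polar_ge0 => x; rewrite lee_fin.
  exact: polar_lty lpos cpos mk1 k1_ge0 k1_le.
have fin0 : polar l sigma (EFin \o row_charfun) \is a fin_num.
  by rewrite ge0_fin_numE ?polar_row_charfun_lty//; apply: polar_ge0 => x; rewrite lee_fin row_charfun_ge0.
have rd0 : 0 < 2 * r ^+ d by rewrite mulr_gt0// exprn_gt0.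
have finA : A \is a fin_num.
  rewrite ge0_fin_numE; last first.
    by apply: integral_ge0 => w _; rewrite mule_ge0 ?neg_power_ge0// lee_fin gauss_ge0.
  have := integral_neg_power_psi z; rewrite integral_neg_power_psi_shift -/A.
  move: A => A'; case: A' => [x _||//]; first exact: ltry.
  by rewrite gt0_muley ?lte_fin.
have : \int[lebesgue_mx]_x (N x `^ (- l) * psi z x) =
    2 * r ^+ d * Cg * (fine (polar l sigma (EFin \o k1)) - fine (polar l sigma (EFin \o row_charfun))).
  rewrite embed_real// -E1 -E0.
  have mD : measurable (`]0, +oo[%classic : set (measurableTypeR R)) by exact: measurable_itv.
  rewrite -RintegralB; [|exact: mD|exact: I1|exact: I0].
  rewrite -RintegralZl; [|exact: mD|]; last first.
    by apply: (@eq_integrable _ _ _ _ _ mD _ _ _ (integrableB mD I1 I0)) => t _.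
  apply: eq_Rintegral => t; rewrite inE/= in_itv/= andbT => t0.
  have mS := @measurable_sphere R d.
  rewrite -RintegralB; [|exact: mS|exact: i1|exact: i0].
  rewrite -RintegralZl; [|exact: mS|].
    by apply: eq_Rintegral => th _; rewrite fourier_psi /k1; ring.
  by apply: (@eq_integrable _ _ _ _ _ mS _ _ _ (integrableB mS (i1 t t0) (i0 t t0))) => th _.
rewrite /Rintegral -integral_neg_power_psiE integral_neg_power_psi_shift -/A.
rewrite -/A -(fineK finA) -EFinM /= => H.
rewrite -/(EFin \o k1) -(fineK fin1) -(fineK fin0) -!EFinM -EFinD; congr EFin.
have rdn0 : 2 * r ^+ d != 0 by rewrite gt_eqF.
apply: (mulfI rdn0); rewrite mulrDr H; ring.
Qed.

End embedding.

Lemma polar_integral_swap (R : realType) d (l : R) dT (T : measurableType dT)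
    (m : {sigma_finite_measure set T -> \bar R})
    (sigma : {finite_measure set 'rV[R]_d -> \bar R}) (F : T * 'rV[R]_d -> \bar R) :
  measurable_fun setT F -> (forall z, 0 <= F z)%E ->
  (\int[m]_x polar l sigma (fun xi => F (x, xi)) =
   polar l sigma (fun xi => \int[m]_x F (x, xi)))%E.
Proof.
move=> mF F0.
pose G (z : (T * R) * 'rV[R]_d) : \bar R :=
  ((polar_weight l (z.1.2, z.2))%:E * F (z.1.1, (z.1.2 *: z.2)%R))%E.
have mG : measurable_fun setT G.
  apply: emeasurable_funM.
    apply/measurable_EFinP; apply: (measurableT_comp (measurable_polar_weight l)).
    by apply: measurable_fun_pair => //; apply: measurableT_comp.
  apply: (measurableT_comp mF); apply: measurable_fun_pair.
    exact: measurableT_comp.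
  by apply: measurable_mx_scale => //; apply: measurableT_comp.
have w0 z : (0 <= (polar_weight l z)%:E :> \bar R)%E by rewrite lee_fin polar_weight_ge0.
have G0 z : (0 <= G z)%E by apply: mule_ge0.
pose h (z : T * R) : \bar R := (\int[sigma]_th G (z, th))%E.
have mh : measurable_fun setT h.
  exact: (measurable_fun_fubini_tonelli_F (m2 := sigma) G).
have h0 z : (0 <= h z)%E by apply: integral_ge0.
transitivity (\int[m]_x \int[lebesgue_measure]_t h (x, t))%E; first by [].
rewrite (fubini_tonelli (m1 := m) (m2 := lebesgue_measure) h mh h0).
apply: eq_integral => t _.
pose Gt (z : T * 'rV[R]_d) : \bar R := G ((z.1, t), z.2).
have mGt : measurable_fun setT Gt.
  apply: (measurableT_comp mG); apply: measurable_fun_pair => //.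
  by apply: measurable_fun_pair.
have Gt0 z : (0 <= Gt z)%E by exact: G0.
transitivity (\int[m]_x \int[sigma]_th Gt (x, th))%E; first by [].
rewrite (fubini_tonelli (m1 := m) (m2 := sigma) Gt mGt Gt0).
apply: eq_integral => th _; rewrite -ge0_integralZl.
- by [].
- by [].
- exact: (measurableT_comp mF (measurable_pair2 _)).
- by move=> x _; exact: F0.
- exact: w0.
Qed.

(** * Combinations of several Gaussian rows *)

Section gauss_formula.
Context {R : realType} {n d : nat}.
Local Notation V := 'rV[R]_d.
Local Notation M := 'M[R]_(n, d).
Variables (l : R) (L : set V) (sigma : {finite_measure set V -> \bar R}).
Hypotheses (l0d : 0 < l < d%:R) (sL : star_body L) (symL : symmetric_set L).
Local Notation N := (Defs.minkowski L).
Hypothesis embed : forall psi : V -> R[i], schwartz psi -> (forall x, psi (- x) = psi x) ->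
  Cintegral lebesgue_mx setT (fun x => ((N x `^ (- l))%:C * psi x)%C) =
  Cintegral lebesgue_measure `]0, +oo[ (fun t =>
    Cintegral sigma sphere (fun theta =>
      ((t `^ (l - 1))%:C * fourier psi (t *: theta))%C)).

(** Characteristic function of [rowcomb c X] at frequency 2 pi xi, for independent Gaussian rows
    with forms [b]; the coefficients enter through their squares only. *)
Definition charfun (b : 'I_n -> V -> V -> R) (c : 'I_n -> R) (xi : V) : R :=
  expR (- \sum_i c i ^+ 2 * b i ((2 * pi) *: xi) ((2 * pi) *: xi)).

Lemma measurable_charfun b c : (forall i, bilinear_form (b i)) ->
  measurable_fun setT (charfun b c).
Proof.
move=> bil; apply: measurable_expRN; apply: measurable_sum => i.
apply: measurable_funM => //; apply: (measurableT_comp (measurable_form (bil i))).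
exact: measurable_mx_scale.
Qed.

Lemma integral_1Dcos_rowcomb f C b c xi : (forall i, bilinear_form (b i)) ->
  has_covariance f C b ->
  (\int[lebesgue_mx]_(X in [set: M]) ((1 + cos (2 * pi * mxdot xi (rowcomb c X))) * f X)%:E =
    (C * (1 + charfun b c xi))%:E)%E.
Proof.
move=> bil /(_ 0 (\matrix_(i, j) (c i * ((2 * pi) *: xi) ord0 j))).
rewrite cos0 mul1r => cov.
have -> : charfun b c xi =
    expR (- rowform b (\matrix_(i, j) (c i * ((2 * pi) *: xi) ord0 j))).
  rewrite /charfun /rowform; congr (expR (- _)); apply: eq_bigr => i _.
  have -> : row i (\matrix_(i, j) (c i * ((2 * pi) *: xi) ord0 j)) = c i *: ((2 * pi) *: xi).
    by apply/rowP => j; rewrite !mxE.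
  have [_ bZ bC] := bil i; move: ((2 * pi) *: xi) => y.
  by rewrite [RHS]bZ (bC y (c i *: y)) bZ mulrA expr2.
rewrite -cov; apply: eq_integral => X _; congr ((_ * _)%:E); congr (1 + cos _).
by rewrite add0r -mxdot_rowcomb mxdotZr mxdotC.
Qed.

(* Apply [embed_gauss] to the Gaussian density of row [i0], conditionally on the
   other rows. The term [polar l sigma K] on both sides comes from adding [1] to
   the cosines; it is finite and cancels, since [Cg * C' = cb * C]. *)
Lemma integral_neg_power_gauss (e : R) (s : seq ('I_n * V)) C b c (i0 : 'I_n) :
  e != 0 -> 0 < C -> (forall i, bilinear_form (b i)) ->
  has_covariance (gauss e s) C b -> 0 < c i0 ->
  (\int[lebesgue_mx]_X (neg_power l (N (rowcomb c X)) * (gauss e s X)%:E) =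
   C%:E * polar l sigma (EFin \o charfun b c))%E.
Proof.
move=> e0 C0 bil cov ci0.
have [Cg [bg [cg [Cg0 cg0 bilg bcg covg]]]] := gauss_covariance (own_row i0 s) e0.
have [C' [b' [c' [C'0 _ _ _ cov']]]] := gauss_covariance (other_rows i0 s) e0.
have [cb [bb [cc [cb0 _ _ _ covb]]]] := @gauss_covariance R 1 d e [::] e0.
pose K := row_charfun (c i0) bg.
pose gs X := gauss e (other_rows i0 s) X.
pose Z (X : M) : V := rowcomb c (setrow i0 0 X).
have K0 xi : 0 <= K xi by exact: row_charfun_ge0.
have mK : measurable_fun setT K := measurable_row_charfun (c i0) (bilg ord0).
have mE := measurable_charfun c bil.
have E0 xi : 0 <= charfun b c xi by exact: expR_ge0.
have gs0 X : 0 <= gs X by exact: gauss_ge0.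
have mgs : measurable_fun setT gs by exact: measurable_gauss.
have mZ : measurable_fun setT Z.
  by apply: (measurableT_comp (measurable_rowcomb c)); exact: measurable_setrow.
have massb : (\int[lebesgue_mx]_w (gauss e [::] (w : V))%:E = cb%:E)%E := has_covariance_mass covb.
have mass' : (\int[lebesgue_mx]_X (gs X)%:E = C'%:E)%E := has_covariance_mass cov'.
have mcos : measurable_fun setT (@cos R) by exact: (continuous_measurable_fun (@continuous_cos R)).
(* Two evaluations of one cosine integral: integrating row [i0] before the others, and using the
   covariance of the whole density. *)
have key xi : (\int[lebesgue_mx]_X (gs X * (Cg * (1 + cos (2 * pi * mxdot xi (Z X)) * K xi)))%:E =
    (cb * (C * (1 + charfun b c xi)))%:E)%E.
  pose F (y : V) := (1 + cos (2 * pi * mxdot xi y))%:E.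
  have mF : measurable_fun setT F.
    apply/measurable_EFinP; apply: measurable_funD => //; apply: (measurableT_comp mcos).
    by apply: measurable_funM => //; exact: measurable_mxdot.
  have F0 y : (0 <= F y)%E by rewrite lee_fin cos1D_ge0.
  have := integral_rowcomb_gauss i0 e s c mF F0.
  rewrite massb.
  have -> : (\int[lebesgue_mx]_X (F (rowcomb c X) * (gauss e s X)%:E) =
       (C * (1 + charfun b c xi))%:E)%E by exact: (integral_1Dcos_rowcomb c xi bil cov).
  rewrite -EFinM => ->; apply: eq_integral => X _.
  rewrite EFinM; congr (_ * _)%E.
  have := covg (2 * pi * mxdot xi (Z X)) ((2 * pi * c i0) *: xi).
  rewrite rowform_row => <-; apply: eq_integral => w _.
  rewrite -EFinM; congr ((_ * _)%:E); congr (1 + cos _).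
  by rewrite mxdotDr mxdotZr mxdotZl /Z; ring.
have K00 : K 0 = 1.
  have [_ bZ _] := bilg ord0; rewrite /K /row_charfun scaler0.
  by rewrite -{1}(scale0r (0 : V)) bZ mul0r oppr0 expR0.
(* At [xi = 0] both characteristic functions equal 1, and [key] compares total masses. *)
have mass : Cg * C' = cb * C.
  have := key 0; have -> : charfun b c 0 = 1.
    rewrite /charfun big1 ?oppr0 ?expR0// => i _; have [_ bZ _] := bil i.
    by rewrite scaler0 -{1}(scale0r (0 : V)) bZ mul0r mulr0.
  under eq_integral do rewrite mxdot0l mulr0 cos0 mul1r K00 EFinM.
  rewrite ge0_integralZr; last 4 first.
  - by [].
  - exact/measurable_EFinP.
  - by move=> X _; rewrite lee_fin.
  - by rewrite lee_fin mulr_ge0// ltW.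
  rewrite mass' -EFinM => -[] H.
  have two0 : (1 + 1 : R) != 0 by rewrite -(natrD _ 1 1) pnatr_eq0.
  apply: (mulIf two0); rewrite -[RHS]mulrA -H.
  by rewrite mulrCA mulrA.
have Efin (x y : R) (I : \bar R) : (I + x%:E = y%:E -> I = (y - x)%:E)%E.
  by move=> h; rewrite EFinB -h addeK.
have mcosZ xi : measurable_fun setT (fun X => cos (2 * pi * mxdot xi (Z X))).
  apply: (measurableT_comp mcos); apply: measurable_funM => //.
  exact: measurable_mxdot.
have key2 xi : (\int[lebesgue_mx]_X (gs X * (Cg * ((1 + cos (2 * pi * mxdot xi (Z X))) * K xi)))%:E =
    (cb * C * (K xi + charfun b c xi))%:E)%E.
  (* From (1 + cos) K + 1 = (1 + K cos) + K, where every term is nonnegative because K <= 1. *)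
  have E1 : (\int[lebesgue_mx]_X (gs X * (Cg * ((1 + cos (2 * pi * mxdot xi (Z X))) * K xi)))%:E +
      \int[lebesgue_mx]_X (gs X * Cg)%:E =
      \int[lebesgue_mx]_X (gs X * (Cg * (1 + cos (2 * pi * mxdot xi (Z X)) * K xi)))%:E +
      \int[lebesgue_mx]_X (gs X * (Cg * K xi))%:E)%E.
    rewrite -!ge0_integralD.
    - apply: eq_integral => X _; rewrite -!EFinD; congr EFin.
      by move: (gs X) (cos _) (K xi) => u v w; ring.
    - by [].
    - move=> X _; rewrite lee_fin mulr_ge0 ?mulr_ge0 ?(ltW Cg0)//.
      have K1 : K xi <= 1.
        rewrite -[leRHS]expR0 ler_expR oppr_le0; apply: le_trans (bcg _ _).
        by rewrite mulr_ge0 ?mxdot_ge0 ?ltW.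
      have := K0 xi; have := cos_geN1 (2 * pi * mxdot xi (Z X)).
      have := cos_le1 (2 * pi * mxdot xi (Z X)).
      by move: K1; move: (cos _) (K xi) => u v; nra.
    - apply/measurable_EFinP; apply: measurable_funM => //; apply: measurable_funM => //.
      by apply: measurable_funD => //; exact: measurable_funM.
    - by move=> X _; rewrite lee_fin !mulr_ge0 ?(ltW Cg0).
    - by apply/measurable_EFinP; exact: measurable_funM.
    - by [].
    - by move=> X _; rewrite lee_fin !mulr_ge0 ?(ltW Cg0) ?cos1D_ge0.
    - apply/measurable_EFinP; apply: measurable_funM => //; apply: measurable_funM => //.
      by apply: measurable_funM => //; exact: measurable_funD.
    - by move=> X _; rewrite lee_fin mulr_ge0 ?(ltW Cg0).
    - by apply/measurable_EFinP; exact: measurable_funM.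
  have gsZ k : 0 <= k -> (\int[lebesgue_mx]_X (gs X * k)%:E = (C' * k)%:E)%E.
    move=> k0; under eq_integral do rewrite EFinM.
    rewrite ge0_integralZr; last 4 first.
    - by [].
    - exact/measurable_EFinP.
    - by move=> X _; rewrite lee_fin.
    - by rewrite lee_fin.
    by rewrite mass' EFinM.
  move: E1; rewrite key !gsZ ?mulr_ge0 ?(ltW Cg0)// -EFinD => /Efin ->.
  by congr EFin; rewrite (mulrA C') (mulrC C') mass; move: (K xi) (charfun b c xi) => u v; ring.
have polK_lty : (polar l sigma (EFin \o K) < +oo)%E.
  exact: (polar_row_charfun_lty sigma l0d ci0 cg0 (bilg ord0) (bcg ord0)).
have polK0 : (0 <= polar l sigma (EFin \o K))%E by apply: polar_ge0 => x; rewrite lee_fin.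
pose n0 (y : V) := neg_power l (N y).
have mn0 : measurable_fun setT n0.
  by apply: (measurableT_comp (measurable_neg_power l)); exact: measurable_minkowski.
have n00 y : (0 <= n0 y)%E by exact: neg_power_ge0.
have H1 := integral_rowcomb_gauss i0 e s c mn0 n00.
rewrite massb in H1.
pose A (X : M) : \bar R := (\int[lebesgue_mx]_w (n0 (c i0 *: w + Z X)%R * (gauss e (own_row i0 s) w)%:E))%E.
have HA X : (A X + Cg%:E * polar l sigma (EFin \o K) =
   Cg%:E * polar l sigma (fun xi => ((1 + cos (2 * pi * mxdot xi (Z X))) * K xi)%:E))%E.
  exact: (embed_gauss l0d sL symL embed e0 ci0 cg0 (bilg ord0) (bcg ord0) covg (Z X)).
have mA : measurable_fun setT A.
  apply: (measurable_fun_fubini_tonelli_F (m2 := lebesgue_mx) (fun z : M * V =>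
    (n0 (c i0 *: z.2 + Z z.1)%R * (gauss e (own_row i0 s) z.2)%:E)%E)); last first.
    by move=> z; apply: mule_ge0 => //; rewrite lee_fin gauss_ge0.
  apply: emeasurable_funM.
    apply: (measurableT_comp mn0); apply: measurable_mx_add.
      exact: measurable_mx_scale.
    exact: (measurableT_comp mZ).
  apply/measurable_EFinP; exact: (measurableT_comp (measurable_gauss _ _)).
have A0 X : (0 <= A X)%E.
  by apply: integral_ge0 => w _; apply: mule_ge0 => //; rewrite lee_fin gauss_ge0.
pose polK := polar l sigma (EFin \o K).
(* [HA] is integrated over the other rows with weight [gs]; once the polar integral is outermost,
   [key2] evaluates the cosines. *)
have H2 : (cb%:E * \int[lebesgue_mx]_X (n0 (rowcomb c X) * (gauss e s X)%:E) +
   (C' * Cg)%:E * polK =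
   (cb * C)%:E * polK + (cb * C)%:E * polar l sigma (EFin \o charfun b c))%E.
  rewrite H1 EFinM -mass' -muleA -ge0_integralZr; last 4 first.
  - by [].
  - exact/measurable_EFinP.
  - by move=> X _; rewrite lee_fin.
  - by apply: mule_ge0 => //; rewrite lee_fin ltW.
  rewrite -ge0_integralD; last 5 first.
  - by [].
  - by move=> X _; apply: mule_ge0; [rewrite lee_fin|exact: A0].
  - by apply: emeasurable_funM; [exact/measurable_EFinP|exact: mA].
  - move=> X _; apply: mule_ge0; first by rewrite lee_fin.
    by apply: mule_ge0 => //; rewrite lee_fin ltW.
  - by apply: emeasurable_funM => //; exact/measurable_EFinP.
  pose F (z : M * V) := (gs z.1 * (Cg * ((1 + cos (2 * pi * mxdot z.2 (Z z.1))) * K z.2)))%:E.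
  have mF : measurable_fun setT F.
    apply/measurable_EFinP; apply: measurable_funM; first exact: (measurableT_comp mgs).
    apply: measurable_funM => //; apply: measurable_funM; last exact: (measurableT_comp mK).
    apply: measurable_funD => //; apply: (measurableT_comp mcos); apply: measurable_funM => //.
    by apply: measurable_mxdot => //; exact: (measurableT_comp mZ).
  have F0 z : (0 <= F z)%E by rewrite lee_fin !mulr_ge0 ?(ltW Cg0) ?cos1D_ge0.
  have mcK X : measurable_fun setT (fun xi => ((1 + cos (2 * pi * mxdot xi (Z X))) * K xi)%:E).
    apply/measurable_EFinP; apply: measurable_funM => //.
    apply: measurable_funD => //; apply: (measurableT_comp mcos); apply: measurable_funM => //.
    exact: measurable_mxdot.
  have cK0 X xi : (0 <= ((1 + cos (2 * pi * mxdot xi (Z X))) * K xi)%:E)%E.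
    by rewrite lee_fin mulr_ge0 ?cos1D_ge0.
  transitivity (\int[lebesgue_mx]_X polar l sigma (fun xi => F (X, xi)))%E.
    apply: eq_integral => X _; rewrite -/(gs X) -/(A X).
    rewrite -ge0_muleDr; [|exact: A0|by apply: mule_ge0 => //; rewrite lee_fin ltW].
    have k0 : 0 <= gs X * Cg by rewrite mulr_ge0 ?(ltW Cg0).
    rewrite HA muleA -EFinM -(@polarZ _ _ l sigma _ _ k0 (mcK X) (cK0 X)).
    congr (polar l sigma _); apply/funext => xi; rewrite -EFinM /F/=.
    by congr EFin; apply/esym; exact: mulrA.
  rewrite (polar_integral_swap l lebesgue_mx sigma mF F0).
  have -> : (fun xi => \int[lebesgue_mx]_X F (X, xi))%E =
     (fun xi => (cb * C)%:E * (K xi)%:E + (cb * C)%:E * (charfun b c xi)%:E)%E.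
    by apply/funext => xi; rewrite key2 -!EFinM -EFinD mulrDr.
  have m0 : 0 <= cb * C by rewrite mulr_ge0 ?ltW.
  rewrite polarD; last 4 first.
  - by apply: emeasurable_funM => //; exact/measurable_EFinP.
  - by move=> x; rewrite -EFinM lee_fin mulr_ge0.
  - by apply: emeasurable_funM => //; exact/measurable_EFinP.
  - by move=> x; rewrite -EFinM lee_fin mulr_ge0.
  rewrite (@polarZ _ _ l sigma _ (EFin \o K) m0); last 2 first.
  - exact/measurable_EFinP.
  - by move=> x; rewrite lee_fin.
  rewrite (@polarZ _ _ l sigma _ (EFin \o charfun b c) m0); last 2 first.
  - exact/measurable_EFinP.
  - by move=> x; rewrite lee_fin.
  by [].
have mpK : ((cb * C)%:E * polK)%E \is a fin_num.
  apply: fin_numM; first by [].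
  by rewrite /polK (ge0_fin_numE polK0); exact: polK_lty.
move: H2; rewrite (mulrC C') mass addeC => H2.
have cbn0 : cb != 0 by rewrite gt_eqF.
have := congr1 (fun x => x - (cb * C)%:E * polK)%E H2.
rewrite addeAC subee// add0e addeAC subee// add0e => H3.
have := congr1 (fun x => (cb^-1)%:E * x)%E H3.
by rewrite !muleA -!EFinM mulVf// mul1e mulrA mulVf// mul1r.
Qed.

End gauss_formula.

(** * Log-convexity as a linear condition on the density *)

Section dominated_weights.
Context {R : realType} dT (T : measurableType dT).
Variable m : {sigma_finite_measure set T -> \bar R}.
Variables (nz nx ny : T -> \bar R) (p q : R).
Hypotheses (mnz : measurable_fun setT nz) (mnx : measurable_fun setT nx)
  (mny : measurable_fun setT ny).
Hypotheses (nz0 : forall X, (0 <= nz X)%E) (nx0 : forall X, (0 <= nx X)%E)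
  (ny0 : forall X, (0 <= ny X)%E).
Hypotheses (p0 : 0 <= p) (q0 : 0 <= q).

Definition weighted (w : T -> \bar R) (f : T -> R) : \bar R :=
  (\int[m]_X (w X * (f X)%:E))%E.

(* For [p = t e^((t-1)s)] and [q = (1-t) e^(ts)] with [s] arbitrary this is
   equivalent to [weighted nz f <= weighted nx f `^ t * weighted ny f `^ (1-t)];
   unlike the latter it is linear in [f]. *)
Definition dom (f : T -> R) : Prop :=
  (weighted nz f <= p%:E * weighted nx f + q%:E * weighted ny f)%E.

Section weight.
Variable w : T -> \bar R.
Hypotheses (mw : measurable_fun setT w) (w0 : forall X, (0 <= w X)%E).

Lemma weighted_ge0 (f : T -> R) : (forall X, 0 <= f X) -> (0 <= weighted w f)%E.
Proof. by move=> f0; apply: integral_ge0 => X _; rewrite mule_ge0// lee_fin. Qed.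

Lemma measurable_weighted (f : T -> R) : measurable_fun setT f ->
  measurable_fun setT (fun X => w X * (f X)%:E)%E.
Proof. by move=> mf; apply: emeasurable_funM => //; exact/measurable_EFinP. Qed.

Lemma weightedZ (k : R) (f : T -> R) : 0 <= k -> measurable_fun setT f -> (forall X, 0 <= f X) ->
  weighted w (fun X => k * f X) = (k%:E * weighted w f)%E.
Proof.
move=> k0 mf f0; rewrite /weighted -ge0_integralZl.
- by apply: eq_integral => X _; rewrite EFinM muleCA.
- by [].
- exact: measurable_weighted.
- by move=> X _; rewrite mule_ge0// lee_fin.
- by rewrite lee_fin.
Qed.

Lemma weightedD (f g : T -> R) : measurable_fun setT f -> (forall X, 0 <= f X) ->
  measurable_fun setT g -> (forall X, 0 <= g X) ->
  weighted w (fun X => f X + g X) = (weighted w f + weighted w g)%E.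
Proof.
move=> mf f0 mg g0; rewrite /weighted -ge0_integralD.
- by apply: eq_integral => X _; rewrite EFinD ge0_muleDr ?lee_fin.
- by [].
- by move=> X _; rewrite mule_ge0// lee_fin.
- exact: measurable_weighted.
- by move=> X _; rewrite mule_ge0// lee_fin.
- exact: measurable_weighted.
Qed.

Lemma le_weighted (f g : T -> R) : measurable_fun setT f -> (forall X, 0 <= f X) ->
  measurable_fun setT g -> (forall X, f X <= g X) ->
  (weighted w f <= weighted w g)%E.
Proof.
move=> mf f0 mg fg; apply: ge0_le_integral => //.
- by move=> X _; rewrite mule_ge0// lee_fin.
- exact: measurable_weighted.
- exact: measurable_weighted.
- by move=> X _; rewrite lee_wpmul2l// lee_fin.
Qed.

Lemma weighted_mix dU (U : measurableType dU) (nu : {sigma_finite_measure set U -> \bar R})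
    (f : U * T -> R) (g : T -> R) :
  measurable_fun setT f -> (forall z, 0 <= f z) ->
  (forall X, (g X)%:E = \int[nu]_u (f (u, X))%:E)%E ->
  weighted w g = (\int[nu]_u weighted w (fun X => f (u, X)))%E.
Proof.
move=> mf f0 gE.
pose F (z : U * T) := (w z.2 * (f z)%:E)%E.
have mF : measurable_fun setT F.
  apply: emeasurable_funM; first exact: (measurableT_comp mw).
  exact/measurable_EFinP.
have F0 z : (0 <= F z)%E by rewrite mule_ge0// lee_fin.
rewrite /weighted -[RHS]/(\int[nu]_u \int[m]_X F (u, X))%E.
rewrite (fubini_tonelli (m1 := nu) (m2 := m) F mF F0).
apply: eq_integral => X _; rewrite gE -ge0_integralZl.
- by [].
- by [].
- by apply/measurable_EFinP; exact: (measurableT_comp mf (measurable_pair2 X)).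
- by move=> u _; rewrite lee_fin.
- exact: w0.
Qed.

Lemma measurable_weighted_mix dU (U : measurableType dU) (f : U * T -> R) :
  measurable_fun setT f -> (forall z, 0 <= f z) ->
  measurable_fun setT (fun u => weighted w (fun X => f (u, X))).
Proof.
move=> mf f0.
apply: (measurable_fun_fubini_tonelli_F (m2 := m) (fun z : U * T => w z.2 * (f z)%:E)%E).
  apply: emeasurable_funM; first exact: (measurableT_comp mw).
  exact/measurable_EFinP.
by move=> z; rewrite mule_ge0// lee_fin.
Qed.

(** Monotone convergence. Where [w] is infinite the product is infinite or 0 according to whether
    the density is positive or 0: a positive limit is reached through eventually positive values,
    and by monotonicity a zero limit forces all values to be 0. *)
Lemma cvg_weighted_nd (f : nat -> T -> R) (g : T -> R) :
  (forall j, measurable_fun setT (f j)) -> (forall j X, 0 <= f j X) ->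
  measurable_fun setT g ->
  (forall X, nondecreasing_seq (f ^~ X)) -> (forall X, f ^~ X @ \oo --> g X) ->
  weighted w (f j) @[j --> \oo] --> weighted w g.
Proof.
move=> mf f0 mg fnd fg.
have -> : weighted w g = (\int[m]_X limn (fun j => w X * (f j X)%:E))%E.
  apply: eq_integral => X _; apply/esym/cvg_lim => //.
  have fgE : (f j X)%:E @[j --> \oo] --> (g X)%:E by apply: cvg_EFin; [exact: nearW|exact: fg].
  have gX0 : 0 <= g X.
    rewrite -(cvg_lim (@Rhausdorff R) (fg X)); apply: limr_ge; last exact: nearW.
    by apply/cvg_ex; exists (g X); exact: fg.
  move: (w0 X); case wX: (w X) => [r| |]// r0.
    by apply: cvgeZl => //.
  have [gXp|gXn] := ltP 0 (g X).
    rewrite gt0_mulye ?lte_fin//.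
    apply: cvg_near_cst; near=> j; rewrite gt0_mulye// lte_fin.
    by near: j; exact: (cvgr_gt (g X)).
  have gX : g X = 0 by apply/eqP; rewrite eq_le gXn gX0.
  have fX j : f j X = 0.
    apply/eqP; rewrite eq_le f0 andbT -gX.
    by rewrite -(cvg_lim (@Rhausdorff R) (fg X)); apply: nondecreasing_cvgn_le; [exact: fnd|apply/cvg_ex; exists (g X)].
  by rewrite gX; under eq_fun do rewrite fX; exact: cvg_cst.
apply: cvg_monotone_convergence => //.
- by move=> j; exact: measurable_weighted.
- by move=> j X _; rewrite mule_ge0// lee_fin.
- by move=> X _ i j ij; rewrite lee_wpmul2l// lee_fin; exact: fnd.
Unshelve. all: end_near. Qed.

(** As [h] is positive and its weighted integral finite, [w] is finite almost everywhere; so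
    multiplication by [w] preserves the pointwise limit. *)
Lemma cvg_weighted_dominated (f : nat -> T -> R) (g h : T -> R) :
  (forall j, measurable_fun setT (f j)) -> (forall j X, 0 <= f j X) ->
  measurable_fun setT h -> (forall X, 0 < h X) -> (forall j X, f j X <= h X) ->
  (forall X, f ^~ X @ \oo --> g X) -> (weighted w h < +oo)%E ->
  weighted w (f j) @[j --> \oo] --> weighted w g.
Proof.
move=> mf f0 mh h0 fh fg hlty.
have mg : measurable_fun setT g.
  by apply: (measurable_fun_cvg mf) => X _; exact: fg.
have ih : m.-integrable setT (fun X => w X * (h X)%:E)%E.
  apply/integrableP; split; first exact: measurable_weighted.
  by under eq_integral => X _ do rewrite gee0_abs ?(mule_ge0 (w0 X)) ?lee_fin ?(ltW (h0 X))//.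
have cfg : {ae m, forall X, setT X -> (w X * (f j X)%:E)%E @[j --> \oo] --> (w X * (g X)%:E)%E}.
  apply: filterS (integrable_ae measurableT ih) => X /(_ I) wfin _.
  have fgE : (f j X)%:E @[j --> \oo] --> (g X)%:E by apply: cvg_EFin; [exact: nearW|exact: fg].
  move: (w0 X) wfin; case wX: (w X) => [r| |]// r0.
    by move=> _; exact: cvgeZl.
  by rewrite gt0_mulye ?lte_fin.
have dm : {ae m, forall X j, setT X -> (`|w X * (f j X)%:E| <= w X * (h X)%:E)%E}.
  apply: aeW => X j _; rewrite gee0_abs; last by rewrite mule_ge0// lee_fin.
  by rewrite lee_wpmul2l// lee_fin.
have [_ _] := @dominated_convergence _ _ _ m setT measurableT
  (fun j X => w X * (f j X)%:E)%E (fun X => w X * (g X)%:E)%E (fun X => w X * (h X)%:E)%E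
  (fun j => measurable_weighted (mf j)) (measurable_weighted mg) cfg ih dm.
by [].
Qed.

End weight.

Lemma domZ (k : R) (f : T -> R) : 0 <= k -> measurable_fun setT f -> (forall X, 0 <= f X) ->
  dom f -> dom (fun X => k * f X).
Proof.
move=> k0 mf f0 df; rewrite /dom !weightedZ//.
rewrite [X in (_ <= X + _)%E]muleCA [X in (_ <= _ + X)%E]muleCA.
rewrite -ge0_muleDr; [|by rewrite mule_ge0 ?lee_fin ?weighted_ge0..].
by rewrite lee_wpmul2l// lee_fin.
Qed.

Lemma domD (f g : T -> R) : measurable_fun setT f -> (forall X, 0 <= f X) ->
  measurable_fun setT g -> (forall X, 0 <= g X) ->
  dom f -> dom g -> dom (fun X => f X + g X).
Proof.
move=> mf f0 mg g0 df dg; rewrite /dom !weightedD//.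
rewrite (@ge0_muleDr _ p%:E); [|exact: weighted_ge0..].
rewrite (@ge0_muleDr _ q%:E); [|exact: weighted_ge0..].
by rewrite [leRHS]addeACA; apply: leeD; [exact: df|exact: dg].
Qed.

Lemma dom_mix dU (U : measurableType dU) (nu : {sigma_finite_measure set U -> \bar R})
    (f : U * T -> R) (g : T -> R) :
  measurable_fun setT f -> (forall z, 0 <= f z) ->
  (forall X, (g X)%:E = \int[nu]_u (f (u, X))%:E)%E ->
  (forall u, dom (fun X => f (u, X))) -> dom g.
Proof.
move=> mf f0 gE df.
rewrite /dom (weighted_mix mnz nz0 mf f0 gE) (weighted_mix mnx nx0 mf f0 gE)
  (weighted_mix mny ny0 mf f0 gE).
have mx := measurable_weighted_mix mnx nx0 mf f0.
have my := measurable_weighted_mix mny ny0 mf f0.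
have x0 u : (0 <= weighted nx (fun X => f (u, X)))%E by exact: weighted_ge0.
have y0 u : (0 <= weighted ny (fun X => f (u, X)))%E by exact: weighted_ge0.
rewrite -!ge0_integralZl// -ge0_integralD//; last 4 first.
- by move=> u _; rewrite mule_ge0.
- exact: emeasurable_funM.
- by move=> u _; rewrite mule_ge0.
- exact: emeasurable_funM.
apply: ge0_le_integral => //.
- by move=> u _; exact: weighted_ge0.
- exact: (measurable_weighted_mix mnz nz0 mf f0).
- by apply: emeasurable_funD; exact: emeasurable_funM.
- by move=> u _; exact: df.
Qed.

(** Only the left side is passed to the limit; on the right each term is bounded by its value at
    [g]. So no finiteness is required. *)
Lemma dom_nd (f : nat -> T -> R) (g : T -> R) :
  (forall j, measurable_fun setT (f j)) -> (forall j X, 0 <= f j X) ->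
  (forall X, nondecreasing_seq (f ^~ X)) -> (forall X, f ^~ X @ \oo --> g X) ->
  (forall j, dom (f j)) -> dom g.
Proof.
move=> mf f0 fnd fg df.
have mg : measurable_fun setT g.
  by apply: (measurable_fun_cvg mf) => X _; exact: fg.
have fleg j X : f j X <= g X.
  rewrite -(cvg_lim (@Rhausdorff R) (fg X)); apply: nondecreasing_cvgn_le; first exact: fnd.
  by apply/cvg_ex; exists (g X).
have cz := cvg_weighted_nd mnz nz0 mf f0 mg fnd fg.
rewrite /dom -(cvg_lim _ cz)//; apply: lime_le.
  by apply/cvg_ex; eexists; exact: cz.
apply: nearW => j; apply: le_trans (df j) _.
apply: leeD; apply: lee_wpmul2l; rewrite ?lee_fin//; exact: le_weighted.
Qed.

(** Without monotonicity all three integrals must converge, and finiteness makes the sum on the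
    right continuous. *)
Lemma dom_dominated (f : nat -> T -> R) (g h : T -> R) :
  (forall j, measurable_fun setT (f j)) -> (forall j X, 0 <= f j X) ->
  measurable_fun setT h -> (forall X, 0 < h X) -> (forall j X, f j X <= h X) ->
  (forall X, f ^~ X @ \oo --> g X) ->
  (weighted nz h < +oo)%E -> (weighted nx h < +oo)%E -> (weighted ny h < +oo)%E ->
  (forall j, dom (f j)) -> dom g.
Proof.
move=> mf f0 mh h0 fh fg hz hx hy df.
have cz := cvg_weighted_dominated mnz nz0 mf f0 mh h0 fh fg hz.
have cx := cvg_weighted_dominated mnx nx0 mf f0 mh h0 fh fg hx.
have cy := cvg_weighted_dominated mny ny0 mf f0 mh h0 fh fg hy.
have g0 X : 0 <= g X.
  rewrite -(cvg_lim (@Rhausdorff R) (fg X)); apply: limr_ge; last exact: nearW.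
  by apply/cvg_ex; exists (g X); exact: fg.
have gh X : g X <= h X.
  rewrite -(cvg_lim (@Rhausdorff R) (fg X)); apply: limr_le; last exact: nearW.
  by apply/cvg_ex; exists (g X); exact: fg.
have mg : measurable_fun setT g.
  by apply: (measurable_fun_cvg mf) => X _; exact: fg.
have fin w : measurable_fun setT w -> (forall X, 0 <= w X)%E -> (weighted w h < +oo)%E ->
    weighted w g \is a fin_num.
  move=> mw w0 hw; rewrite ge0_fin_numE; last exact: weighted_ge0.
  by apply: le_lt_trans hw; exact: le_weighted.
have cxy : (p%:E * weighted nx (f j) + q%:E * weighted ny (f j))%E @[j --> \oo] -->
    (p%:E * weighted nx g + q%:E * weighted ny g)%E.
  apply: cvgeD; [|exact: cvgeZl..].
  by rewrite fin_num_adde_defr// fin_numM// fin.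
apply: (lee_cvg_to cz cxy); exact: nearW.
Qed.

End dominated_weights.

(** * Densities and multipliers compatible with the inequality *)

Section multipliers.
Context {R : realType} dT (T : measurableType dT).
Variable m : {sigma_finite_measure set T -> \bar R}.
Variables (nz nx ny : T -> \bar R) (p q : R).
Hypotheses (mnz : measurable_fun setT nz) (mnx : measurable_fun setT nx)
  (mny : measurable_fun setT ny).
Hypotheses (nz0 : forall X, (0 <= nz X)%E) (nx0 : forall X, (0 <= nx X)%E)
  (ny0 : forall X, (0 <= ny X)%E).
Hypotheses (p0 : 0 <= p) (q0 : 0 <= q).
Variable G : set (T -> R).
Hypotheses (mG : forall g, G g -> measurable_fun setT g) (G0 : forall g X, G g -> 0 < g X).
Hypotheses (Gz : forall g, G g -> (weighted m nz g < +oo)%E)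
  (Gx : forall g, G g -> (weighted m nx g < +oo)%E)
  (Gy : forall g, G g -> (weighted m ny g < +oo)%E).

Let domG := dom m nz nx ny p q.

(** The members of [G] have finite weighted integrals, and the bound on [k] supplies the uniform
    bounds under which limits are taken. *)
Definition dom_density (k : T -> R) : Prop :=
  [/\ measurable_fun setT k, (forall X, 0 <= k X), (exists B, forall X, k X <= B) &
      forall g, G g -> domG (fun X => k X * g X)].

(** [dom] is linear in the density but says nothing of products. Multipliers are closed under
    products by construction, which serves for the powers in the exponential series and for the
    product over the rows. *)
Definition dom_multiplier (f : T -> R) : Prop :=
  forall k, dom_density k -> dom_density (fun X => k X * f X).

Hypothesis dom1 : dom_density (fun=> 1).

Lemma multiplier_density f : dom_multiplier f -> dom_density f.
Proof. by move=> /(_ _ dom1); congr dom_density; apply/funext => X; rewrite mul1r. Qed.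

Lemma dom_densityZ c k : 0 <= c -> dom_density k -> dom_density (fun X => c * k X).
Proof.
move=> c0 [mk k0 [B kB] dk]; split.
- exact: measurable_funM.
- by move=> X; exact: mulr_ge0.
- by exists (c * B) => X; exact: ler_wpM2l.
- move=> g Gg; have gp X : 0 <= g X by apply: ltW; exact: G0.
  rewrite [X in domG X](_ : _ = fun X => c * (k X * g X)); last by apply/funext => X; rewrite mulrA.
  apply: (domZ mnz mnx mny) => //; last exact: dk.
    by apply: measurable_funM => //; exact: mG.
  by move=> X; exact: mulr_ge0.
Qed.

Lemma dom_densityD k k' : dom_density k -> dom_density k' -> dom_density (fun X => k X + k' X).
Proof.
move=> [mk k0 [B kB] dk] [mk' k'0 [B' kB'] dk']; split.
- exact: measurable_funD.
- by move=> X; exact: addr_ge0.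
- by exists (B + B') => X; exact: lerD.
- move=> g Gg; have gp X : 0 <= g X by apply: ltW; exact: G0.
  rewrite [X in domG X](_ : _ = fun X => k X * g X + k' X * g X); last first.
    by apply/funext => X; rewrite mulrDl.
  have mg := mG Gg.
  apply: (domD mnz mnx mny) => //; last 2 first.
  + exact: dk.
  + exact: dk'.
  + exact: measurable_funM.
  + by move=> X; exact: mulr_ge0.
  + exact: measurable_funM.
  + by move=> X; exact: mulr_ge0.
Qed.

Lemma dom_density_mix dU (U : measurableType dU) (nu : {sigma_finite_measure set U -> \bar R})
    (f : U * T -> R) (k : T -> R) B :
  measurable_fun setT f -> (forall z, 0 <= f z) ->
  (forall X, (k X)%:E = \int[nu]_u (f (u, X))%:E)%E -> (forall X, k X <= B) ->
  (forall u, dom_density (fun X => f (u, X))) -> dom_density k.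
Proof.
move=> mf f0 kE kB df; split.
- apply/measurable_EFinP; rewrite (_ : _ \o _ = fun X => \int[nu]_u (f (u, X))%:E)%E; last first.
    by apply/funext => X /=; exact: kE.
  apply: (measurable_fun_fubini_tonelli_G (m1 := nu) (fun z : U * T => (f z)%:E)).
    exact/measurable_EFinP.
  by move=> z; rewrite lee_fin.
- by move=> X; rewrite -lee_fin kE; apply: integral_ge0 => u _; rewrite lee_fin.
- by exists B.
- move=> g Gg; have mg := mG Gg; have gp X : 0 <= g X by apply: ltW; exact: G0.
  apply: (dom_mix mnz mnx mny nz0 nx0 ny0 p0 q0 (nu := nu) (f := fun z => f z * g z.2)).
  + by apply: measurable_funM => //; exact: (measurableT_comp mg).
  + by move=> z; exact: mulr_ge0.
  + move=> X; rewrite EFinM kE -ge0_integralZr.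
    * by apply: eq_integral => u _; rewrite -EFinM.
    * by [].
    * by apply/measurable_EFinP; exact: (measurableT_comp mf (measurable_pair2 X)).
    * by move=> u _; rewrite lee_fin.
    * by rewrite lee_fin.
  + by move=> u /=; have [_ _ _] := df u; exact.
Qed.

Lemma dom_density_nd (f : nat -> T -> R) (k : T -> R) B :
  (forall j, dom_density (f j)) -> (forall X, nondecreasing_seq (f ^~ X)) ->
  (forall X, f ^~ X @ \oo --> k X) -> (forall X, k X <= B) -> dom_density k.
Proof.
move=> df fnd fk kB.
have mf j : measurable_fun setT (f j) by case: (df j).
have f0 j X : 0 <= f j X by case: (df j).
split.
- by apply: (measurable_fun_cvg mf) => X _; exact: fk.
- move=> X; rewrite -(cvg_lim (@Rhausdorff R) (fk X)); apply: limr_ge; last exact: nearW.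
  by apply/cvg_ex; exists (k X); exact: fk.
- by exists B.
- move=> g Gg; have mg := mG Gg; have gp X : 0 <= g X by apply: ltW; exact: G0.
  apply: (dom_nd mnz mnx mny nz0 nx0 ny0 p0 q0 (f := fun j X => f j X * g X)).
  + by move=> j; exact: measurable_funM.
  + by move=> j X; exact: mulr_ge0.
  + by move=> X i j ij; rewrite ler_wpM2r//; exact: fnd.
  + by move=> X; apply: cvgMl; exact: fk.
  + by move=> j; have [_ _ _] := df j; exact.
Qed.

Lemma dom_density_dominated (f : nat -> T -> R) (k : T -> R) B :
  (forall j, dom_density (f j)) -> (forall j X, f j X <= B) ->
  (forall X, f ^~ X @ \oo --> k X) -> dom_density k.
Proof.
move=> df fB fk.
have mf j : measurable_fun setT (f j) by case: (df j).
have f0 j X : 0 <= f j X by case: (df j).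
split.
- by apply: (measurable_fun_cvg mf) => X _; exact: fk.
- move=> X; rewrite -(cvg_lim (@Rhausdorff R) (fk X)); apply: limr_ge; last exact: nearW.
  by apply/cvg_ex; exists (k X); exact: fk.
- exists B => X; rewrite -(cvg_lim (@Rhausdorff R) (fk X)); apply: limr_le; last exact: nearW.
  by apply/cvg_ex; exists (k X); exact: fk.
- move=> g Gg; have mg := mG Gg; have gp X : 0 <= g X by apply: ltW; exact: G0.
  have B0 : 0 < `|B| + 1 by apply: ltr_wpDl.
  have wB w : measurable_fun setT w -> (forall X, (0 <= w X)%E) -> (weighted m w g < +oo)%E ->
      (weighted m w (fun X => (`|B| + 1) * g X)%R < +oo)%E.
    move=> mw w0 wg; rewrite weightedZ//.
    by rewrite lte_mul_pinfty// lee_fin ltW.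
  apply: (dom_dominated (p := p) (q := q) mnz mnx mny nz0 nx0 ny0 (f := fun j X => f j X * g X)
    (h := fun X => (`|B| + 1) * g X)).
  + by move=> j; exact: measurable_funM.
  + by move=> j X; exact: mulr_ge0.
  + exact: measurable_funM.
  + by move=> X; rewrite mulr_gt0// G0.
  + move=> j X; rewrite ler_wpM2r//; apply: le_trans (fB j X) _.
    by rewrite (le_trans (ler_norm B))// lerDl.
  + by move=> X; apply: cvgMl; exact: fk.
  + by apply: wB => //; exact: Gz.
  + by apply: wB => //; exact: Gx.
  + by apply: wB => //; exact: Gy.
  + by move=> j; have [_ _ _] := df j; exact.
Qed.

Lemma dom_multiplierM f g : dom_multiplier f -> dom_multiplier g ->
  dom_multiplier (fun X => f X * g X).
Proof.
move=> df dg k dk.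
rewrite (_ : (fun X => _) = fun X => k X * f X * g X); last by apply/funext => X; rewrite mulrA.
exact/dg/df.
Qed.

Lemma dom_multiplierZ c f : 0 <= c -> dom_multiplier f -> dom_multiplier (fun X => c * f X).
Proof.
move=> c0 df k dk.
rewrite (_ : (fun X => _) = fun X => c * (k X * f X)); last by apply/funext => X; rewrite mulrCA.
exact/dom_densityZ/df.
Qed.

Lemma dom_multiplierD f g : dom_multiplier f -> dom_multiplier g ->
  dom_multiplier (fun X => f X + g X).
Proof.
move=> df dg k dk.
rewrite (_ : (fun X => _) = fun X => k X * f X + k X * g X); last first.
  by apply/funext => X; rewrite mulrDr.
by apply: dom_densityD; [exact: df|exact: dg].
Qed.

Lemma dom_multiplier1 : dom_multiplier (fun=> 1).
Proof. by move=> k; congr dom_density; apply/funext => X; rewrite mulr1. Qed.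

Lemma dom_multiplierX f j : dom_multiplier f -> dom_multiplier (fun X => f X ^+ j).
Proof.
move=> df; elim: j => [|j IH]; first exact: dom_multiplier1.
under eq_fun do rewrite exprS.
exact: dom_multiplierM.
Qed.

Lemma dom_multiplier_prod (I : Type) (r : seq I) (f : I -> T -> R) :
  (forall i, dom_multiplier (f i)) -> dom_multiplier (fun X => \prod_(i <- r) f i X).
Proof.
move=> df; elim: r => [|i r IH].
  by under eq_fun do rewrite big_nil; exact: dom_multiplier1.
by under eq_fun do rewrite big_cons; exact: dom_multiplierM.
Qed.

Lemma dom_multiplier_mix dU (U : measurableType dU) (nu : {sigma_finite_measure set U -> \bar R})
    (f : U * T -> R) (h : T -> R) B :
  measurable_fun setT f -> (forall z, 0 <= f z) ->
  (forall X, (h X)%:E = \int[nu]_u (f (u, X))%:E)%E -> (forall X, h X <= B) ->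
  (forall u, dom_multiplier (fun X => f (u, X))) -> dom_multiplier h.
Proof.
move=> mf f0 hE hB df k dk; have [mk k0 [C kC] _] := dk.
have h0 X : 0 <= h X.
  by rewrite -lee_fin hE; apply: integral_ge0 => u _; rewrite lee_fin.
apply: (dom_density_mix (nu := nu) (f := fun z => k z.2 * f z) (B := C * B)).
- by apply: measurable_funM => //; exact: (measurableT_comp mk).
- by move=> z; exact: mulr_ge0.
- move=> X; rewrite EFinM hE -ge0_integralZl.
  + by apply: eq_integral => u _; rewrite -EFinM.
  + by [].
  + by apply/measurable_EFinP; exact: (measurableT_comp mf (measurable_pair2 X)).
  + by move=> u _; rewrite lee_fin.
  + by rewrite lee_fin.
- by move=> X; exact: ler_pM.
- by move=> u; exact: df.
Qed.

(* The partial sums of the exponential series increase because [f] is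
   nonnegative. *)
Lemma dom_multiplier_expR f : dom_multiplier f -> dom_multiplier (fun X => expR (f X)).
Proof.
move=> df; have [_ f0 [B fB] _] := multiplier_density df.
have dS j : dom_multiplier (fun X => series (exp_coeff (f X)) j.+1).
  rewrite (_ : (fun X => _) = fun X => \sum_(i < j.+1) (i`!%:R)^-1 * f X ^+ i); last first.
    by apply/funext => X; rewrite /series/= big_mkord; apply: eq_bigr => i _; rewrite mulrC.
  elim: j => [|j IH].
    rewrite (_ : (fun X => _) = fun=> 1); first exact: dom_multiplier1.
    by apply/funext => X; rewrite big_ord1 expr0 fact0 invr1 mulr1.
  under eq_fun do rewrite big_ord_recr/=.
  by apply: dom_multiplierD => //; apply: dom_multiplierZ => //; exact: dom_multiplierX.
move=> k dk; have [mk k0 [C kC] _] := dk.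
apply: (dom_density_nd (f := fun j X => k X * series (exp_coeff (f X)) j.+1) (B := C * expR B)).
- by move=> j; exact: dS.
- move=> X; apply/nondecreasing_seqP => j; rewrite ler_wpM2l//.
  by rewrite [leRHS]seriesSr lerDl/= divr_ge0// exprn_ge0.
- move=> X; apply: cvgMr.
  have := @is_cvg_series_exp_coeff R (f X).
  by rewrite -(cvg_shiftS (series (exp_coeff (f X)))).
- by move=> X; apply: ler_pM => //; rewrite ?expR_ge0// ler_expR.
Qed.

(* The exponential of a mixture of multipliers, divided by the exponential of
   the mass of the mixture, is [expR (- \int w_j (1 - theta))]; the mass may
   become infinite in the limit [w_j --> w]. *)
Lemma dom_multiplier_laplace dU (U : measurableType dU)
    (nu : {sigma_finite_measure set U -> \bar R})
    (w : nat -> U -> R) (winf : U -> R) (theta : U * T -> R) (phi : T -> R) :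
  (forall j, measurable_fun setT (w j)) -> (forall j u, 0 <= w j u) ->
  (forall u, nondecreasing_seq (w ^~ u)) -> (forall u, w ^~ u @ \oo --> winf u) ->
  (forall j, \int[nu]_u (w j u)%:E < +oo)%E ->
  measurable_fun setT theta -> (forall z, 0 <= theta z <= 1) ->
  (forall u, dom_multiplier (fun X => theta (u, X))) ->
  (forall X, \int[nu]_u (winf u * (1 - theta (u, X)))%:E = (phi X)%:E)%E ->
  dom_multiplier (fun X => expR (- phi X)).
Proof.
move=> mw w0 wnd wcvg wfin mth th01 dth phiE.
have th0 z : 0 <= theta z by have /andP[] := th01 z.
have th1 z : theta z <= 1 by have /andP[] := th01 z.
have mthX X : measurable_fun setT (fun u => theta (u, X)).
  exact: (measurableT_comp mth (measurable_pair2 X)).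
have mw' j : measurable_fun setT (fun u => (w j u)%:E) by exact/measurable_EFinP.
pose a j := fine (\int[nu]_u (w j u)%:E)%E.
pose h j X := fine (\int[nu]_u (w j u * theta (u, X))%:E)%E.
pose de j X := fine (\int[nu]_u (w j u * (1 - theta (u, X)))%:E)%E.
have aE j : ((a j)%:E = \int[nu]_u (w j u)%:E)%E.
  by rewrite fineK// ge0_fin_numE// integral_ge0// => u _; rewrite lee_fin.
have le_w (f : U -> R) j : measurable_fun setT f -> (forall u, 0 <= f u <= 1) ->
    (\int[nu]_u (w j u * f u)%:E <= (a j)%:E)%E.
  move=> mf f01; rewrite aE; apply: ge0_le_integral => //.
  - by move=> u _; rewrite lee_fin mulr_ge0//; have /andP[] := f01 u.
  - by apply/measurable_EFinP; exact: measurable_funM.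
  - by move=> u _; rewrite lee_fin ler_piMr//; have /andP[] := f01 u.
have finE (f : U -> R) j : measurable_fun setT f -> (forall u, 0 <= f u <= 1) ->
    ((fine (\int[nu]_u (w j u * f u)%:E)%E)%:E = \int[nu]_u (w j u * f u)%:E)%E.
  move=> mf f01; rewrite fineK// ge0_fin_numE; last first.
    by apply: integral_ge0 => u _; rewrite lee_fin mulr_ge0//; have /andP[] := f01 u.
  exact: le_lt_trans (le_w f j mf f01) (ltry _).
have mth' X : measurable_fun setT (fun u => 1 - theta (u, X)) by exact: measurable_funB.
have th01' X u : 0 <= 1 - theta (u, X) <= 1 by rewrite subr_ge0 th1 lerBlDr lerDl th0.
have hE j X : ((h j X)%:E = \int[nu]_u (w j u * theta (u, X))%:E)%E by exact: finE.
have deE j X : ((de j X)%:E = \int[nu]_u (w j u * (1 - theta (u, X)))%:E)%E by exact: finE.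
have ahd j X : a j = h j X + de j X.
  apply: EFin_inj; rewrite EFinD hE deE aE -ge0_integralD.
  - by apply: eq_integral => u _; rewrite -EFinD -mulrDr addrC subrK mulr1.
  - by [].
  - by move=> u _; rewrite lee_fin mulr_ge0.
  - by apply/measurable_EFinP; exact: measurable_funM.
  - by move=> u _; rewrite lee_fin mulr_ge0//; have /andP[] := th01' X u.
  - by apply/measurable_EFinP; exact: measurable_funM.
have de0 j X : 0 <= de j X.
  by apply: fine_ge0; apply: integral_ge0 => u _; rewrite lee_fin mulr_ge0//; have /andP[] := th01' X u.
have dh j : dom_multiplier (h j).
  apply: (dom_multiplier_mix (nu := nu) (f := fun z => w j z.1 * theta z) (B := a j)).
  - by apply: measurable_funM => //; exact: (measurableT_comp (mw j)).
  - by move=> z; exact: mulr_ge0.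
  - exact: hE.
  - by move=> X; rewrite (ahd j X) lerDl.
  - by move=> u /=; apply: dom_multiplierZ => //.
have dphi X : de ^~ X @ \oo --> phi X.
  suff : (de j X)%:E @[j --> \oo] --> (phi X)%:E by move=> /fine_cvgP[].
  rewrite -phiE; under eq_fun do rewrite deE.
  have -> : (\int[nu]_u (winf u * (1 - theta (u, X)))%:E =
      \int[nu]_u (limn (fun j => (w j u * (1 - theta (u, X)))%:E)))%E.
    apply: eq_integral => u _; apply/esym/cvg_lim => //.
    by apply: cvg_EFin; [exact: nearW|apply: cvgMl; exact: wcvg].
  apply: cvg_monotone_convergence => //.
  - by move=> j; apply/measurable_EFinP; exact: measurable_funM.
  - by move=> j u _; rewrite lee_fin mulr_ge0//; have /andP[] := th01' X u.
  - move=> u _ i j ij; rewrite lee_fin ler_wpM2r//; last exact: wnd.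
    by have /andP[] := th01' X u.
move=> k dk; have [mk k0 [C kC] _] := dk.
apply: (dom_density_dominated (f := fun j X => k X * (expR (- a j) * expR (h j X))) (B := C)).
- move=> j; apply: (dom_multiplierZ (expR_ge0 _)) => //.
  exact: dom_multiplier_expR.
- move=> j X; rewrite -expRD (ahd j X) opprD addrAC addNr add0r.
  rewrite -[leRHS]mulr1; apply: ler_pM => //.
  by rewrite -[leRHS]expR0 ler_expR oppr_le0.
- move=> X; apply: cvgMr; rewrite (_ : (fun j => _) = fun j => expR (- de j X)); last first.
    by apply/funext => j; rewrite -expRD (ahd j X) opprD addrAC addNr add0r.
  by apply: continuous_cvg; [exact: continuous_expR|apply: cvgN; exact: dphi].
Qed.

End multipliers.

(** * The gauge of a body in Lewis position *)

Section stable_kernel.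
Context {R : realType}.
Local Notation mu := (@lebesgue_measure R).
Variable a : R.
Hypothesis a01 : 0 < a < 1.

(** The kernel (1 - exp(-r)) r^(-1-a) dr of a stable law, in the variable r = e^v, where dilations
    become translations. *)
Definition stable_kernel (v : R) : R := (1 - expR (- expR v)) * expR (- (a * v)).

Lemma stable_kernel_ge0 v : 0 <= stable_kernel v.
Proof.
by rewrite mulr_ge0 ?expR_ge0// subr_ge0 -[leRHS]expR0 ler_expR oppr_le0 expR_ge0.
Qed.

Lemma measurable_stable_kernel : measurable_fun setT stable_kernel.
Proof.
apply: measurable_funM.
  apply: measurable_funB => //; apply: measurable_expRN; exact: measurable_expR.
by apply: measurable_expRN; exact: measurable_funM.
Qed.

(** The kernel is at most exp(-av) for v >= 0 and, as 1 - exp(-y) <= y, at most exp((1-a)v) for v <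
    0. Both bounds are multiples of exponential densities, the second one reflected. *)
Lemma integral_stable_kernel_lty : (\int[mu]_v (stable_kernel v)%:E < +oo)%E.
Proof.
have [a0 a1] := andP a01.
have b0 : 0 < 1 - a by rewrite subr_gt0.
pose f1 v : \bar R := (a^-1 * exponential_pdf a v)%:E.
pose f2 v : \bar R := ((1 - a)^-1 * exponential_pdf (1 - a) v)%:E.
have mf1 : measurable_fun setT f1.
  by apply/measurable_EFinP; apply: measurable_funM => //; exact: measurable_exponential_pdf.
have mf2 : measurable_fun setT f2.
  by apply/measurable_EFinP; apply: measurable_funM => //; exact: measurable_exponential_pdf.
have mf2N : measurable_fun setT (fun v : R => f2 (- v)).
  exact: (measurableT_comp mf2 (@oppr_measurable R setT)).
have f10 v : (0 <= f1 v)%E.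
  by rewrite lee_fin mulr_ge0 ?invr_ge0 ?exponential_pdf_ge0 ?ltW.
have f20 v : (0 <= f2 v)%E.
  by rewrite lee_fin mulr_ge0 ?invr_ge0 ?exponential_pdf_ge0 ?ltW.
have f_fin r : 0 < r -> (\int[mu]_v (r^-1 * exponential_pdf r v)%:E < +oo)%E.
  move=> r0; under eq_integral do rewrite EFinM.
  rewrite ge0_integralZl; last 4 first.
  - by [].
  - by apply/measurable_EFinP; exact: measurable_exponential_pdf.
  - by move=> v _; rewrite lee_fin exponential_pdf_ge0// ltW.
  - by rewrite lee_fin invr_ge0 ltW.
  by rewrite integral_exponential_pdf// mule1 ltry.
apply: (@le_lt_trans _ _ (\int[mu]_v (f1 v + f2 (- v)%R))%E); last first.
  rewrite ge0_integralD//.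
  by rewrite (ge0_integral_lebesgue_opp mf2 f20) lte_add_pinfty// f_fin.
apply: ge0_le_integral => //.
- by move=> v _; rewrite lee_fin stable_kernel_ge0.
- by apply/measurable_EFinP; exact: measurable_stable_kernel.
- exact: emeasurable_funD.
- move=> v _; have [v0|v0] := leP 0 v.
    apply: (@le_trans _ _ (f1 v)); last by rewrite leeDl.
    rewrite /f1 exponential_pdfE// mulrA mulVf ?gt_eqF// mul1r lee_fin mulNr.
    rewrite -[leRHS]mul1r ler_wpM2r ?expR_ge0// lerBlDr lerDl; exact: expR_ge0.
  apply: (@le_trans _ _ (f2 (- v))); last by rewrite leeDr.
  rewrite /f2 exponential_pdfE ?oppr_ge0 ?(ltW v0)// mulrA mulVf ?gt_eqF// mul1r lee_fin mulrNN.
  rewrite mulrBl mul1r expRD ler_wpM2r ?expR_ge0// lerBlDr addrC -lerBlDr.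
  exact: expR_ge1Dx.
Qed.

Lemma integral_stable_kernel_gt0 : (0 < \int[mu]_v (stable_kernel v)%:E)%E.
Proof.
have [a0 a1] := andP a01.
pose c := (1 - expR (- 1)) * expR (- a).
have c0 : 0 < c.
  by rewrite mulr_gt0 ?expR_gt0// subr_gt0 -[ltRHS]expR0 ltr_expR oppr_lt0.
have m1 : mu `[0, 1]%classic = 1%E by rewrite lebesgue_measure_itv/= lte_fin ltr01 oppr0 adde0.
apply: (@lt_le_trans _ _ (\int[mu]_(v in `[0%R, 1%R]) (stable_kernel v)%:E)%E); last first.
  apply: ge0_subset_integral => //.
  - by apply/measurable_EFinP; exact: measurable_stable_kernel.
  - by move=> v _; rewrite lee_fin stable_kernel_ge0.
apply: (@lt_le_trans _ _ (\int[mu]_(v in `[0%R, 1%R]) c%:E)%E).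
  by rewrite integral_cst//= m1 mule1 lte_fin.
apply: ge0_le_integral => //.
- by move=> v _; rewrite lee_fin ltW.
- by apply/measurable_EFinP; apply: measurable_funTS; exact: measurable_stable_kernel.
- move=> v /=; rewrite in_itv/= => /andP[v0 v1]; rewrite lee_fin /c /stable_kernel.
  apply: ler_pM; rewrite ?expR_ge0//.
  + by rewrite lerB// ler_expR lerN2 -[leLHS]expR0 ler_expR.
  + by rewrite ler_expR lerN2 -[leRHS]mulr1 ler_wpM2l// ltW.
Qed.

(* [|s|^(2a)] as a mixture of the functions [1 - exp (- r s^2)], with [r = e^v]. *)
Lemma stable_mixture : exists C : R, 0 < C /\ forall s : R,
  (\int[mu]_v ((1 - expR (- (expR v * s ^+ 2))) * expR (- (a * v)))%:E =
   (C * `|s| `^ (2 * a))%:E)%E.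
Proof.
have [a0 a1] := andP a01.
have E0 : (0 <= \int[mu]_v (stable_kernel v)%:E)%E by exact: ltW integral_stable_kernel_gt0.
have Efin : (\int[mu]_v (stable_kernel v)%:E)%E \is a fin_num.
  by rewrite ge0_fin_numE// integral_stable_kernel_lty.
exists (fine (\int[mu]_v (stable_kernel v)%:E)%E); split.
  by rewrite fine_gt0// integral_stable_kernel_lty integral_stable_kernel_gt0.
move=> s; have [->|s0] := eqVneq s 0.
  rewrite normr0 powR0 ?mulf_neq0 ?gt_eqF// mulr0.
  under eq_integral do rewrite expr0n/= mulr0 oppr0 expR0 subrr mul0r.
  by rewrite integral0.
have s20 : 0 < s ^+ 2 by rewrite exprn_even_gt0.
have m0 v : (0 <= (stable_kernel v)%:E)%E by rewrite lee_fin stable_kernel_ge0.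
have mk : measurable_fun setT (EFin \o stable_kernel).
  by apply/measurable_EFinP; exact: measurable_stable_kernel.
(* Translating v by ln(s^2) carries the factor s^2 inside the kernel, at the cost of exp(a ln(s^2))
   = |s|^(2a). *)
have := ge0_integral_lebesgue_affine (ln (s ^+ 2)) (oner_neq0 R) mk m0.
rewrite normr1 invr1 mul1e => H.
rewrite EFinM fineK// muleC -[in RHS]H -ge0_integralZl; last 4 first.
- by [].
- apply/measurable_EFinP; apply: (measurableT_comp measurable_stable_kernel).
  by apply: measurable_funD => //; exact: measurable_funM.
- by move=> v _; exact: m0.
- by rewrite lee_fin powR_ge0.
apply: eq_integral => v _; rewrite -EFinM; congr EFin.
rewrite /= /stable_kernel mul1r expRD lnK// [RHS]mulrCA; congr (_ * _).
rewrite /powR normr_eq0 (negbTE s0) -expRD; congr expR.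
have -> : s ^+ 2 = `|s| ^+ 2 by rewrite real_normK ?num_real.
by rewrite lnXn ?normr_gt0//; move: (ln _) => x; ring.
Qed.

End stable_kernel.

(** * The inequality for Gaussian densities *)

Lemma le_polar (R : realType) d (l : R) (sigma : {finite_measure set 'rV[R]_d -> \bar R})
    (H1 H2 : 'rV[R]_d -> \bar R) :
  measurable_fun setT H1 -> (forall x, 0 <= H1 x)%E ->
  measurable_fun setT H2 -> (forall x, H1 x <= H2 x)%E ->
  (polar l sigma H1 <= polar l sigma H2)%E.
Proof.
move=> mH1 H10 mH2 H12.
have H20 x : (0 <= H2 x)%E by exact: le_trans (H10 x) (H12 x).
have w0 z : (0 <= (polar_weight l z)%:E :> \bar R)%E by rewrite lee_fin polar_weight_ge0.
apply: ge0_le_integral => //.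
- by move=> t _; apply: integral_ge0 => th _; apply: mule_ge0.
- exact: measurable_polar_inner.
- exact: measurable_polar_inner.
- move=> t _; apply: ge0_le_integral => //.
  + by move=> th _; apply: mule_ge0.
  + exact: measurable_polar_section.
  + exact: measurable_polar_section.
  + by move=> th _; apply: lee_wpmul2l.
Qed.

(** The weights are absorbed as shifts of [A] by (t-1)r and of [B] by tr, which leave the mean tA +
    (1-t)B unchanged; the tangent of the exponential at this mean does the rest. *)
Lemma expR_convex_shift (R : realType) (t r A B : R) : 0 < t < 1 ->
  expR (t * A + (1 - t) * B) <=
  t * expR ((t - 1) * r) * expR A + (1 - t) * expR (t * r) * expR B.
Proof.
move=> /andP[t0 t1]; have t1' : 0 <= 1 - t by rewrite subr_ge0 ltW.
rewrite -!mulrA -!expRD.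
set A' := _ + A; set B' := _ + B; set m := t * A + _.
have le_m x : expR m * (1 + (x - m)) <= expR x.
  have -> : expR x = expR (x - m) * expR m by rewrite -expRD subrK.
  by rewrite mulrC ler_wpM2r ?expR_ge0// expR_ge1Dx.
apply: le_trans (lerD (ler_wpM2l (ltW t0) (le_m A')) (ler_wpM2l t1' (le_m B'))).
by rewrite le_eqVlt; apply/orP; left; apply/eqP; rewrite /A' /B' /m; move: (expR _) => x; ring.
Qed.

Section dom_gauss.
Context {R : realType} {n d : nat}.
Local Notation V := 'rV[R]_d.
Local Notation M := 'M[R]_(n, d).
Variables (l : R) (L : set V) (sigma : {finite_measure set V -> \bar R}).
Hypotheses (l0d : 0 < l < d%:R) (sL : star_body L) (symL : symmetric_set L).
Local Notation N := (Defs.minkowski L).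
Hypothesis embed : forall psi : V -> R[i], schwartz psi -> (forall x, psi (- x) = psi x) ->
  Cintegral lebesgue_mx setT (fun x => ((N x `^ (- l))%:C * psi x)%C) =
  Cintegral lebesgue_measure `]0, +oo[ (fun t =>
    Cintegral sigma sphere (fun theta =>
      ((t `^ (l - 1))%:C * fourier psi (t *: theta))%C)).

Definition norm_weight (c : 'I_n -> R) (X : M) : \bar R := neg_power l (N (rowcomb c X)).

Lemma measurable_norm_weight c : measurable_fun setT (norm_weight c).
Proof.
apply: (measurableT_comp (measurable_neg_power l)).
apply: (measurableT_comp (measurable_minkowski sL)); exact: measurable_rowcomb.
Qed.

Lemma norm_weight_ge0 c X : (0 <= norm_weight c X)%E.
Proof. exact: neg_power_ge0. Qed.

Lemma charfun_le (b : 'I_n -> V -> V -> R) (a : R) c i0 (xi : V) :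
  0 < a -> (forall i x, a * mxdot x x <= b i x x) ->
  charfun b c xi <= 1 * expR (- ((c i0 ^+ 2 * a * (2 * pi) ^+ 2) * mxdot xi xi)).
Proof.
move=> a0 ba; rewrite mul1r ler_expR lerN2 (bigD1 i0)//= -[leLHS]addr0 lerD//.
  set y := (2 * pi) *: xi.
  have yE : mxdot y y = (2 * pi) ^+ 2 * mxdot xi xi by rewrite mxdotZl mxdotZr mulrA -expr2.
  move: (ba i0 y) (sqr_ge0 (c i0)); rewrite yE.
  move: (c i0 ^+ 2) ((2 * pi) ^+ 2) => k w bai k0.
  by rewrite -(mulrA k a w) -(mulrA k) -(mulrA a w) ler_wpM2l.
apply: sumr_ge0 => i _; rewrite mulr_ge0 ?sqr_ge0//; apply: le_trans _ (ba _ _).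
by rewrite mulr_ge0 ?mxdot_ge0 ?ltW.
Qed.

Lemma weighted_gauss_lty c i0 e s : e != 0 -> 0 < c i0 ->
  (weighted lebesgue_mx (norm_weight c) (gauss e s) < +oo)%E.
Proof.
move=> e0 ci0; have [l0 _] := andP l0d.
have [C [b [a [C0 a0 bil ba cov]]]] := gauss_covariance s e0.
rewrite /weighted /norm_weight (integral_neg_power_gauss l0d sL symL embed e0 C0 bil cov ci0).
apply: lte_mul_pinfty; rewrite ?lee_fin ?(ltW C0)//.
have k0 : 0 < c i0 ^+ 2 * a * (2 * pi) ^+ 2.
  by rewrite !mulr_gt0 ?exprn_gt0 ?mulr_gt0 ?pi_gt0.
apply: (@polar_lty R d l sigma (charfun b c) 1 _ l0 k0).
- exact: measurable_charfun.
- by move=> x; exact: expR_ge0.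
- by move=> x; exact: charfun_le.
Qed.

(** All three integrals become polar integrals with the same constant [C], and the inequality is
    already true of the integrands by [expR_convex_shift]. The indices [iz], [ix], [iy] point to
    rows to which the embedding formula can be applied. *)
Lemma dom_gauss (t r : R) (cz cx cy : 'I_n -> R) e s iz ix iy : 0 < t < 1 ->
  (forall i, cz i ^+ 2 = t * cx i ^+ 2 + (1 - t) * cy i ^+ 2) ->
  0 < cz iz -> 0 < cx ix -> 0 < cy iy -> e != 0 ->
  dom lebesgue_mx (norm_weight cz) (norm_weight cx) (norm_weight cy)
    (t * expR ((t - 1) * r)) ((1 - t) * expR (t * r)) (gauss e s).
Proof.
move=> t01 cE zp xp yp e0.
have [t0 t1] := andP t01.
have [C [b [a [C0 a0 bil ba cov]]]] := gauss_covariance s e0.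
have F c i0 : 0 < c i0 -> weighted lebesgue_mx (norm_weight c) (gauss e s) =
    (C%:E * polar l sigma (EFin \o charfun b c))%E.
  exact: (integral_neg_power_gauss l0d sL symL embed e0 C0 bil cov).
rewrite /dom (F _ _ zp) (F _ _ xp) (F _ _ yp).
set p := t * _; set q := (1 - t) * _.
have p0 : 0 <= p by rewrite mulr_ge0 ?expR_ge0 ?ltW.
have q0 : 0 <= q by rewrite mulr_ge0 ?expR_ge0 ?subr_ge0 ?ltW.
have mE c : measurable_fun setT (EFin \o charfun b c).
  by apply/measurable_EFinP; exact: measurable_charfun.
have E0 c x : (0 <= (EFin \o charfun b c) x)%E by rewrite lee_fin expR_ge0.
have mEZ k c : measurable_fun setT (fun x => k%:E * (EFin \o charfun b c) x)%E.
  exact: emeasurable_funM.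
have EZ0 k c x : 0 <= k -> (0 <= k%:E * (EFin \o charfun b c) x)%E.
  by move=> k0; apply: mule_ge0.
have P0 c : (0 <= polar l sigma (EFin \o charfun b c))%E by exact: polar_ge0.
rewrite [X in (_ <= X + _)%E]muleCA [X in (_ <= _ + X)%E]muleCA -ge0_muleDr; last 2 first.
- by rewrite mule_ge0.
- by rewrite mule_ge0.
apply: lee_wpmul2l; first by rewrite lee_fin ltW.
rewrite -(@polarZ _ _ l sigma _ _ p0 (mE cx) (E0 cx)) -(@polarZ _ _ l sigma _ _ q0 (mE cy) (E0 cy)).
rewrite -(@polarD _ _ l sigma _ _ (mEZ p cx) (fun x => EZ0 p cx x p0) (mEZ q cy) (fun x => EZ0 q cy x q0)).
apply: le_polar => //.
- by apply: emeasurable_funD.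
- move=> x; rewrite -!EFinM -EFinD lee_fin /charfun.
  set y := (2 * pi) *: x.
  have -> : - (\sum_i cz i ^+ 2 * b i y y) =
     t * (- \sum_i cx i ^+ 2 * b i y y) + (1 - t) * (- \sum_i cy i ^+ 2 * b i y y).
    rewrite !mulrN -opprD; congr (- _); rewrite !mulr_sumr -big_split/=.
    by apply: eq_bigr => i _; rewrite cE mulrDl !mulrA.
  exact: expR_convex_shift.
Qed.

End dom_gauss.

(** * The isotropic measure of a body in Lewis position *)

Section lewis_measure.
Context {R : realType} {d : nat}.
Local Notation V := 'rV[R]_d.

Lemma mxdot_sphere (u : V) : sphere u -> mxdot u u = 1.
Proof. by rewrite /sphere/= dotvE. Qed.

Lemma sphere_coord_le1 (u : V) j : sphere u -> `|u ord0 j| <= 1.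
Proof.
move=> /mxdot_sphere u1; rewrite -(expr_le1 (n := 2))// real_normK ?num_real//.
by rewrite -u1; exact: sqr_entry_le_mxdot.
Qed.

Lemma outerE (u : V) i j : (u^T *m u) i j = u ord0 i * u ord0 j.
Proof. by rewrite !mxE big_ord1 mxE. Qed.

Lemma isotropicE (nu : {measure set V -> \bar R}) i j : isotropic nu ->
  (\int[nu]_(u in sphere) (u ord0 i * u ord0 j)%:E = (i == j)%:R%:E)%E.
Proof.
move=> /(_ i j); rewrite mxE => <-.
by apply: eq_integral => u _; rewrite outerE.
Qed.

(** The trace of the isotropy identity. In particular the measure of the sphere is finite, which the
    definition of Lewis position leaves implicit. *)
Lemma isotropic_sphere (nu : {measure set V -> \bar R}) :
  isotropic nu -> nu sphere = (d%:R)%:E.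
Proof.
move=> iso.
have mc i : measurable_fun (@sphere R d) (fun u : V => (u ord0 i * u ord0 i)%:E).
  apply/measurable_EFinP; apply: measurable_funTS.
  by apply: measurable_funM; exact: measurable_mx_entry.
rewrite -[LHS]mul1e -integral_cst; last exact: measurable_sphere.
transitivity (\int[nu]_(u in sphere) \sum_(i < d) (u ord0 i * u ord0 i)%:E)%E.
  apply: eq_integral => u /set_mem us; rewrite sumEFin; congr EFin.
  by rewrite /cst/=; have := us; rewrite /sphere/= /dotv.
rewrite ge0_integral_sum//; last 2 first.
- exact: measurable_sphere.
- by move=> i u _; rewrite lee_fin -expr2 sqr_ge0.
rewrite (eq_bigr (fun=> 1%E)); last first.
  by move=> i _; rewrite isotropicE// eqxx.
by rewrite sumEFin sumr_const card_ord.
Qed.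

Lemma lewis_finite_measure (p : R) (K : set V) : lewis_position p K ->
  exists nu : {finite_measure set V -> \bar R},
    forall x, (((Defs.minkowski K x) `^ p)%:E = \int[nu]_u (`|mxdot x u| `^ p)%:E)%E.
Proof.
move=> [nu [carr iso nuE]].
have nufin : (nu sphere < +oo)%E by rewrite isotropic_sphere// ltry.
exists (mfrestr measurable_sphere nufin) => x.
have mS := @measurable_sphere R d.
have mf : measurable_fun setT (fun u : V => (`|mxdot x u| `^ p)%:E).
  apply/measurable_EFinP; apply: (measurableT_comp (measurable_powR p)).
  by apply: measurableT_comp => //; exact: measurable_mxdot.
rewrite (@ge0_negligible_integral _ _ _ (mfrestr mS nufin) setT (~` sphere)) //; last 2 first.
- exact: measurableC.
- by rewrite -[LHS]/(nu (~` sphere `&` sphere)) setICl measure0.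
rewrite setTD setCK nuE.
transitivity (\int[nu]_(u in sphere) (`|mxdot x u| `^ p)%:E)%E.
  by apply: eq_integral => u _; rewrite dotvE.
apply: eq_measure_integral => A mA AS.
by rewrite -[RHS]/(nu (A `&` sphere)) setIidl.
Qed.

(** Expanding <x, u>^2 in coordinates and using isotropy: for exponent 2 the gauge is the Euclidean
    norm. *)
Lemma lewis_position2 (K : set V) : lewis_position 2 K ->
  forall x, Defs.minkowski K x `^ 2 = mxdot x x.
Proof.
move=> [nu [carr iso nuE]] x.
have nufin : (nu sphere < +oo)%E by rewrite isotropic_sphere// ltry.
have mS := @measurable_sphere R d.
apply: EFin_inj; rewrite nuE.
have ijint i j : nu.-integrable sphere (fun u : V => (u ord0 i * u ord0 j)%:E).
  apply: measurable_bounded_integrable => //.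
    by apply: measurable_funTS; apply: measurable_funM; exact: measurable_mx_entry.
  exists 1; split; first exact: num_real.
  move=> y y1 u us; apply: ltW; apply: le_lt_trans y1; rewrite normrM -[leRHS]mulr1.
  by apply: ler_pM => //; exact: sphere_coord_le1.
have ijintZ i j : nu.-integrable sphere
    (fun u : V => (x ord0 i * x ord0 j)%:E * (u ord0 i * u ord0 j)%:E)%E.
  exact: integrableZl.
transitivity (\int[nu]_(u in sphere) \sum_(i < d) \sum_(j < d)
    ((x ord0 i * x ord0 j)%:E * (u ord0 i * u ord0 j)%:E))%E.
  apply: eq_integral => u _; rewrite powR_mulrn// real_normK ?num_real// /dotv expr2.
  rewrite mulr_suml -sumEFin; apply: eq_bigr => i _.
  rewrite mulr_sumr -sumEFin; apply: eq_bigr => j _.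
  by rewrite -EFinM mulrACA.
rewrite integral_sum//; last first.
  by move=> i; apply: integrable_sum.
rewrite -dotvE /dotv -sumEFin; apply: eq_bigr => i _.
rewrite integral_sum// (bigD1 i)//= big1 ?adde0.
  by rewrite integralZl// isotropicE// eqxx mule1.
by move=> j ji; rewrite integralZl// isotropicE// eq_sym (negbTE ji) mule0.
Qed.

End lewis_measure.

Section lebesgue_product.
Context {R : realType} dT (T : measurableType dT).
Variable nu : {finite_measure set T -> \bar R}.

Definition lebesgue_prod := (@lebesgue_measure R \x nu)%E.

HB.instance Definition _ := Measure.on lebesgue_prod.
HB.instance Definition _ := @Measure_isSigmaFinite.Build _ _ _ lebesgue_prod
  (sigma_finite_product (@lebesgue_measure R) nu).

End lebesgue_product.

(** * Multipliers built from Gaussian factors *)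

Section gauss_multipliers.
Context {R : realType} {n d : nat}.
Local Notation V := 'rV[R]_d.
Local Notation M := 'M[R]_(n, d).
Variables (wz wx wy : M -> \bar R) (p q e : R).
Hypotheses (mz : measurable_fun setT wz) (mx : measurable_fun setT wx)
  (my : measurable_fun setT wy).
Hypotheses (z0 : forall X, (0 <= wz X)%E) (x0 : forall X, (0 <= wx X)%E)
  (y0 : forall X, (0 <= wy X)%E).
Hypotheses (p0 : 0 <= p) (q0 : 0 <= q).
Hypothesis dom_g : forall s, dom lebesgue_mx wz wx wy p q (gauss e s).
Hypotheses (zfin : forall s, (weighted lebesgue_mx wz (gauss e s) < +oo)%E)
  (xfin : forall s, (weighted lebesgue_mx wx (gauss e s) < +oo)%E)
  (yfin : forall s, (weighted lebesgue_mx wy (gauss e s) < +oo)%E).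

Let G : set (M -> R) := [set gauss e s | s in setT].

Local Notation density := (dom_density lebesgue_mx wz wx wy p q G).
Local Notation multiplier := (dom_multiplier lebesgue_mx wz wx wy p q G).

Lemma measurable_gauss_family g : G g -> measurable_fun setT g.
Proof. by move=> [s _ <-]; exact: measurable_gauss. Qed.

Lemma gauss_family_gt0 g X : G g -> 0 < g X.
Proof. by move=> [s _ <-]; exact: expR_gt0. Qed.

Lemma density1 : density (fun=> 1).
Proof.
split => //; first by exists 1.
move=> g [s _ <-]; have := dom_g s; congr dom.
by apply/funext => X; rewrite mul1r.
Qed.

(** By [gauss_cons] the factor only lengthens the list, so it maps the family [G], with [e] fixed
    and the list free, into itself. *)
Lemma multiplier_row i (u : V) : multiplier (fun X => expR (- mxdot (row i X) u ^+ 2)).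
Proof.
move=> k [mk k0 [B kB] dk]; split.
- apply: measurable_funM => //; apply: measurable_expRN; apply: measurable_funX.
  by apply: measurable_mxdot => //; exact: measurable_row.
- by move=> X; rewrite mulr_ge0// expR_ge0.
- exists B => X; apply: le_trans (kB X); rewrite ler_piMr// -[leRHS]expR0 ler_expR oppr_le0.
  exact: sqr_ge0.
- move=> g [s _ <-]; have := dk (gauss e ((i, u) :: s)).
  rewrite (_ : (fun X => k X * gauss e ((i, u) :: s) X) =
    fun X => k X * expR (- mxdot (row i X) u ^+ 2) * gauss e s X); last first.
    by apply/funext => X; rewrite gauss_cons mulrA mulrAC.
  by apply; exists ((i, u) :: s).
Qed.

Lemma multiplier_lewis2 i : multiplier (fun X => expR (- mxdot (row i X) (row i X))).
Proof.
rewrite (_ : (fun X => _) =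
  fun X : M => \prod_(j < d) expR (- mxdot (row i X) (delta_mx ord0 j) ^+ 2)).
  by apply: dom_multiplier_prod => j; exact: multiplier_row.
apply/funext => X; rewrite -expR_sum; congr expR; rewrite sumrN; congr (- _).
rewrite -dotvE /dotv; apply: eq_bigr => j _; rewrite -dotvE /dotv (bigD1 j)//= big1.
  by rewrite addr0 !mxE !eqxx mulr1 expr2.
by move=> k kj; rewrite [delta_mx _ _ _ _]mxE eqxx/= (negbTE kj) mulr0.
Qed.

(* The weights [w j%:R] truncate [expR (- (b * v)) / C]; by [stable_mixture] they
   have finite mass. *)
Lemma multiplier_lewis_lt2 (a : R) (K : set V) i : 0 < a < 2 ->
  lewis_position a K ->
  multiplier (fun X => expR (- (Defs.minkowski K (row i X)) `^ a)).
Proof.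
move=> /andP[a0 a2] /lewis_finite_measure[nu nuE].
pose b := a / 2.
have b01 : 0 < b < 1 by rewrite divr_gt0//= ltr_pdivrMr// mul1r.
have bE : 2 * b = a by rewrite mulrC divfK.
have [C [C0 CE]] := stable_mixture b01; rewrite bE in CE.
pose U := (measurableTypeR R * V)%type.
(* [w s] serves twice: at s = j it is the truncated weight, and at s = <x, u> it is the integrand of
   the mixture that represents |s|^a. *)
pose w (s : R) (z : U) : R := C^-1 * ((1 - expR (- (expR z.1 * s ^+ 2))) * expR (- (b * z.1))).
have iC : 0 <= C^-1 by rewrite invr_ge0 ltW.
have w_ge0 s z : 0 <= w s z.
  rewrite mulr_ge0// mulr_ge0 ?expR_ge0// subr_ge0 -[leRHS]expR0 ler_expR oppr_le0.
  by rewrite mulr_ge0 ?expR_ge0 ?sqr_ge0.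
have mw (s : R) : measurable_fun setT (w s).
  have mz1 : measurable_fun setT (fun z : U => expR z.1).
    exact: (measurableT_comp (@measurable_expR R)).
  apply: measurable_funM => //; apply: measurable_funM; last first.
    by apply: measurable_expRN; apply: measurable_funM.
  by apply: measurable_funB => //; apply: measurable_expRN; apply: measurable_funM.
have wE (u : V) (s : R) : (\int[lebesgue_measure]_v (w s (v, u))%:E = (`|s| `^ a)%:E)%E.
  rewrite /w/=; under eq_integral do rewrite EFinM.
  rewrite ge0_integralZl; last 4 first.
  - by [].
  - apply/measurable_EFinP; apply: measurable_funM; last first.
      by apply: measurable_expRN; apply: measurable_funM.
    apply: measurable_funB => //; apply: measurable_expRN; apply: measurable_funM => //.
  - move=> v _; rewrite lee_fin mulr_ge0 ?expR_ge0// subr_ge0 -[leRHS]expR0 ler_expR oppr_le0.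
    by rewrite mulr_ge0 ?expR_ge0 ?sqr_ge0.
  - by rewrite lee_fin.
  by rewrite CE -EFinM mulrA mulVf ?gt_eqF// mul1r.
pose theta (z : U * M) := expR (- (expR z.1.1 * mxdot (row i z.2) z.1.2 ^+ 2)).
have mth : measurable_fun setT theta.
  apply: measurable_expRN; apply: measurable_funM.
    apply: (measurableT_comp (@measurable_expR R)); exact: measurableT_comp.
  apply: measurable_funX; apply: measurable_mxdot.
    by apply: (measurableT_comp (measurable_row _)).
  exact: measurableT_comp.
apply: (@dom_multiplier_laplace _ _ _ _ _ _ _ _ _ mz mx my z0 x0 y0 p0 q0 G measurable_gauss_family
  (fun g X => @gauss_family_gt0 g X) _ _ _ density1 _ U (lebesgue_prod nu)
  (fun j => w j%:R) (fun z => C^-1 * expR (- (b * z.1))) theta).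
- by move=> g [s _ <-]; exact: zfin.
- by move=> g [s _ <-]; exact: xfin.
- by move=> g [s _ <-]; exact: yfin.
- by move=> j; exact: mw.
- by move=> j z; exact: w_ge0.
- move=> z j k jk; rewrite ler_wpM2l// ler_wpM2r ?expR_ge0// lerB// ler_expR lerN2.
  by rewrite ler_wpM2l ?expR_ge0// ler_sqr ?nnegrE// ler_nat.
(* As j <= j^2, the exponential is at most the j-th power of exp(-e^v), which is less than 1. *)
- move=> z; apply: cvgMr; rewrite -[X in _ --> X]mul1r; apply: cvgMl.
  rewrite -[X in _ --> X]subr0; apply: cvgB; first exact: cvg_cst.
  apply: (@squeeze_cvgr _ _ _ _ (fun=> 0) (fun j => expR (- expR z.1) ^+ j)); last 2 first.
  + exact: cvg_cst.
  + apply: cvg_expr; rewrite ger0_norm ?expR_ge0// -[ltRHS]expR0 ltr_expR oppr_lt0.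
    exact: expR_gt0.
  apply: nearW => j; rewrite expR_ge0/= -expRM_natl ler_expR mulrN lerN2 mulrC.
  rewrite ler_wpM2l ?expR_ge0// -natrX ler_nat; case: j => // j.
  exact: (@leq_pexp2l j.+1 1 2).
- move=> j; rewrite /lebesgue_prod.
  rewrite (@fubini_tonelli2 _ _ _ _ _ lebesgue_measure nu (fun z => (w j%:R z)%:E)); last 2 first.
  + by apply/measurable_EFinP; exact: mw.
  + by move=> z; rewrite lee_fin.
  rewrite /fubini_G; under eq_integral do rewrite wE.
  by rewrite integral_cst// lte_mul_pinfty ?lee_fin ?powR_ge0// -ge0_fin_numE// fin_num_measure.
- exact: mth.
- move=> z; rewrite expR_ge0/= -[leRHS]expR0 ler_expR oppr_le0.
  by rewrite mulr_ge0 ?expR_ge0 ?sqr_ge0.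
(* The coefficient e^v is absorbed by rescaling the direction [u] with its square root. *)
- move=> [v u]; have := multiplier_row i (expR (v / 2) *: u).
  congr dom_multiplier; apply/funext => X; congr (expR (- _)) => /=.
  rewrite mxdotZr exprMn; congr (_ * _).
  by rewrite -expRM_natl mulrC divfK.
- move=> X; rewrite nuE /lebesgue_prod.
  transitivity (\int[(lebesgue_measure \x nu)%E]_z (w (mxdot (row i X) z.2) z)%:E)%E.
    by apply: eq_integral => z _; congr EFin; rewrite /w /theta/= -mulrA (mulrC (expR (- (b * z.1)))).
  rewrite (@fubini_tonelli2 _ _ _ _ _ lebesgue_measure nu (fun z => (w (mxdot (row i X) z.2) z)%:E)); last 2 first.
  + apply/measurable_EFinP; apply: measurable_funM => //; apply: measurable_funM; last first.
      by apply: measurable_expRN; apply: measurable_funM.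
    apply: measurable_funB => //; apply: measurable_expRN; apply: measurable_funM => //.
      exact: (measurableT_comp (@measurable_expR R)).
    by apply: measurable_funX; apply: measurable_mxdot.
  + by move=> z; rewrite lee_fin.
  by apply: eq_integral => u _; exact: (wE u (mxdot (row i X) u)).
Qed.

Lemma dom_lewis (a : R) (K : set V) : 0 < a <= 2 -> lewis_position a K ->
  dom lebesgue_mx wz wx wy p q
    (fun X => expR (- \sum_i (Defs.minkowski K (row i X)) `^ a) * gauss e [::] X).
Proof.
move=> /andP[a0]; rewrite le_eqVlt => a2 lewis.
have mult i : multiplier (fun X => expR (- (Defs.minkowski K (row i X)) `^ a)).
  case/predU1P: a2 => [a2|a2]; last by apply: multiplier_lewis_lt2 => //; rewrite a0.
  rewrite a2 in lewis *.
  rewrite (_ : (fun X => _) = fun X : M => expR (- mxdot (row i X) (row i X))).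
    exact: multiplier_lewis2.
  by apply/funext => X; rewrite lewis_position2.
rewrite (_ : (fun X => _) =
    fun X : M => \prod_i expR (- (Defs.minkowski K (row i X)) `^ a) * gauss e [::] X).
  have [_ _ _] := multiplier_density density1 (dom_multiplier_prod (index_enum _) mult).
  by apply; exists [::].
by apply/funext => X; rewrite -sumrN expR_sum.
Qed.


End gauss_multipliers.

(** * From the exponential density to the ball *)

Section no_gauss.
Context {R : realType} {n d : nat}.
Local Notation V := 'rV[R]_d.
Local Notation M := 'M[R]_(n, d).
Variables (l : R) (L : set V) (sigma : {finite_measure set V -> \bar R}).
Hypotheses (l0d : 0 < l < d%:R) (sL : star_body L) (symL : symmetric_set L).
Local Notation N := (Defs.minkowski L).
Hypothesis embed : forall psi : V -> R[i], schwartz psi -> (forall x, psi (- x) = psi x) ->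
  Cintegral lebesgue_mx setT (fun x => ((N x `^ (- l))%:C * psi x)%C) =
  Cintegral lebesgue_measure `]0, +oo[ (fun t =>
    Cintegral sigma sphere (fun theta =>
      ((t `^ (l - 1))%:C * fourier psi (t *: theta))%C)).

Definition lewis_gauge (a : R) (K : set V) (X : M) : R :=
  \sum_(i < n) (Defs.minkowski K (row i X)) `^ a.

Lemma lewis_gauge_ge0 a K X : 0 <= lewis_gauge a K X.
Proof. by apply: sumr_ge0 => i _; exact: powR_ge0. Qed.

Lemma measurable_lewis_gauge a K : star_body K -> measurable_fun setT (lewis_gauge a K).
Proof.
move=> sK; apply: measurable_sum => i; apply: (measurableT_comp (measurable_powR a)).
by apply: (measurableT_comp (measurable_minkowski sK)); exact: measurable_row.
Qed.

Lemma lewis_gaugeZ a K c X : star_body K -> 0 <= c ->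
  lewis_gauge a K (c *: X) = c `^ a * lewis_gauge a K X.
Proof.
move=> sK c0; rewrite /lewis_gauge mulr_sumr; apply: eq_bigr => i _.
rewrite linearZ/= minkowskiZ// powRM//; exact: minkowski_ge0.
Qed.

(** The damping was required for finiteness in the dominated limits. As [e] decreases to 0 the
    damped densities increase, so [dom_nd] removes it without any integrability of the limit. *)
Lemma dom_expN_gauge (t r a : R) (K : set V) (cz cx cy : 'I_n -> R) iz ix iy : 0 < t < 1 ->
  (forall i, cz i ^+ 2 = t * cx i ^+ 2 + (1 - t) * cy i ^+ 2) ->
  0 < cz iz -> 0 < cx ix -> 0 < cy iy ->
  star_body K -> 0 < a <= 2 -> lewis_position a K ->
  dom lebesgue_mx (norm_weight l L cz) (norm_weight l L cx) (norm_weight l L cy)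
    (t * expR ((t - 1) * r)) ((1 - t) * expR (t * r))
    (fun X => expR (- lewis_gauge a K X)).
Proof.
move=> t01 cE zp xp yp sK a02 lewis; have [t0 t1] := andP t01.
have p0 : 0 <= t * expR ((t - 1) * r) by rewrite mulr_ge0 ?expR_ge0 ?ltW.
have q0 : 0 <= (1 - t) * expR (t * r) by rewrite mulr_ge0 ?expR_ge0 ?subr_ge0 ?ltW.
have mw c : measurable_fun setT (@norm_weight R n d l L c) by exact: measurable_norm_weight.
have w0 c X : (0 <= @norm_weight R n d l L c X)%E by exact: norm_weight_ge0.
pose e j : R := j.+1%:R^-1.
have e0 j : e j != 0 by rewrite invr_eq0 pnatr_eq0.
have gE j (X : M) : gauss (e j) [::] X = expR (- (e j ^+ 2 * mxdot X X)).
  by rewrite /gauss /quad big_nil addr0.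
apply: (dom_nd (mw cz) (mw cx) (mw cy) (w0 cz) (w0 cx) (w0 cy) p0 q0
  (f := fun j X => expR (- lewis_gauge a K X) * gauss (e j) [::] X)).
- move=> j; apply: measurable_funM; last exact: measurable_gauss.
  by apply: measurable_expRN; exact: measurable_lewis_gauge.
- by move=> j X; rewrite mulr_ge0 ?expR_ge0.
- move=> X i j ij; rewrite ler_wpM2l ?expR_ge0// !gE ler_expR lerN2 ler_wpM2r ?mxdot_ge0//.
  by rewrite lerXn2r ?nnegrE ?invr_ge0// lef_pV2 ?posrE// ler_nat.
- move=> X; rewrite -[X in _ --> X]mulr1; apply: cvgMr.
  under eq_fun do rewrite gE.
  rewrite -expR0; apply: continuous_cvg; first exact: continuous_expR.
  rewrite -oppr0; apply: cvgN; rewrite -(mul0r (mxdot X X)); apply: cvgMl.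
  under eq_fun do rewrite expr2.
  by rewrite -(mulr0 (0 : R)); apply: cvgM; exact: cvg_harmonic.
- move=> j; apply: (dom_lewis (mw cz) (mw cx) (mw cy) (w0 cz) (w0 cx) (w0 cy) p0 q0 _ _ _ _ a02 lewis).
  + by move=> s; exact: (dom_gauss l0d sL symL embed r s t01 cE zp xp yp (e0 j)).
  + by move=> s; exact: (weighted_gauss_lty l0d sL symL embed s (e0 j) zp).
  + by move=> s; exact: (weighted_gauss_lty l0d sL symL embed s (e0 j) xp).
  + by move=> s; exact: (weighted_gauss_lty l0d sL symL embed s (e0 j) yp).
Qed.

End no_gauss.

Section layer_cake.
Context {R : realType} {n d : nat}.
Local Notation M := 'M[R]_(n, d).
Variables (l a : R) (H : M -> \bar R) (rho : M -> R).
Hypotheses (mH : measurable_fun setT H) (H0 : forall X, (0 <= H X)%E).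
Hypotheses (mrho : measurable_fun setT rho) (rho0 : forall X, 0 <= rho X).
Hypotheses (a0 : 0 < a) (HZ : forall c X, 0 < c -> H (c *: X) = ((c `^ (- l))%:E * H X)%E).
Hypothesis rhoZ : forall c X, 0 < c -> rho (c *: X) = c `^ a * rho X.

Let unit_ball (X : M) : R := if rho X <= 1 then 1 else 0.

Lemma measurable_sublevel s : measurable [set X | rho X <= s].
Proof. by rewrite -[X in measurable X]setTI; exact: measurable_fun_le. Qed.

Lemma integral_unit_sublevel : (\int[lebesgue_mx]_X (H X * (unit_ball X)%:E) =
  \int[lebesgue_mx]_(X in [set X | (rho X <= 1)%R]) H X)%E.
Proof.
rewrite [RHS]integral_mkcond; apply: eq_integral => X _.
rewrite patchE /unit_ball; case: ifPn => h.
  by rewrite mem_set ?mule1.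
by rewrite memNset ?mule0// => h'; rewrite h' in h.
Qed.

(* Layer cake: [expR (- rho X)] is the integral of [expR (- s)] over
   [s >= rho X], and [rho X <= s] is a dilation of [rho X <= 1]. *)
Lemma integral_expN_gauge :
  (\int[lebesgue_mx]_X (H X * (expR (- rho X))%:E) =
   (\int[lebesgue_measure]_(s in `]0%R, +oo[) (s `^ (((n * d)%:R - l) / a) * expR (- s))%:E) *
   \int[lebesgue_mx]_(X in [set X | (rho X <= 1)%R]) H X)%E.
Proof.
pose kern (z : R * M) : R := if rho z.2 <= z.1 then expR (- z.1) else 0.
have mkern : measurable_fun setT kern.
  apply: measurable_fun_ifT => //.
    apply: measurable_fun_ler => //; exact: (measurableT_comp mrho).
  by apply: measurable_expRN.
have kern0 z : 0 <= kern z by rewrite /kern; case: ifP => // _; exact: expR_ge0.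
have kernE X : ((expR (- rho X))%:E = \int[lebesgue_measure]_s (kern (s, X))%:E)%E.
  have m1 : measurable_fun setT (EFin \o exponential_pdf (1 : R)).
    by apply/measurable_EFinP; exact: measurable_exponential_pdf.
  have p0 s : (0 <= (EFin \o exponential_pdf (1 : R)) s)%E.
    by rewrite lee_fin exponential_pdf_ge0.
  have := ge0_integral_lebesgue_affine (- rho X) (oner_neq0 R) m1 p0.
  rewrite normr1 invr1 mul1e integral_exponential_pdf// => E1.
  rewrite -[LHS]mule1 -[in LHS]E1 -ge0_integralZl; last 4 first.
  - by [].
  - apply: (measurableT_comp m1); apply: measurable_funD => //; exact: measurable_funM.
  - by move=> s _; exact: p0.
  - by rewrite lee_fin expR_ge0.
  apply: eq_integral => s _; rewrite -EFinM; congr EFin; rewrite /kern/= mul1r.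
  case: leP => sr.
    rewrite exponential_pdfE ?subr_ge0// mul1r -expRD; congr expR.
    by move: (rho X) => x; ring.
  by rewrite lt0_exponential_pdf ?mulr0// subr_lt0.
pose F (z : R * M) : \bar R := (H z.2 * (kern z)%:E)%E.
have mF : measurable_fun setT F.
  by apply: emeasurable_funM; [exact: (measurableT_comp mH)|exact/measurable_EFinP].
have F0 z : (0 <= F z)%E by apply: mule_ge0; rewrite ?lee_fin.
transitivity (\int[lebesgue_mx]_X \int[lebesgue_measure]_s F (s, X))%E.
  apply: eq_integral => X _; rewrite kernE -ge0_integralZl.
  - by [].
  - by [].
  - by apply/measurable_EFinP; exact: (measurableT_comp mkern (measurable_pair2 X)).
  - by move=> s _; rewrite lee_fin.
  - exact: H0.
rewrite -(fubini_tonelli (m1 := lebesgue_measure) (m2 := lebesgue_mx) F mF F0).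
have mJ := measurable_fun_fubini_tonelli_F (m2 := lebesgue_mx) F mF F0.
transitivity (\int[lebesgue_measure]_(s in `[0%R, +oo[) \int[lebesgue_mx]_X F (s, X))%E.
  rewrite [RHS]integral_mkcond; apply: eq_integral => s _; rewrite patchE.
  have [s0|s0] := leP 0 s; first by rewrite mem_set//= in_itv/= s0.
  rewrite memNset/=; last by rewrite in_itv/= andbT leNgt s0.
  rewrite integral0_eq// => X _; rewrite /F /kern/= ifF ?mule0//.
  by apply/negbTE; rewrite -ltNge (lt_le_trans s0).
rewrite -integral_itv_obnd_cbnd; last exact: measurable_funTS.
rewrite -integral_unit_sublevel -ge0_integralZr; last 4 first.
- by [].
- apply/measurable_EFinP; apply: measurable_funTS; apply: measurable_funM.
    exact: measurable_powR.
  by apply: measurable_expRN.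
- by move=> s _; rewrite lee_fin mulr_ge0 ?powR_ge0 ?expR_ge0.
- apply: integral_ge0 => X _; apply: mule_ge0 => //; rewrite lee_fin /unit_ball.
  by case: ifP.
apply: eq_integral => s; rewrite inE/= in_itv/= andbT => s0.
(* Dilation by [c] carries the sublevel set at 1 to the one at [s]. The Jacobian c^(nd) and the
   homogeneity c^(-l) of [H] produce the exponent (nd - l)/a. *)
pose c := s `^ a^-1.
have c0 : 0 < c by rewrite powR_gt0.
have ca : c `^ a = s by rewrite -powRrM mulVf ?gt_eqF// powRr1// ltW.
have mFs : measurable_fun setT (fun X => F (s, X)) by exact: (measurableT_comp mF (measurable_pair1 s)).
have := ge0_integral_lebesgue_mx_scale (lt0r_neq0 c0) mFs (fun X => F0 (s, X)).
rewrite gtr0_norm// => scaleE.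
have E2 : (\int[lebesgue_mx]_X F (s, c *: X)%R =
    (c `^ (- l) * expR (- s))%:E * \int[lebesgue_mx]_X (H X * (unit_ball X)%:E))%E.
  rewrite -ge0_integralZl; last 4 first.
  - by [].
  - apply: emeasurable_funM => //; apply/measurable_EFinP; apply: measurable_fun_ifT => //.
    exact: measurable_fun_ler.
  - by move=> X _; apply: mule_ge0 => //; rewrite lee_fin /unit_ball; case: ifP.
  - by rewrite lee_fin mulr_ge0 ?powR_ge0 ?expR_ge0.
  apply: eq_integral => X _; rewrite /F /kern/= HZ// rhoZ// ca /unit_ball.
  have -> : (s * rho X <= s) = (rho X <= 1) by rewrite -[X in _ <= X]mulr1 ler_pM2l.
  case: ifP => _; last by rewrite !mule0.
  by rewrite mule1 EFinM muleAC.
have cN : (c^-1 ^+ (n * d))%R != 0 by rewrite expf_neq0// invr_eq0 gt_eqF.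
have E3 : (\int[lebesgue_mx]_X F (s, X) =
    (c ^+ (n * d))%:E * \int[lebesgue_mx]_X F (s, c *: X)%R)%E.
  by rewrite scaleE muleA -EFinM -exprMn divff ?gt_eqF// expr1n mul1e.
rewrite E3 E2 muleA -EFinM; congr (_%:E * _)%E.
rewrite mulrA; congr (_ * _).
rewrite -powR_mulrn ?ltW// -powRD; last by apply/implyP => _; rewrite gt_eqF.
by rewrite -powRrM mulrC.
Qed.

Lemma gamma_factor_gt0 k : 0 <= k ->
  (0 < \int[lebesgue_measure]_(s in `]0%R, +oo[) ((s : R) `^ k * expR (- s))%:E)%E.
Proof.
move=> k0.
have mf : measurable_fun setT (fun s : R => (s `^ k * expR (- s))%:E).
  apply/measurable_EFinP; apply: measurable_funM; first exact: measurable_powR.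
  exact: measurable_expRN.
have f0 (s : R) : (0 <= (s `^ k * expR (- s))%:E)%E.
  by rewrite lee_fin mulr_ge0 ?powR_ge0 ?expR_ge0.
have m1 : @lebesgue_measure R `[1, 2]%classic = 1%E.
  by rewrite lebesgue_measure_itv/= lte_fin ltr1n/= -EFinB; congr EFin; ring.
apply: (@lt_le_trans _ _ (\int[lebesgue_measure]_(s in `[1%R, 2%R]) (expR (- 2 : R))%:E)%E).
  by rewrite integral_cst//= m1 mule1 lte_fin expR_gt0.
apply: (@le_trans _ _ (\int[lebesgue_measure]_(s in `[1%R, 2%R]) ((s : R) `^ k * expR (- s))%:E)%E).
  apply: ge0_le_integral => //.
  - exact: measurable_funTS.
  - move=> s /=; rewrite in_itv/= => /andP[s1 s2]; rewrite lee_fin -[leLHS]mul1r.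
    apply: ler_pM; rewrite ?expR_ge0 ?ler_expR ?lerN2//.
    have pow1 : (1 : R) `^ k = 1 by rewrite powR1.
    by rewrite -[leLHS]pow1; apply: ge0_ler_powR => //; rewrite nnegrE ?(le_trans ler01).
apply: ge0_subset_integral => //.
- exact: measurable_funTS.
- by move=> s /=; rewrite !in_itv/= => /andP[s1 _]; rewrite andbT (lt_le_trans ltr01).
Qed.

End layer_cake.

Section uniform_integral.
Context {R : realType} {n d : nat} dO (Omega : measurableType dO).
Variables (P : probability Omega R) (Y : {RV P >-> 'M[R]_(n, d)}).

(** Testing the law on the whole space shows that the volume of [B] is positive and finite:
    otherwise the quotient would be 0 by the conventions of the extended reals. The constant is the
    inverse volume. *)
Lemma uniform_on_integral (B : set 'M[R]_(n, d)) : measurable B -> uniform_on Y B ->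
  exists2 v : R, 0 < v & forall H : 'M[R]_(n, d) -> \bar R,
    measurable_fun setT H -> (forall X, 0 <= H X)%E ->
    (\int[P]_w H (Y w) = v%:E * \int[lebesgue_mx]_(X in B) H X)%E.
Proof.
move=> mB unif.
have := unif setT measurableT; rewrite probability_setT setTI => /esym E1.
have B0 : (0 <= lebesgue_mx B)%E by [].
case BE : (lebesgue_mx B) E1 B0 => [b| |]; last 2 first.
- by rewrite invey mule0 => /eqP; rewrite lt_eqF// lte_fin.
- by [].
rewrite lee_fin le_eqVlt => E1 /predU1P[b0|b0].
  by move: E1; rewrite -b0 mul0e => /eqP; rewrite lt_eqF// lte_fin.
exists b^-1; first by rewrite invr_gt0.
move=> H mH H0; rewrite -[LHS](ge0_integral_distribution Y mH H0).
have ib0 : 0 <= b^-1 by rewrite invr_ge0 ltW.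
rewrite (@eq_measure_integral _ _ _ setT (mscale (NngNum ib0) (mrestr lebesgue_mx mB))); last first.
  move=> A mA _; rewrite /mscale/= unif// BE inver gt_eqF// muleC.
  by [].
rewrite ge0_integral_mscale//; congr (_ * _)%E.
rewrite (@ge0_negligible_integral _ _ _ _ setT (~` B))//; last 2 first.
- exact: measurableC.
- by rewrite -[LHS]/(lebesgue_mx (~` B `&` B)) setICl measure0.
rewrite setTD setCK; apply: eq_measure_integral => A mA AB.
by rewrite -[LHS]/(lebesgue_mx (A `&` B)) setIidl.
Qed.

Lemma expectation_gt0 (f : Omega -> \bar R) : measurable_fun setT f ->
  (forall w, 0 < f w)%E -> (0 < \int[P]_w f w)%E.
Proof.
move=> mf f0; rewrite lt_neqAle integral_ge0 ?andbT; last by move=> w _; exact: ltW.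
apply/negP => /eqP /esym I0.
have : (\int[P]_w `|f w| = 0)%E.
  by rewrite -[RHS]I0; apply: eq_integral => w _; rewrite gee0_abs// ltW.
move=> /(ae_eq_integral_abs P measurableT mf)[A [mA PA0 sub]].
have AT : A = setT.
  apply/seteqP; split => // w _; apply: sub => /= /(_ I) fw.
  by have := f0 w; rewrite fw ltxx.
have := probability_setT P; rewrite -AT -[LHS]/(P A) [LHS]PA0 => /eqP.
by rewrite lt_eqF// lte_fin.
Qed.

End uniform_integral.

(** For finite x and y equality of the two bounds occurs at r = ln x - ln y. If one of them is
    infinite, so is the geometric mean, because the other is positive. *)
Lemma geometric_mean_le (R : realType) (t : R) (x y z : \bar R) : 0 < t < 1 ->
  (0 < x)%E -> (0 < y)%E ->
  (forall r, z <= (t * expR ((t - 1) * r))%:E * x + ((1 - t) * expR (t * r))%:E * y)%E ->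
  (z <= x `^ t * y `^ (1 - t)%R)%E.
Proof.
move=> /andP[t0 t1]; have t1' : 0 < 1 - t by rewrite subr_gt0.
case: x => [x| |] //; case: y => [y| |] //; last 3 first.
- by move=> x0 _ _; rewrite poweRyr ?gt_eqF// gt0_muley ?leey// poweR_gt0.
- by move=> _ y0 _; rewrite poweRyr ?gt_eqF// gt0_mulye ?leey// poweR_gt0.
- by move=> _ _ _; rewrite !poweRyr ?gt_eqF// mulyy leey.
rewrite !lte_fin => x0 y0 /(_ (ln x - ln y)) /le_trans; apply.
rewrite !poweR_EFin -!EFinM -EFinD lee_fin.
have xE : x = expR (ln x) by rewrite lnK.
have yE : y = expR (ln y) by rewrite lnK.
have -> : x `^ t * y `^ (1 - t) = expR (t * ln x + (1 - t) * ln y).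
  by rewrite /powR !gt_eqF// expRD.
have ex : expR ((t - 1) * (ln x - ln y)) * x = expR (t * ln x + (1 - t) * ln y).
  by rewrite {2}xE -expRD; congr expR; move: (ln x) (ln y) => u v; ring.
have ey : expR (t * (ln x - ln y)) * y = expR (t * ln x + (1 - t) * ln y).
  by rewrite {2}yE -expRD; congr expR; move: (ln x) (ln y) => u v; ring.
rewrite -!mulrA ex ey.
by rewrite -mulrDl addrC subrK mul1r.
Qed.

Theorem corollary4p8 (R : realType) (d n : nat) (p l : R)
    (K : set 'rV[R]_d) (N : 'rV[R]_d -> R)
    (dO : measure_display) (Omega : measurableType dO)
    (P : probability Omega R) (Y : {RV P >-> 'M[R]_(n, d)}) :
  0 < p <= 2 ->
  star_body K -> symmetric_set K -> lewis_position p K ->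
  0 < l < d%:R ->
  quasi_norm N -> embeds_in_Lneg l N ->
  uniform_on Y (Bpn n p K) ->
  log_convex_on [set a : 'rV[R]_n | forall i, 0 <= a ord0 i]
    (fun a => (\int[P]_w
       neg_power l (N (\sum_(i < n) Num.sqrt (a ord0 i) *: row i (Y w))%R))%E).
Proof.
move=> p02 sK _ lewis l0d [L [sL symL NE]] [sigma [_ embed]] unif x y t x0 y0 t01.
rewrite NE in embed *; have [p0 _] := andP p02; have [t0 t1] := andP t01.
have t1' : 0 < 1 - t by rewrite subr_gt0.
pose c (a : 'rV[R]_n) i := Num.sqrt (a ord0 i).
pose E a := (\int[P]_w norm_weight l L (c a) (Y w))%E.
rewrite -[leLHS]/(E _) -[X in (_ <= X `^ _ * _)%E]/(E x) -[X in (_ <= _ * X `^ _)%E]/(E y).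
have mw a : measurable_fun setT (@norm_weight R n d l L (c a)) by exact: measurable_norm_weight.
have w0 a X : (0 <= @norm_weight R n d l L (c a) X)%E by exact: norm_weight_ge0.
have Epos a : (0 < E a)%E.
  have mY : measurable_fun setT (fun w => norm_weight l L (c a) (Y w)).
    exact: (measurableT_comp (mw a) (measurable_funPT Y)).
  rewrite /E; refine (@expectation_gt0 _ _ _ P _ mY _).
  by move=> w; apply: neg_power_gt0; exact: minkowski_ge0.
(* When all coefficients vanish the combination is 0, and the convention at the origin makes the
   expectation infinite. *)
have Einf (a : 'rV[R]_n) : (forall i, 0 <= a ord0 i) -> ~ (exists i, 0 < c a i) -> E a = +oo%E.
  move=> a0 na; rewrite /E (_ : (fun w => _) = cst +oo%E).
    rewrite integral_cst// -[RHS]mule1; congr (_ * _)%E; exact: probability_setT.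
  apply/funext => w; rewrite /norm_weight /rowcomb big1 ?minkowski0 ?/neg_power ?eqxx// => i _.
  rewrite (_ : c a i = 0) ?scale0r//; apply/eqP; rewrite eq_le sqrtr_ge0 andbT leNgt.
  by apply/negP => ci; apply: na; exists i.
(* If [x] or [y] is 0 the right side is infinite, the other factor being positive by [Epos]; so both
   have a positive coordinate from here on. *)
have [[ix xp]|nx] := pselect (exists i, 0 < c x i); last first.
  rewrite (Einf x)// poweRyr ?gt_eqF// gt0_mulye ?leey// poweR_gt0//.
have [[iy yp]|ny] := pselect (exists i, 0 < c y i); last first.
  by rewrite (Einf y)// poweRyr ?gt_eqF// gt0_muley ?leey// poweR_gt0.
set z := t *: x + (1 - t) *: y.
have zE i : z ord0 i = t * x ord0 i + (1 - t) * y ord0 i by rewrite !mxE.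
have z0 i : 0 <= z ord0 i by rewrite zE addr_ge0 ?mulr_ge0 ?(ltW t0) ?(ltW t1').
have cE i : c z i ^+ 2 = t * c x i ^+ 2 + (1 - t) * c y i ^+ 2.
  by rewrite !sqr_sqrtr.
(* The coordinate that is positive at [x] stays positive at [z], because t > 0. *)
have zp : 0 < c z ix.
  rewrite sqrtr_gt0 zE ltr_pwDl ?mulr_ge0 ?(ltW t1')// mulr_gt0//.
  by move: xp; rewrite sqrtr_gt0.
have BE : Bpn n p K = [set X | lewis_gauge p K X <= 1] by [].
have mrho := @measurable_lewis_gauge R n d p K sK.
have mB : measurable (Bpn n p K) by rewrite BE; exact: measurable_sublevel.
have [v v0 vE] := uniform_on_integral mB unif.
have n0 : (0 < n)%N by exact: leq_ltn_trans (leq0n ix) (ltn_ord ix).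
(* Since l < d <= nd, the exponent of the gamma factor is nonnegative; hence that factor is positive
   and finite and can be divided out. *)
have nd : 0 <= ((n * d)%:R - l) / p.
  rewrite divr_ge0 ?(ltW p0)// subr_ge0; have [_ /ltW ld] := andP l0d.
  by apply: le_trans ld _; rewrite ler_nat leq_pmull.
set k := ((n * d)%:R - l) / p in nd.
pose g : \bar R := (\int[lebesgue_measure]_(s in `]0%R, +oo[) ((s : R) `^ k * expR (- s))%:E)%E.
have g0 : (0 < g)%E by exact: gamma_factor_gt0.
have glty : (g < +oo)%E by apply: integral_gamma_lty; exact: lt_le_trans (ltrN10 _) nd.
have gfin : g = (fine g)%:E by rewrite fineK// ge0_fin_numE// ltW.
have fg0 : 0 < fine g by rewrite -lte_fin -gfin.
pose A a := weighted lebesgue_mx (norm_weight l L (c a)) (fun X => expR (- lewis_gauge p K X)).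
(* The constant does not depend on [a], so it cancels from the inequality, which is homogeneous of
   degree one in the three integrals. *)
have AE a : A a = ((fine g / v)%:E * E a)%E.
  rewrite /A /E (vE _ (mw a) (w0 a)) /weighted muleA -EFinM divfK ?gt_eqF// -gfin.
  apply: integral_expN_gauge => //.
  - exact: lewis_gauge_ge0.
  - move=> r X r0; rewrite /norm_weight.
    have -> : rowcomb (c a) (r *: X) = r *: rowcomb (c a) X.
      rewrite /rowcomb scaler_sumr; apply: eq_bigr => i _.
      by rewrite linearZ/= !scalerA mulrC.
    by rewrite minkowskiZ ?(ltW r0)// neg_powerM//; exact: minkowski_ge0.
  - by move=> r X r0; rewrite lewis_gaugeZ// ltW.
apply: geometric_mean_le => // r.
have gv : 0 < fine g / v by rewrite divr_gt0.
have : (A z <= (t * expR ((t - 1) * r))%:E * A x + ((1 - t) * expR (t * r))%:E * A y)%E.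
  exact: (dom_expN_gauge l0d sL symL embed r t01 cE zp xp yp sK p02 lewis).
rewrite !AE.
rewrite [X in (_ <= X + _)%E -> _]muleCA [X in (_ <= _ + X)%E -> _]muleCA -ge0_muleDr.
- by rewrite lee_pmul2l// lte_fin.
- by rewrite mule_ge0 ?lee_fin ?mulr_ge0 ?expR_ge0 ?(ltW t0)// ltW.
- by rewrite mule_ge0 ?lee_fin ?mulr_ge0 ?expR_ge0 ?(ltW t1')// ltW.
Qed.
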